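(* Let $\beta_0>\beta_1>\beta_2>\cdots$ be the zeros of $\psi_G$ (the logarithmic derivative of the Barnes $G$ function). Then for all $z\in\mathbb C$, $$\frac{\psi_G(z)}{\Gamma(z)}=e^{\left(2\gamma+\frac12\log 2\pi-\frac12\right)z}\prod_{k=0}^\infty\left(1-\frac{z}{\beta_k}\right)e^{\frac{z}{\beta_k}},$$ where $\gamma$ is the Euler constant and, at the non-positive integers, the left-hand side is understood as the value of the entire extension of $\psi_G/\Gamma$.
   Context: $\Gamma$ is the Euler gamma function and $\psi=\Gamma'/\Gamma$ is the Digamma function. The Barnes $G$ function satisfies $G(z+1)=\Gamma(z)G(z)$ with $G(1)=1$, and its logarithmic derivative is $$\psi_G(z)=\frac{G'(z)}{G(z)}=\frac{\log(2\pi)+1}{2}-z+(z-1)\psi(z)\quad(z\in\mathbb C\setminus\{0,-1,-2,\dots\}).$$ The function $\psi_G$ has first order poles at the non-positive integers; its zeros are real of multiplicity one, and exactly two of them are positive. They are enumerated in decreasing order: $\beta_0=2.55766\dots$, $\beta_1=1.39147\dots$, $\beta_2=-0.3662934\dots$, and so on. *)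

(* Defs.v *)
From Stdlib Require Import Reals Factorial.
From Coquelicot Require Import Coquelicot.

Open Scope R_scope.
Open Scope C_scope.

Definition Cexp (z : C) : C :=
  (exp (Re z) * cos (Im z), exp (Re z) * sin (Im z))%R.

(* The limit of a complex sequence, with an unspecified value when the real or
   the imaginary parts do not converge. *)
Definition Clim_seq (u : nat -> C) : C :=
  (real (Lim_seq (fun n => Re (u n))), real (Lim_seq (fun n => Im (u n)))).

(* u 0 * u 1 * ... * u (n - 1) *)
Fixpoint Cprod (u : nat -> C) (n : nat) : C :=
  match n with
  | O => 1
  | S m => Cprod u m * u m
  end.

(* The usual convergence of an infinite product: once the first N factors are
   set aside, the partial products have a nonzero limit.  In particular the
   partial products of u converge to p, and p = 0 only if some factor is 0. *)
Definition is_infprod (u : nat -> C) (p : C) : Prop :=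
  exists (N : nat) (q : C),
    q <> 0 /\
    filterlim (Cprod (fun k => u (N + k)%nat)) eventually (locally q) /\
    p = Cprod u N * q.

Definition euler_const : R :=
  real (Lim_seq (fun n => sum_n_m (fun k => / INR k)%R 1 n - ln (INR n))%R).

Definition nonpos_integer (z : C) : Prop := exists n : nat, z = - INR n.

(* Euler's limit n! n^z / (z (z + 1) ... (z + n)); it has no meaning at the
   non-positive integers. *)
Definition Gamma (z : C) : C :=
  Clim_seq (fun n =>
    INR (fact n) * Cexp (z * ln (INR n)) / Cprod (fun k => z + INR k) (S n)).

(* The Weierstrass product of the Barnes function,
     G(1 + w) = (2 pi)^(w/2) exp(- (w + (1 + gamma) w^2) / 2)
                * prod_(k >= 1) (1 + w/k)^k exp(w^2 / (2 k) - w),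
   valid on the whole plane; below, the k-th factor has index k - 1. *)
Definition BarnesG (z : C) : C :=
  let w := z - 1 in
  Cexp (w / 2 * ln (2 * PI)%R)
  * Cexp (- (w + (1 + euler_const) * w ^ 2) / 2)
  * Clim_seq (Cprod (fun k =>
      (1 + w / INR (S k)) ^ S k * Cexp (w ^ 2 / (2 * INR (S k)) - w))).

(* [C_derive] is the limit of difference quotients along real increments, which
   is the complex derivative wherever the latter exists; BarnesG is entire. *)
Definition psi_G (z : C) : C := C_derive BarnesG z / BarnesG z.

(* Division by 0 is total, so the poles of psi_G have to be excluded. *)
Definition zero_of_psi_G (z : C) : Prop :=
  ~ nonpos_integer z /\ psi_G z = 0.

Definition entire (f : C -> C) : Prop :=
  forall z : C, @ex_derive C_AbsRing C_NormedModule f z.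

(* Main.v *)
(* The function psi_G / Gamma is the limit of n^(-z) P_n(z), where P_n is the polynomial of degree
   n + 2 obtained by truncating psi and Euler's limit for Gamma after n + 1 terms.  Rolle's theorem
   gives one zero of P_n in each interval (-k - 1, -k), k < n, and the signs at 1, 2, 4 give one in
   (1, 2) and one in (2, 4), so P_n is the product of the factors 1 - z / r over these zeros r.  As
   n grows, each zero converges (the truncations have secant slopes bounded away from 0 near their
   zeros), the zero with index k is at least of order k uniformly in n, and the factors converge in
   the sense of Tannery.  The constant in the exponent is the limit of the logarithmic derivative
   of n^(-z) P_n(z) at 0.  This yields the product over the limits of the zeros, which are therefore
   exactly the zeros of psi_G and must be the given enumeration. *)
Require Import Defs.
From Stdlib Require Import Reals Lra Lia Arith ClassicalEpsilon.
From Coquelicot Require Import Coquelicot.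

Open Scope R_scope.
Open Scope C_scope.

(** * Convergence of complex sequences *)

(** A polynomial is determined by its zeros and its value at 0, so the P_n stand in for Hadamard's
    factorization theorem and for any growth estimate of psi_G / Gamma; since n + 2 real zeros are
    found, the degree excludes all others. The sum of the 1 / r is never estimated: it is minus the
    derivative of P_n at 0, where P_n = 1. Hence the exponential left over when genus-one factors
    are formed is explicit, with rate kappa + 2 (H_n - ln n), kappa = (ln (2 pi) - 1) / 2. The
    delicate point is the limit of the zeros. The identity with psi_G / Gamma says nothing at the
    poles, so the limits must be kept away from the non-positive integers, and apart from each
    other, before they can be called zeros of psi_G. Numerical input is confined to psi_G(1) = kappa
    > 0, psi_G(2) = kappa - gamma < 0 and psi_G(4) = kappa + 5/2 - 3 gamma > 0, and to kappa < 1. As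
    [psi_G] is defined through the product for G, its expression by partial fractions is itself
    derived, by differentiating that product without logarithms. *)

Definition Ccv (u : nat -> C) (l : C) : Prop :=
  is_lim_seq (fun n => Cmod (u n - l)) 0%R.

Lemma im_le_Cmod (z : C) : (Rabs (Im z) <= Cmod z)%R.
Proof. apply Rle_trans with (2 := Rmax_Cmod z); apply Rmax_r. Qed.

Lemma Cmod_triangle_rev (a b : C) : (Cmod a - Cmod b <= Cmod (a - b))%R.
Proof.
  assert (H := Cmod_triangle (a - b) b); replace (a - b + b) with a in H by ring; lra.
Qed.

Lemma Cmod_sub_le (a b : C) : (Cmod (a - b) <= Cmod a + Cmod b)%R.
Proof. rewrite <- (Cmod_opp b); apply Cmod_triangle. Qed.

Lemma Cmod_sub_sym (a b : C) : Cmod (a - b) = Cmod (b - a).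
Proof. rewrite <- Cmod_opp; f_equal; ring. Qed.

Lemma Ccv_squeeze (u : nat -> C) (l : C) (v : nat -> R) :
  eventually (fun n => Cmod (u n - l) <= v n)%R -> is_lim_seq v 0%R -> Ccv u l.
Proof.
  intros H Hv; unfold Ccv.
  apply is_lim_seq_le_le_loc with (u := fun _ => 0%R) (w := v); auto.
  - destruct H as [N H]; exists N; intros n Hn; split; auto; apply Cmod_ge_0.
  - apply is_lim_seq_const.
Qed.

Lemma Ccv_eps (u : nat -> C) (l : C) :
  Ccv u l <-> (forall eps : posreal, eventually (fun n => Cmod (u n - l) < eps)%R).
Proof.
  split.
  - intros H eps; apply is_lim_seq_spec in H; destruct (H eps) as [N HN].
    exists N; intros n Hn; specialize (HN n Hn).
    rewrite Rminus_0_r, Rabs_pos_eq in HN; auto; apply Cmod_ge_0.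
  - intros H; apply is_lim_seq_spec; intros eps; destruct (H eps) as [N HN].
    exists N; intros n Hn; rewrite Rminus_0_r, Rabs_pos_eq; auto; apply Cmod_ge_0.
Qed.

Lemma Ccv_filterlim (u : nat -> C) (l : C) :
  Ccv u l <-> filterlim u eventually (locally l).
Proof.
  rewrite Ccv_eps; split.
  - intros H P [eps HP]; destruct (H eps) as [N HN]; exists N; intros n Hn.
    apply HP; apply C_NormedModule_mixin_compat1; apply HN; auto.
  - intros H eps.
    (* The balls of [C] are those of the product uniform structure; going back from a ball to the
       modulus costs a factor sqrt 2. *)
    assert (He : (0 < eps / sqrt 2)%R)
      by (apply Rdiv_lt_0_compat; [apply cond_pos | apply sqrt_lt_R0; lra]).
    destruct (H (ball l (mkposreal _ He)) (locally_ball l _)) as [N HN].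
    exists N; intros n Hn; specialize (HN n Hn).
    apply C_NormedModule_mixin_compat2 in HN; simpl in HN.
    replace (sqrt 2 * (eps / sqrt 2))%R with (pos eps) in HN; auto.
    field; apply Rgt_not_eq; apply sqrt_lt_R0; lra.
Qed.

Lemma Ccv_Re (u : nat -> C) (l : C) : Ccv u l -> is_lim_seq (fun n => Re (u n)) (Re l).
Proof.
  rewrite Ccv_eps; intros H; apply is_lim_seq_spec; intros eps.
  destruct (H eps) as [N HN]; exists N; intros n Hn.
  apply Rle_lt_trans with (2 := HN n Hn).
  replace (Re (u n) - Re l)%R with (Re (u n - l)); [apply re_le_Cmod|].
  unfold Cminus; rewrite re_plus, re_opp; ring.
Qed.

Lemma Ccv_Im (u : nat -> C) (l : C) : Ccv u l -> is_lim_seq (fun n => Im (u n)) (Im l).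
Proof.
  rewrite Ccv_eps; intros H; apply is_lim_seq_spec; intros eps.
  destruct (H eps) as [N HN]; exists N; intros n Hn.
  apply Rle_lt_trans with (2 := HN n Hn).
  replace (Im (u n) - Im l)%R with (Im (u n - l)); [apply im_le_Cmod|].
  unfold Cminus; rewrite im_plus, im_opp; ring.
Qed.

Lemma Ccv_Clim_seq (u : nat -> C) (l : C) : Ccv u l -> Clim_seq u = l.
Proof.
  intros H; unfold Clim_seq.
  rewrite (is_lim_seq_unique _ _ (Ccv_Re _ _ H)), (is_lim_seq_unique _ _ (Ccv_Im _ _ H)).
  destruct l; reflexivity.
Qed.

Lemma Ccv_unique (u : nat -> C) (l m : C) : Ccv u l -> Ccv u m -> l = m.
Proof.
  intros Hl Hm; rewrite <- (Ccv_Clim_seq _ _ Hl); apply Ccv_Clim_seq, Hm.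
Qed.

Lemma Ccv_ext_loc (u v : nat -> C) (l : C) :
  eventually (fun n => u n = v n) -> Ccv u l -> Ccv v l.
Proof.
  intros [N HN]; apply is_lim_seq_ext_loc; exists N; intros n Hn; rewrite HN; auto.
Qed.

Lemma Ccv_ext (u v : nat -> C) (l : C) : (forall n, u n = v n) -> Ccv u l -> Ccv v l.
Proof. intros H; apply Ccv_ext_loc; exists 0%nat; auto. Qed.

Lemma Ccv_const (c : C) : Ccv (fun _ => c) c.
Proof.
  apply Ccv_squeeze with (v := fun _ => 0%R); [|apply is_lim_seq_const].
  exists 0%nat; intros n _; replace (c - c) with (RtoC 0) by ring; rewrite Cmod_0; lra.
Qed.

Lemma is_lim_seq_plus0 (u v : nat -> R) :
  is_lim_seq u 0%R -> is_lim_seq v 0%R -> is_lim_seq (fun n => u n + v n)%R 0%R.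
Proof.
  intros Hu Hv; replace 0%R with (0 + 0)%R by ring; apply is_lim_seq_plus'; auto.
Qed.

Lemma is_lim_seq_scal0 (a : R) (u : nat -> R) :
  is_lim_seq u 0%R -> is_lim_seq (fun n => a * u n)%R 0%R.
Proof.
  intros Hu; replace (Finite 0) with (Rbar_mult a 0%R)
    by (simpl; f_equal; ring).
  apply is_lim_seq_scal_l, Hu.
Qed.

Lemma Ccv_plus (u v : nat -> C) (l m : C) :
  Ccv u l -> Ccv v m -> Ccv (fun n => u n + v n) (l + m).
Proof.
  intros Hu Hv; eapply Ccv_squeeze; [|apply (is_lim_seq_plus0 _ _ Hu Hv)].
  exists 0%nat; intros n _.
  replace (u n + v n - (l + m)) with ((u n - l) + (v n - m)) by ring.
  apply Cmod_triangle.
Qed.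

Lemma Ccv_mult (u v : nat -> C) (l m : C) :
  Ccv u l -> Ccv v m -> Ccv (fun n => u n * v n) (l * m).
Proof.
  intros Hu Hv; eapply Ccv_squeeze.
  2:{ apply (is_lim_seq_plus0 (fun n => (Cmod (u n - l) * (Cmod (v n - m) + Cmod m))%R)
        (fun n => (Cmod l * Cmod (v n - m))%R)); [|apply is_lim_seq_scal0, Hv].
      replace 0%R with (0 * (0 + Cmod m))%R by ring.
      apply is_lim_seq_mult'; auto; apply is_lim_seq_plus'; auto.
      apply is_lim_seq_const. }
  exists 0%nat; intros n _; cbv beta.
  replace (u n * v n - l * m) with ((u n - l) * ((v n - m) + m) + l * (v n - m)) by ring.
  eapply Rle_trans; [apply Cmod_triangle|]; rewrite 2 Cmod_mult.
  apply Rplus_le_compat_r, Rmult_le_compat_l; [apply Cmod_ge_0 | apply Cmod_triangle].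
Qed.

Lemma Ccv_scal (c : C) (u : nat -> C) (l : C) : Ccv u l -> Ccv (fun n => c * u n) (c * l).
Proof. intros H; apply Ccv_mult; auto; apply Ccv_const. Qed.

Lemma Ccv_minus (u v : nat -> C) (l m : C) :
  Ccv u l -> Ccv v m -> Ccv (fun n => u n - v n) (l - m).
Proof.
  intros Hu Hv; replace (l - m) with (l + -(1) * m) by ring.
  apply Ccv_ext with (fun n => u n + -(1) * v n); [intros; ring|].
  apply Ccv_plus; auto; apply Ccv_scal; auto.
Qed.

Lemma Ccv_inv (u : nat -> C) (l : C) : l <> 0 -> Ccv u l -> Ccv (fun n => / u n) (/ l).
Proof.
  intros Hl H; assert (Hl' := proj1 (Cmod_gt_0 l) Hl).
  apply Ccv_squeeze with (v := fun n => (2 / (Cmod l * Cmod l) * Cmod (u n - l))%R);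
    [|apply is_lim_seq_scal0, H].
  assert (He : (0 < Cmod l / 2)%R) by lra.
  destruct (proj1 (Ccv_eps _ _) H (mkposreal _ He)) as [N HN]; simpl in HN.
  exists N; intros n Hn; specialize (HN n Hn).
  assert (Hu : (Cmod l / 2 < Cmod (u n))%R).
  { assert (T := Cmod_triangle_rev l (l - u n)).
    replace (l - (l - u n)) with (u n) in T by ring.
    rewrite Cmod_sub_sym in HN; lra. }
  assert (Hu0 : u n <> 0) by (apply Cmod_gt_0; lra).
  replace (/ u n - / l) with ((l - u n) / (u n * l)) by (field; auto).
  rewrite Cmod_div, Cmod_mult, Cmod_sub_sym by (apply Cmult_neq_0; auto).
  unfold Rdiv; rewrite Rmult_comm; apply Rmult_le_compat_r; [apply Cmod_ge_0|].
  replace (2 * / (Cmod l * Cmod l))%R with (/ (Cmod l / 2 * Cmod l))%R by (field; lra).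
  apply Rinv_le_contravar; [|apply Rmult_le_compat_r; lra].
  apply Rmult_lt_0_compat; lra.
Qed.

Lemma Ccv_RtoC (u : nat -> R) (l : R) : is_lim_seq u l -> Ccv (fun n => RtoC (u n)) l.
Proof.
  intros H; apply Ccv_eps; intros eps; apply is_lim_seq_spec in H.
  destruct (H eps) as [N HN]; exists N; intros n Hn.
  rewrite <- RtoC_minus, Cmod_R; apply HN; auto.
Qed.

(** * The complex exponential *)

Lemma Cexp_plus (a b : C) : Cexp (a + b) = Cexp a * Cexp b.
Proof.
  unfold Cexp; rewrite re_plus, im_plus, exp_plus, cos_plus, sin_plus.
  unfold Cmult; simpl; f_equal; ring.
Qed.

Lemma Cexp_RtoC (x : R) : Cexp x = exp x.
Proof.
  unfold Cexp; rewrite re_RtoC, im_RtoC, cos_0, sin_0.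
  unfold RtoC; f_equal; ring.
Qed.

Lemma Cexp_0 : Cexp 0 = 1.
Proof. rewrite Cexp_RtoC, exp_0; reflexivity. Qed.

Lemma Cexp_neq_0 (z : C) : Cexp z <> 0.
Proof.
  intros H; apply C1_nz; rewrite <- Cexp_0.
  replace (RtoC 0) with (z + - z) by ring; rewrite Cexp_plus, H; ring.
Qed.

Lemma Cexp_opp (z : C) : Cexp (- z) = / Cexp z.
Proof.
  assert (H : Cexp (- z) * Cexp z = 1).
  { rewrite <- Cexp_plus; replace (- z + z) with (RtoC 0) by ring; apply Cexp_0. }
  replace (Cexp (- z)) with (Cexp (- z) * Cexp z * / Cexp z) by (field; apply Cexp_neq_0).
  rewrite H; ring.
Qed.

Lemma Cexp_INR (n : nat) (z : C) : Cexp (INR n * z) = Cexp z ^ n.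
Proof.
  induction n as [|n IH].
  - simpl; replace (0 * z) with (RtoC 0) by ring; apply Cexp_0.
  - rewrite S_INR, RtoC_plus, Cpow_S, <- IH, <- Cexp_plus; f_equal; ring.
Qed.

Lemma Cmod_Cexp (z : C) : Cmod (Cexp z) = exp (Re z).
Proof.
  unfold Cmod, Cexp; simpl.
  replace (_ + _)%R with (exp (Re z) * exp (Re z) * (Rsqr (sin (Im z)) + Rsqr (cos (Im z))))%R
    by (unfold Rsqr; ring).
  rewrite sin2_cos2, Rmult_1_r; apply sqrt_square; left; apply exp_pos.
Qed.

Lemma Cmod_Cexp_le (z : C) : (Cmod (Cexp z) <= exp (Cmod z))%R.
Proof.
  rewrite Cmod_Cexp.
  assert (H : (Re z <= Cmod z)%R)
    by (apply Rle_trans with (2 := re_le_Cmod z); apply Rle_abs).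
  destruct (Rle_lt_or_eq_dec _ _ H) as [H'|H'].
  - left; apply exp_increasing; auto.
  - rewrite H'; lra.
Qed.

(** * Remainder estimates for the exponential, by a mean value inequality on segments *)

Definition curve_derive (f : R -> C) (t : R) (l : C) : Prop :=
  is_derive (fun s => Re (f s)) t (Re l) /\ is_derive (fun s => Im (f s)) t (Im l).

(* The mean value theorem is applied to the component along f b - f a. *)
Lemma curve_MVT (f df : R -> C) (D : R) :
  (forall t, 0 <= t <= 1 -> curve_derive f t (df t) /\ Cmod (df t) <= D)%R ->
  (Cmod (f 1%R - f 0%R) <= D)%R.
Proof.
  intros H; set (v := f 1%R - f 0%R).
  assert (Hd : forall t, (0 <= t <= 1)%R ->
    is_derive (fun t => Re v * Re (f t) + Im v * Im (f t))%R t
      (Re v * Re (df t) + Im v * Im (df t))%R).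
  { intros t Ht; destruct (H t Ht) as [[H1 H2] _].
    apply (is_derive_plus (fun t => Re v * Re (f t))%R (fun t => Im v * Im (f t))%R);
      apply is_derive_scal; assumption. }
  destruct (MVT_gen (fun t => Re v * Re (f t) + Im v * Im (f t))%R 0 1
    (fun t => Re v * Re (df t) + Im v * Im (df t))%R) as [t [Ht E]].
  - intros t; rewrite Rmin_left, Rmax_right by lra; intros Ht; apply Hd; lra.
  - intros t; rewrite Rmin_left, Rmax_right by lra; intros Ht.
    apply derivable_continuous_pt; exists (Re v * Re (df t) + Im v * Im (df t))%R.
    apply is_derive_Reals, Hd, Ht.
  - rewrite Rmin_left, Rmax_right in Ht by lra; destruct (H t Ht) as [_ HD].
    replace (Re v * Re (f 1%R) + Im v * Im (f 1%R) - (Re v * Re (f 0%R) + Im v * Im (f 0%R)))%R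
      with (Cmod v ^ 2)%R in E.
    2:{ assert (H1 : Re v = (Re (f 1%R) - Re (f 0%R))%R)
          by (unfold v, Cminus; rewrite re_plus, re_opp; ring).
        assert (H2 : Im v = (Im (f 1%R) - Im (f 0%R))%R)
          by (unfold v, Cminus; rewrite im_plus, im_opp; ring).
        rewrite Cmod2_alt, H1, H2; ring. }
    assert (CS : (Re v * Re (df t) + Im v * Im (df t) <= Cmod v * Cmod (df t))%R).
    { replace (Re v * Re (df t) + Im v * Im (df t))%R with (Re (v * Cconj (df t)))
        by (rewrite re_mult, re_conj, im_conj; ring).
      rewrite <- (Cmod_conj (df t)), <- Cmod_mult.
      apply Rle_trans with (2 := re_le_Cmod _); apply Rle_abs. }
    assert (Hv := Cmod_ge_0 v).
    destruct Hv as [Hv|Hv]; [|rewrite <- Hv; apply Rle_trans with (2 := HD); apply Cmod_ge_0].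
    apply Rmult_le_reg_l with (Cmod v); auto.
    apply Rle_trans with (Cmod v * Cmod (df t))%R; [nra|].
    apply Rmult_le_compat_l; lra.
Qed.

Lemma curve_derive_Cexp (w : C) (t : R) :
  curve_derive (fun s => Cexp (s * w)) t (w * Cexp (t * w)).
Proof.
  unfold Cexp; split;
    [apply is_derive_ext with (fun s => exp (s * Re w) * cos (s * Im w))%R
    |apply is_derive_ext with (fun s => exp (s * Re w) * sin (s * Im w))%R];
    try (intros s; rewrite re_scal_l, im_scal_l; reflexivity);
    rewrite re_scal_l, im_scal_l, ?re_mult, ?im_mult; cbn [Re Im fst snd];
    auto_derive; auto; unfold Re, Im; simpl; ring.
Qed.

Lemma curve_derive_minus (f g : R -> C) (t : R) (l m : C) :
  curve_derive f t l -> curve_derive g t m -> curve_derive (fun s => f s - g s) t (l - m).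
Proof.
  intros [f1 f2] [g1 g2]; split; unfold Cminus; rewrite ?re_plus, ?im_plus, ?re_opp, ?im_opp.
  - apply is_derive_ext with (fun s => Re (f s) - Re (g s))%R.
    + intros s; rewrite re_plus, re_opp; reflexivity.
    + apply (is_derive_minus (fun s => Re (f s)) (fun s => Re (g s))); auto.
  - apply is_derive_ext with (fun s => Im (f s) - Im (g s))%R.
    + intros s; rewrite im_plus, im_opp; reflexivity.
    + apply (is_derive_minus (fun s => Im (f s)) (fun s => Im (g s))); auto.
Qed.

Lemma curve_derive_scal (p : R -> R) (t dp : R) (w : C) :
  is_derive p t dp -> curve_derive (fun s => p s * w) t (dp * w).
Proof.
  intros H; split.
  - apply is_derive_ext with (fun s => Re w * p s)%R.
    + intros s; rewrite re_scal_l; apply Rmult_comm.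
    + rewrite re_scal_l, Rmult_comm; apply is_derive_scal, H.
  - apply is_derive_ext with (fun s => Im w * p s)%R.
    + intros s; rewrite im_scal_l; apply Rmult_comm.
    + rewrite im_scal_l, Rmult_comm; apply is_derive_scal, H.
Qed.

Lemma curve_derive_lin (w : C) (t : R) : curve_derive (fun s => s * w) t w.
Proof.
  assert (H := curve_derive_scal (fun s => s) t 1 w (is_derive_id (K := R_AbsRing) t)).
  rewrite Cmult_1_l in H; exact H.
Qed.

Lemma exp_le (x y : R) : (x <= y -> exp x <= exp y)%R.
Proof. intros [H|H]; [left; apply exp_increasing; auto | subst; lra]. Qed.

Lemma Cmod_unit_scal (t : R) (w : C) : (0 <= t <= 1 -> Cmod (t * w) <= Cmod w)%R.
Proof.
  intros H; rewrite Cmod_mult, Cmod_R, Rabs_pos_eq by lra.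
  assert (Hw := Cmod_ge_0 w); nra.
Qed.

(** In this and the next two estimates, the derivative along t -> t w of a remainder is w times the
    preceding remainder, so the mean value inequality raises the order by one. The factorials are
    given up, as the constants do not matter. *)
Lemma Cexp_taylor1 (w : C) : (Cmod (Cexp w - 1) <= Cmod w * exp (Cmod w))%R.
Proof.
  assert (H := curve_MVT (fun t => Cexp (t * w)) (fun t => w * Cexp (t * w))
    (Cmod w * exp (Cmod w))%R).
  cbv beta in H; rewrite Cmult_1_l, Cmult_0_l, Cexp_0 in H; apply H; clear H.
  intros t Ht; split; [apply curve_derive_Cexp|].
  rewrite Cmod_mult; apply Rmult_le_compat_l; [apply Cmod_ge_0|].
  apply Rle_trans with (1 := Cmod_Cexp_le _); apply exp_le, Cmod_unit_scal, Ht.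
Qed.

Lemma Cexp_taylor2 (w : C) : (Cmod (Cexp w - 1 - w) <= Cmod w ^ 2 * exp (Cmod w))%R.
Proof.
  assert (H := curve_MVT (fun t => Cexp (t * w) - t * w)
    (fun t => w * Cexp (t * w) - w) (Cmod w ^ 2 * exp (Cmod w))%R).
  cbv beta in H; rewrite Cmult_1_l, Cmult_0_l, Cexp_0 in H.
  replace (Cexp w - w - (1 - 0)) with (Cexp w - 1 - w) in H by ring.
  apply H; clear H; intros t Ht; split.
  - apply curve_derive_minus; [apply curve_derive_Cexp | apply curve_derive_lin].
  - replace (w * Cexp (t * w) - w) with (w * (Cexp (t * w) - 1)) by ring.
    rewrite Cmod_mult; simpl; rewrite Rmult_1_r, Rmult_assoc.
    apply Rmult_le_compat_l; [apply Cmod_ge_0|].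
    apply Rle_trans with (1 := Cexp_taylor1 _).
    assert (T := Cmod_unit_scal t w Ht).
    apply Rmult_le_compat; auto; [apply Cmod_ge_0|left; apply exp_pos|apply exp_le; auto].
Qed.

Lemma Cexp_taylor3 (w : C) :
  (Cmod (Cexp w - 1 - w - w ^ 2 / 2) <= Cmod w ^ 3 * exp (Cmod w))%R.
Proof.
  assert (H := curve_MVT (fun t => Cexp (t * w) - t * w - (t * t / 2)%R * w ^ 2)
    (fun t => w * Cexp (t * w) - w - t * w ^ 2) (Cmod w ^ 3 * exp (Cmod w))%R).
  cbv beta in H; rewrite Cmult_1_l, Cmult_0_l, Cexp_0 in H.
  replace (Cexp w - w - (1 * 1 / 2)%R * w ^ 2 - (1 - 0 - (0 * 0 / 2)%R * w ^ 2))
    with (Cexp w - 1 - w - w ^ 2 / 2) in H.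
  2:{ rewrite 2 RtoC_div, 2 RtoC_mult by lra; field. }
  apply H; clear H; intros t Ht; split.
  - apply curve_derive_minus; [apply curve_derive_minus|].
    + apply curve_derive_Cexp.
    + apply curve_derive_lin.
    + apply (curve_derive_scal (fun s => (s * s / 2)%R)); auto_derive; auto; field.
  - replace (w * Cexp (t * w) - w - t * w ^ 2) with (w * (Cexp (t * w) - 1 - t * w))
      by ring.
    rewrite Cmod_mult.
    replace (Cmod w ^ 3 * exp (Cmod w))%R with (Cmod w * (Cmod w ^ 2 * exp (Cmod w)))%R by ring.
    apply Rmult_le_compat_l; [apply Cmod_ge_0|].
    apply Rle_trans with (1 := Cexp_taylor2 _).
    assert (T := Cmod_unit_scal t w Ht).
    apply Rmult_le_compat; [apply pow_le, Cmod_ge_0|left; apply exp_pos| |apply exp_le; auto].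
    apply pow_incr; split; auto; apply Cmod_ge_0.
Qed.

Lemma Ccv_Cexp (u : nat -> C) (l : C) : Ccv u l -> Ccv (fun n => Cexp (u n)) (Cexp l).
Proof.
  intros H; eapply Ccv_squeeze.
  2:{ apply (is_lim_seq_scal0 (Cmod (Cexp l))).
      replace 0%R with (0 * exp 0)%R by ring.
      apply (is_lim_seq_mult' (fun n => Cmod (u n - l)) (fun n => exp (Cmod (u n - l))));
        auto.
      apply is_lim_seq_continuous; auto.
      apply derivable_continuous_pt, derivable_pt_exp. }
  exists 0%nat; intros n _; cbv beta.
  replace (Cexp (u n) - Cexp l) with (Cexp l * (Cexp (u n - l) - 1)).
  - rewrite Cmod_mult; apply Rmult_le_compat_l; [apply Cmod_ge_0 | apply Cexp_taylor1].
  - replace (Cexp (u n)) with (Cexp (l + (u n - l))) by (f_equal; ring).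
    rewrite Cexp_plus; ring.
Qed.

(** * Infinite products *)

Fixpoint Rsum (u : nat -> R) (n : nat) : R :=
  match n with
  | O => 0
  | S m => Rsum u m + u m
  end.

Fixpoint Csum (u : nat -> C) (n : nat) : C :=
  match n with
  | O => 0
  | S m => Csum u m + u m
  end.

Lemma Rsum_le (u v : nat -> R) (n : nat) :
  (forall k, (k < n)%nat -> u k <= v k)%R -> (Rsum u n <= Rsum v n)%R.
Proof.
  induction n as [|n IH]; intros H; simpl; [lra|].
  apply Rplus_le_compat; [apply IH; intros; apply H; lia | apply H; lia].
Qed.

Lemma Rsum_ge0 (u : nat -> R) (n : nat) : (forall k, 0 <= u k)%R -> (0 <= Rsum u n)%R.
Proof. intros H; induction n; simpl; [lra | specialize (H n); lra]. Qed.

Lemma Rsum_scal (a : R) (u : nat -> R) (n : nat) :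
  Rsum (fun k => a * u k)%R n = (a * Rsum u n)%R.
Proof. induction n as [|n IH]; simpl; [ring | rewrite IH; ring]. Qed.

Lemma Rsum_sum_n (u : nat -> R) (n : nat) : Rsum u (S n) = sum_n u n.
Proof.
  induction n as [|n IH]; [simpl; rewrite sum_O; ring|].
  rewrite sum_Sn, <- IH; reflexivity.
Qed.

Lemma Csum_scal (a : C) (u : nat -> C) (n : nat) :
  Csum (fun k => a * u k) n = a * Csum u n.
Proof. induction n as [|n IH]; simpl; [ring | rewrite IH; ring]. Qed.

Lemma Csum_minus (u v : nat -> C) (n : nat) :
  Csum (fun k => u k - v k) n = Csum u n - Csum v n.
Proof. induction n as [|n IH]; simpl; [ring | rewrite IH; ring]. Qed.

Lemma Csum_ext (u v : nat -> C) (n : nat) :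
  (forall k, (k < n)%nat -> u k = v k) -> Csum u n = Csum v n.
Proof.
  induction n as [|n IH]; intros H; simpl; auto.
  rewrite IH, H; auto.
Qed.

Lemma Cmod_Csum (u : nat -> C) (n : nat) :
  (Cmod (Csum u n) <= Rsum (fun k => Cmod (u k)) n)%R.
Proof.
  induction n as [|n IH]; simpl; [rewrite Cmod_0; lra|].
  assert (H := Cmod_triangle (Csum u n) (u n)); lra.
Qed.

Lemma Cprod_ext (u v : nat -> C) (n : nat) :
  (forall k, (k < n)%nat -> u k = v k) -> Cprod u n = Cprod v n.
Proof.
  induction n as [|n IH]; intros H; simpl; auto.
  rewrite IH, H; auto.
Qed.

Lemma Cprod_split (u : nat -> C) (N n : nat) :
  Cprod u (N + n) = Cprod u N * Cprod (fun k => u (N + k)%nat) n.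
Proof.
  induction n as [|n IH]; [rewrite Nat.add_0_r; simpl; ring|].
  rewrite Nat.add_succ_r; simpl; rewrite IH; ring.
Qed.

Lemma Cprod_mult (u v : nat -> C) (n : nat) :
  Cprod (fun k => u k * v k) n = Cprod u n * Cprod v n.
Proof. induction n as [|n IH]; simpl; [ring | rewrite IH; ring]. Qed.

Lemma Cprod_Cexp (u : nat -> C) (n : nat) :
  Cprod (fun k => Cexp (u k)) n = Cexp (Csum u n).
Proof. induction n as [|n IH]; simpl; [rewrite Cexp_0; auto | rewrite IH, Cexp_plus; auto]. Qed.

Lemma Cprod_neq_0 (u : nat -> C) (n : nat) :
  (forall k, (k < n)%nat -> u k <> 0) -> Cprod u n <> 0.
Proof.
  induction n as [|n IH]; intros H; simpl; [apply C1_nz|].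
  apply Cmult_neq_0; [apply IH; intros; apply H; lia | apply H; lia].
Qed.

Lemma Cmult_integral (a b : C) : a * b = 0 -> a = 0 \/ b = 0.
Proof.
  intros H; destruct (Ceq_dec a 0) as [Ha|Ha]; [left; auto|right].
  destruct (Ceq_dec b 0) as [Hb|Hb]; auto; destruct (Cmult_neq_0 a b Ha Hb H).
Qed.

Lemma Cprod_eq_0_inv (u : nat -> C) (n : nat) : Cprod u n = 0 -> exists k, u k = 0.
Proof.
  induction n as [|n IH]; simpl; intros H; [destruct (C1_nz H)|].
  destruct (Cmult_integral _ _ H); [auto | exists n; auto].
Qed.

Lemma Cprod_eq_0 (u : nat -> C) (k n : nat) : (k < n)%nat -> u k = 0 -> Cprod u n = 0.
Proof.
  intros H E; induction H as [|n H IH]; simpl; [rewrite E; ring | rewrite IH; ring].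
Qed.

(** Once the product is expanded in the u k - 1, every term is dominated by the corresponding term
    of the exponential. This makes tails of products small without complex logarithms. *)
Lemma Cmod_Cprod_sub1 (u : nat -> C) (n : nat) :
  (Cmod (Cprod u n - 1) <= exp (Rsum (fun k => Cmod (u k - 1)) n) - 1)%R.
Proof.
  induction n as [|n IH]; simpl.
  - replace (1 - 1) with (RtoC 0) by ring; rewrite Cmod_0, exp_0; lra.
  - set (s := Rsum _ n) in *; set (P := Cprod u n) in *; set (t := Cmod (u n - 1)).
    replace (P * u n - 1) with ((P - 1) + ((P - 1) * (u n - 1) + (u n - 1))) by ring.
    assert (H1 := Cmod_triangle (P - 1) ((P - 1) * (u n - 1) + (u n - 1))).
    assert (H2 := Cmod_triangle ((P - 1) * (u n - 1)) (u n - 1)).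
    rewrite Cmod_mult in H2; fold t in H2; rewrite exp_plus.
    assert (Ht : (0 <= t)%R) by apply Cmod_ge_0.
    assert (He := exp_ineq1_le t); assert (Hs := exp_pos s); nra.
Qed.

(** The terms of degree at least two of the expanded product are dominated by those of exp s;
    isolating the linear part prepares the derivative of an infinite product. *)
Lemma Cmod_Cprod_sub1_lin (u : nat -> C) (n : nat) :
  let s := Rsum (fun k => Cmod (u k - 1)) n in
  (Cmod (Cprod u n - 1 - Csum (fun k => u k - 1)%C n) <= exp s - 1 - s)%R.
Proof.
  induction n as [|n IH]; simpl in *.
  - replace (1 - 1 - 0) with (RtoC 0) by ring; rewrite Cmod_0, exp_0; lra.
  - assert (HP := Cmod_Cprod_sub1 u n).
    set (s := Rsum _ n) in *; set (P := Cprod u n) in *; set (t := Cmod (u n - 1)).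
    set (S := Csum _ n) in *.
    replace (P * u n - 1 - (S + (u n - 1))) with ((P - 1 - S) + (P - 1) * (u n - 1)) by ring.
    assert (H1 := Cmod_triangle (P - 1 - S) ((P - 1) * (u n - 1))).
    rewrite Cmod_mult in H1; fold t in H1; rewrite exp_plus.
    assert (Ht : (0 <= t)%R) by apply Cmod_ge_0.
    assert (He := exp_ineq1_le t); assert (Hs := exp_pos s); nra.
Qed.

(** This is exp (- s) >= 1 - s multiplied by exp s. *)
Lemma exp_sub1_le (s : R) : (exp s - 1 <= s * exp s)%R.
Proof.
  assert (H := exp_ineq1_le (- s)); assert (Hs := exp_pos s).
  assert (E : (exp (- s) * exp s = 1)%R)
    by (rewrite <- exp_plus, <- exp_0; f_equal; ring).
  nra.
Qed.

Lemma exp_sub2_le (s : R) : (0 <= s -> exp s - 1 - s <= s ^ 2 * exp s)%R.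
Proof. intros H; assert (H1 := exp_sub1_le s); nra. Qed.

Lemma ex_series_Rsum_tail (m : nat -> R) :
  (forall k, 0 <= m k)%R -> ex_series m -> forall eps : posreal,
  exists N, forall n n', (N <= n)%nat -> (Rsum (fun k => m (n + k)%nat) n' <= eps)%R.
Proof.
  intros Hm Hs eps; destruct (Cauchy_ex_series (K := R_AbsRing) m Hs eps) as [N HN].
  exists N; intros n n' Hn; destruct n' as [|n']; [simpl; left; apply cond_pos|].
  specialize (HN n (n + n')%nat Hn ltac:(lia)).
  replace (Rsum (fun k => m (n + k)%nat) (S n')) with (sum_n_m m n (n + n')).
  - left; apply Rle_lt_trans with (2 := HN); apply Rle_abs.
  - clear HN; induction n' as [|n' IH].
    + rewrite Nat.add_0_r, sum_n_n; simpl; rewrite Nat.add_0_r; ring.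
    + rewrite Nat.add_succ_r, sum_n_Sm by lia; rewrite IH.
      simpl; rewrite Nat.add_succ_r; reflexivity.
Qed.

Lemma ex_series_Rsum_bound (m : nat -> R) :
  (forall k, 0 <= m k)%R -> ex_series m -> exists B, (0 <= B)%R /\ forall n, (Rsum m n <= B)%R.
Proof.
  intros Hm [l Hl]; exists l.
  assert (H : forall n, (Rsum m n <= l)%R).
  { intros n; apply is_lim_seq_incr_compare with (u := Rsum m).
    - apply is_lim_seq_incr_1, is_lim_seq_ext with (sum_n m); [|exact Hl].
      intros k; symmetry; apply Rsum_sum_n.
    - intros k; simpl; specialize (Hm k); lra. }
  split; auto; apply (H 0%nat).
Qed.

Lemma Cauchy_Ccv (u : nat -> C) :
  (forall eps : posreal, exists N, forall n p, (N <= n)%nat -> (N <= p)%nat ->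
     Cmod (u n - u p) < eps)%R -> exists l, Ccv u l.
Proof.
  intros H.
  assert (H1 : ex_finite_lim_seq (fun n => Re (u n))).
  { apply ex_lim_seq_cauchy_corr; intros eps; destruct (H eps) as [N HN].
    exists N; intros n p Hn Hp; apply Rle_lt_trans with (2 := HN n p Hn Hp).
    replace (Re (u n) - Re (u p))%R with (Re (u n - u p)); [apply re_le_Cmod|].
    unfold Cminus; rewrite re_plus, re_opp; ring. }
  assert (H2 : ex_finite_lim_seq (fun n => Im (u n))).
  { apply ex_lim_seq_cauchy_corr; intros eps; destruct (H eps) as [N HN].
    exists N; intros n p Hn Hp; apply Rle_lt_trans with (2 := HN n p Hn Hp).
    replace (Im (u n) - Im (u p))%R with (Im (u n - u p)); [apply im_le_Cmod|].
    unfold Cminus; rewrite im_plus, im_opp; ring. }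
  destruct H1 as [a Ha], H2 as [b Hb]; exists (RtoC a + Ci * RtoC b).
  apply Ccv_ext with (fun n => RtoC (Re (u n)) + Ci * RtoC (Im (u n))).
  - intros n; destruct (u n) as [x y]; unfold RtoC, Ci, Cmult, Cplus; simpl; f_equal; ring.
  - apply Ccv_plus; [|apply Ccv_scal]; apply Ccv_RtoC; auto.
Qed.

Lemma Cmod_Cprod_sub1_bound (u : nat -> C) (n : nat) (m : nat -> R) (s : R) :
  (forall k, (k < n)%nat -> Cmod (u k - 1) <= m k)%R -> (Rsum m n <= s)%R ->
  (Cmod (Cprod u n - 1) <= exp s - 1)%R.
Proof.
  intros H Hs; apply Rle_trans with (1 := Cmod_Cprod_sub1 u n).
  apply Rplus_le_compat_r, exp_le; apply Rle_trans with (2 := Hs); apply Rsum_le, H.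
Qed.

Lemma exp_small (eps : posreal) : exists d : posreal, (exp d - 1 <= eps)%R.
Proof.
  assert (H : (0 < ln (1 + eps))%R).
  { rewrite <- ln_1; apply ln_increasing; [lra|]; assert (H := cond_pos eps); lra. }
  exists (mkposreal _ H); simpl; rewrite exp_ln; [lra|]; assert (T := cond_pos eps); lra.
Qed.

(** Below [K] the majorant may be negative; setting it to 0 there makes its partial sums
    monotone. *)
Lemma ex_series_nonneg_tail (m : nat -> R) (K : nat) (u : nat -> C) :
  ex_series m -> (forall k, (K <= k)%nat -> Cmod (u k - 1) <= m k)%R ->
  exists m', (forall k, 0 <= m' k)%R /\ ex_series m' /\
    (forall k, (K <= k)%nat -> Cmod (u k - 1) <= m' k)%R.
Proof.
  intros Hm Hu; exists (fun k => if le_lt_dec K k then m k else 0%R); split; [|split].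
  - intros k; destruct (le_lt_dec K k) as [H|H]; [|lra].
    apply Rle_trans with (2 := Hu k H); apply Cmod_ge_0.
  - apply (ex_series_incr_n _ K); apply (ex_series_incr_n _ K) in Hm.
    apply ex_series_ext with (2 := Hm); intros k.
    destruct (le_lt_dec K (K + k)) as [H|H]; auto; lia.
  - intros k Hk; destruct (le_lt_dec K k); auto; lia.
Qed.

Lemma infprod_exists (u : nat -> C) (m : nat -> R) (K : nat) :
  ex_series m -> (forall k, (K <= k)%nat -> Cmod (u k - 1) <= m k)%R ->
  exists P, is_infprod u P.
Proof.
  intros Hm Hu; destruct (ex_series_nonneg_tail m K u Hm Hu) as [m' [Hm0 [Hm' Hu']]].
  clear m Hm Hu; rename m' into m.
  (* Beyond the index where the sums of the majorant stay below [d], all partial products lie within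
     1/2 of 1: this bounds them by 2 and keeps their limit away from 0. *)
  destruct (exp_small (mkposreal (1 / 2) ltac:(lra))) as [d Hd]; simpl in Hd.
  destruct (ex_series_Rsum_tail m Hm0 Hm' d) as [N1 HN1].
  set (N := (N1 + K)%nat).
  assert (Hv : forall n, (Cmod (Cprod (fun k => u (N + k)%nat) n - 1) <= 1 / 2)%R).
  { intros n; apply Rle_trans with (2 := Hd).
    apply Cmod_Cprod_sub1_bound with (fun k => m (N + k)%nat).
    - intros k _; apply Hu'; unfold N; lia.
    - apply HN1; unfold N; lia. }
  set (v := Cprod (fun k => u (N + k)%nat)) in *.
  assert (Hb : forall n, (Cmod (v n) <= 2)%R).
  { intros n; specialize (Hv n); assert (T := Cmod_triangle (v n - 1) 1).
    replace (v n - 1 + 1) with (v n) in T by ring; rewrite Cmod_1 in T; lra. }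
  assert (Hstep : forall eps : posreal, exists N2, forall n p, (N2 <= n)%nat ->
    (Cmod (v (n + p)%nat - v n) <= eps)%R).
  { intros eps; assert (He := cond_pos eps).
    destruct (exp_small (mkposreal (eps / 2) ltac:(lra))) as [d2 Hd2]; simpl in Hd2.
    destruct (ex_series_Rsum_tail m Hm0 Hm' d2) as [N2 HN2].
    exists N2; intros n p Hn; unfold v; rewrite Cprod_split; fold v; fold (v n).
    set (w := Cprod _ p).
    replace (v n * w - v n) with (v n * (w - 1)) by ring; rewrite Cmod_mult.
    assert (Hw : (Cmod (w - 1) <= eps / 2)%R).
    { apply Rle_trans with (2 := Hd2).
      apply Cmod_Cprod_sub1_bound with (fun k => m (N + n + k)%nat).
      - intros k _; rewrite Nat.add_assoc; apply Hu'; unfold N; lia.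
      - apply HN2; lia. }
    assert (T := Hb n); assert (T1 := Cmod_ge_0 (v n)); assert (T2 := Cmod_ge_0 (w - 1)); nra. }
  destruct (Cauchy_Ccv v) as [q Hq].
  { intros eps; assert (He := cond_pos eps).
    destruct (Hstep (mkposreal (eps / 3) ltac:(lra))) as [N2 HN2]; simpl in HN2.
    exists N2; intros n p Hn Hp.
    assert (H1 := HN2 N2 (n - N2)%nat (le_n _)); assert (H2 := HN2 N2 (p - N2)%nat (le_n _)).
    replace (N2 + (n - N2))%nat with n in H1 by lia.
    replace (N2 + (p - N2))%nat with p in H2 by lia.
    replace (v n - v p) with ((v n - v N2) - (v p - v N2)) by ring.
    assert (T := Cmod_sub_le (v n - v N2) (v p - v N2)); lra. }
  exists (Cprod u N * q), N, q; split; [|split; auto].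
  - intros E; subst q.
    destruct (proj1 (Ccv_eps _ _) Hq (mkposreal (1 / 2) ltac:(lra))) as [n Hn].
    specialize (Hn n (le_n _)); specialize (Hv n); simpl in Hn.
    replace (v n - 0) with (v n) in Hn by ring.
    assert (T := Cmod_triangle_rev 1 (1 - v n)); rewrite Cmod_1 in T.
    replace (1 - (1 - v n)) with (v n) in T by ring.
    rewrite Cmod_sub_sym in Hv; lra.
  - apply Ccv_filterlim, Hq.
Qed.

Lemma Ccv_incr_n (u : nat -> C) (N : nat) (l : C) :
  Ccv (fun n => u (N + n)%nat) l <-> Ccv u l.
Proof.
  unfold Ccv; rewrite (is_lim_seq_incr_n (fun n => Cmod (u n - l)) N).
  split; apply is_lim_seq_ext; intros n; rewrite Nat.add_comm; auto.
Qed.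

Lemma infprod_Ccv (u : nat -> C) (P : C) : is_infprod u P -> Ccv (Cprod u) P.
Proof.
  intros [N [q [_ [H E]]]]; apply Ccv_filterlim in H; apply (Ccv_incr_n _ N); subst P.
  apply Ccv_ext with (fun n => Cprod u N * Cprod (fun k => u (N + k)%nat) n).
  - intros n; symmetry; apply Cprod_split.
  - apply Ccv_scal, H.
Qed.

Lemma infprod_eq_0 (u : nat -> C) (P : C) : is_infprod u P -> P = 0 <-> exists k, u k = 0.
Proof.
  intros H; split.
  - destruct H as [N [q [Hq [_ E]]]]; intros E0; rewrite E0 in E.
    destruct (Cmult_integral _ _ (eq_sym E)) as [H|H]; [|destruct (Hq H)].
    apply Cprod_eq_0_inv in H; auto.
  - intros [k Hk]; apply infprod_Ccv in H.
    apply Ccv_unique with (1 := H), Ccv_ext_loc with (fun _ => 0); [|apply Ccv_const].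
    exists (S k); intros n Hn; symmetry; apply Cprod_eq_0 with k; auto.
Qed.

Lemma Ccv_Cprod (u : nat -> nat -> C) (v : nat -> C) (N : nat) :
  (forall k, Ccv (fun n => u n k) (v k)) -> Ccv (fun n => Cprod (u n) N) (Cprod v N).
Proof.
  intros H; induction N as [|N IH]; simpl; [apply Ccv_const | apply Ccv_mult; auto].
Qed.

(** Tannery's theorem for products: a head of fixed length converges factor by factor, while the
    majorant keeps the rest of every row uniformly close to 1. The rows have growing lengths [L n],
    as the polynomials have growing degrees. *)
Lemma infprod_dominated (u : nat -> nat -> C) (v : nat -> C) (L : nat -> nat)
    (m : nat -> R) (K : nat) (P : C) :
  ex_series m -> (forall n k, (K <= k)%nat -> Cmod (u n k - 1) <= m k)%R ->
  (forall k, Ccv (fun n => u n k) (v k)) -> (forall n, (n <= L n)%nat) ->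
  is_infprod v P -> Ccv (fun n => Cprod (u n) (L n)) P.
Proof.
  intros Hm Hu Hv HL HP; apply infprod_Ccv in HP; apply Ccv_eps; intros eps.
  assert (Hm0 : forall k, (K <= k)%nat -> (0 <= m k)%R)
    by (intros k Hk; apply Rle_trans with (2 := Hu 0%nat k Hk); apply Cmod_ge_0).
  assert (He := cond_pos eps).
  assert (HB : (0 < Cmod P + 2)%R) by (assert (T := Cmod_ge_0 P); lra).
  (* The head [a] will be bounded by |P| + 2, so that the tail costs at most eps / 4; each of the
     two other errors is also below eps / 4. *)
  assert (Hd : (0 < eps / (4 * (Cmod P + 2)))%R) by (apply Rdiv_lt_0_compat; lra).
  destruct (exp_small (mkposreal _ Hd)) as [d Hd']; simpl in Hd'.
  assert (Htail : exists N1, forall n n', (N1 <= n)%nat ->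
    (Rsum (fun k => m (K + (n + k))%nat) n' <= d)%R).
  { apply (ex_series_Rsum_tail (fun k => m (K + k)%nat));
      [intros; apply Hm0; lia | apply ex_series_incr_n, Hm]. }
  destruct Htail as [N1 HN1].
  assert (Hlt : (0 < Rmin 1 (eps / 4))%R) by (apply Rmin_glb_lt; lra).
  destruct (proj1 (Ccv_eps _ _) HP (mkposreal _ Hlt)) as [N2 HN2]; simpl in HN2.
  set (N := (K + N1 + N2)%nat).
  destruct (proj1 (Ccv_eps _ _) (Ccv_Cprod u v N Hv) (mkposreal _ Hlt)) as [N3 HN3];
    simpl in HN3.
  exists (N + N3)%nat; intros n Hn.
  assert (HLn := HL n); replace (L n) with (N + (L n - N))%nat by lia.
  rewrite Cprod_split; set (w := Cprod (fun k => _) _).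
  assert (Hw : (Cmod (w - 1) <= eps / (4 * (Cmod P + 2)))%R).
  { apply Rle_trans with (2 := Hd').
    apply Cmod_Cprod_sub1_bound with (fun k => m (K + (N1 + N2 + k))%nat).
    - intros k _; replace (K + (N1 + N2 + k))%nat with (N + k)%nat by (unfold N; lia).
      apply Hu; unfold N; lia.
    - apply (HN1 (N1 + N2)%nat); lia. }
  specialize (HN3 n ltac:(lia)); specialize (HN2 N ltac:(unfold N; lia)).
  assert (R1 := Rmin_l 1 (eps / 4)); assert (R2 := Rmin_r 1 (eps / 4)).
  set (a := Cprod (u n) N) in *; set (b := Cprod v N) in *.
  replace (a * w - P) with (a * (w - 1) + ((a - b) + (b - P))) by ring.
  assert (T1 := Cmod_triangle (a * (w - 1)) ((a - b) + (b - P))).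
  assert (T2 := Cmod_triangle (a - b) (b - P)); rewrite Cmod_mult in T1.
  assert (Ha : (Cmod a <= Cmod P + 2)%R).
  { assert (T3 := Cmod_triangle ((a - b) + (b - P)) P).
    replace (a - b + (b - P) + P) with a in T3 by ring; lra. }
  assert (Hp : (Cmod a * Cmod (w - 1) <= (Cmod P + 2) * (eps / (4 * (Cmod P + 2))))%R)
    by (apply Rmult_le_compat; auto; apply Cmod_ge_0).
  replace ((Cmod P + 2) * (eps / (4 * (Cmod P + 2))))%R with (eps / 4)%R in Hp
    by (field; lra).
  lra.
Qed.

(** * Complex derivatives with a quadratic remainder *)

(** An explicit radius and quadratic constant, instead of an error o(h), allow the errors of
    infinitely many factors to be summed. *)
Definition Cdiff (f : C -> C) (z l : C) : Prop :=
  exists d M : R, (0 < d)%R /\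
    forall h, (Cmod h < d)%R -> (Cmod (f (z + h)%C - f z - l * h) <= M * Cmod h ^ 2)%R.

Lemma Cdiff_is_derive (f : C -> C) (z l : C) :
  Cdiff f z l -> @is_derive C_AbsRing C_NormedModule f z l.
Proof.
  intros [d [M [Hd H]]]; split; [apply is_linear_scal_l|].
  intros z' Hz'; intros eps.
  apply (is_filter_lim_locally_unique (V := AbsRing_NormedModule C_AbsRing)) in Hz'; subst z'.
  assert (He := cond_pos eps).
  assert (HM : (0 < Rabs M + 1)%R) by (assert (T := Rabs_pos M); lra).
  assert (Hr : (0 < Rmin d (eps / (Rabs M + 1)))%R)
    by (apply Rmin_glb_lt; [|apply Rdiv_lt_0_compat]; auto).
  assert (G : forall y : C, (Cmod (y - z) < Rmin d (eps / (Rabs M + 1)))%R ->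
    (Cmod (f y - f z - (y - z) * l) <= eps * Cmod (y - z))%R);
    [|apply (locally_le_locally_norm (V := AbsRing_NormedModule C_AbsRing));
      exists (mkposreal _ Hr); intros y Hy; exact (G y Hy)].
  intros y Hy.
  assert (R1 := Rmin_l d (eps / (Rabs M + 1))); assert (R2 := Rmin_r d (eps / (Rabs M + 1))).
  specialize (H (y - z) ltac:(lra)).
  replace (z + (y - z)) with y in H by ring.
  replace (f y - f z - (y - z) * l) with (f y - f z - l * (y - z)) by ring.
  apply Rle_trans with (1 := H).
  replace (M * Cmod (y - z) ^ 2)%R with (M * Cmod (y - z) * Cmod (y - z))%R by ring.
  apply Rmult_le_compat_r; [apply Cmod_ge_0|].
  assert (T := Cmod_ge_0 (y - z)); assert (TM := Rle_abs M).
  assert (E : (pos eps = (Rabs M + 1) * (eps / (Rabs M + 1)))%R) by (field; lra).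
  rewrite E; apply Rle_trans with ((Rabs M + 1) * Cmod (y - z))%R; [nra|].
  apply Rmult_le_compat_l; lra.
Qed.

Lemma Cdiff_C_derive (f : C -> C) (z l : C) : Cdiff f z l -> C_derive f z = l.
Proof. intros H; apply is_C_derive_unique, Cdiff_is_derive, H. Qed.

Lemma Cdiff_ext (f g : C -> C) (z l : C) :
  (forall x, f x = g x) -> Cdiff f z l -> Cdiff g z l.
Proof.
  intros E [d [M [Hd H]]]; exists d, M; split; auto.
  intros h Hh; rewrite <- 2 E; auto.
Qed.

Lemma Cdiff_plus (f g : C -> C) (z l m : C) :
  Cdiff f z l -> Cdiff g z m -> Cdiff (fun x => f x + g x) z (l + m).
Proof.
  intros [d1 [M1 [Hd1 H1]]] [d2 [M2 [Hd2 H2]]].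
  exists (Rmin d1 d2), (M1 + M2)%R; split; [apply Rmin_glb_lt; auto|]; intros h Hh.
  specialize (H1 h (Rlt_le_trans _ _ _ Hh (Rmin_l _ _))).
  specialize (H2 h (Rlt_le_trans _ _ _ Hh (Rmin_r _ _))).
  replace (_ - _) with ((f (z + h) - f z - l * h) + (g (z + h) - g z - m * h)) by ring.
  apply Rle_trans with (1 := Cmod_triangle _ _); lra.
Qed.

Lemma Cdiff_mult (f g : C -> C) (z l m : C) :
  Cdiff f z l -> Cdiff g z m -> Cdiff (fun x => f x * g x) z (l * g z + f z * m).
Proof.
  intros [d1 [M1 [Hd1 H1]]] [d2 [M2 [Hd2 H2]]].
  exists (Rmin 1 (Rmin d1 d2)),
    (Cmod (g z) * Rabs M1 + Cmod (f z) * Rabs M2 + (Rabs M1 + Cmod l) * (Rabs M2 + Cmod m))%R.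
  split; [repeat apply Rmin_glb_lt; auto; lra|]; intros h Hh.
  assert (R1 := Rmin_l 1 (Rmin d1 d2)); assert (R2 := Rmin_r 1 (Rmin d1 d2)).
  assert (R3 := Rmin_l d1 d2); assert (R4 := Rmin_r d1 d2).
  specialize (H1 h ltac:(lra)); specialize (H2 h ltac:(lra)).
  set (a := f (z + h) - f z - l * h) in *; set (b := g (z + h) - g z - m * h) in *.
  replace (f (z + h) * g (z + h) - f z * g z - (l * g z + f z * m) * h)
    with (g z * a + (f z * b + (a + l * h) * (b + m * h))) by (unfold a, b; ring).
  assert (P1 := Rle_abs M1); assert (P2 := Rle_abs M2).
  assert (Q1 := Rabs_pos M1); assert (Q2 := Rabs_pos M2).
  assert (N1 := Cmod_ge_0 l); assert (N2 := Cmod_ge_0 m); assert (N3 := Cmod_ge_0 h).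
  assert (N4 := Cmod_ge_0 (f z)); assert (N5 := Cmod_ge_0 (g z)).
  set (x := Cmod h) in *.
  assert (X2 : (0 <= x ^ 2)%R) by nra.
  assert (X3 : (x ^ 2 <= x)%R) by nra.
  assert (Ha : (Cmod a <= Rabs M1 * x ^ 2)%R) by nra.
  assert (Hb : (Cmod b <= Rabs M2 * x ^ 2)%R) by nra.
  assert (Ha' : (Cmod (a + l * h) <= (Rabs M1 + Cmod l) * x)%R).
  { apply Rle_trans with (1 := Cmod_triangle _ _); rewrite Cmod_mult; fold x; nra. }
  assert (Hb' : (Cmod (b + m * h) <= (Rabs M2 + Cmod m) * x)%R).
  { apply Rle_trans with (1 := Cmod_triangle _ _); rewrite Cmod_mult; fold x; nra. }
  apply Rle_trans with (1 := Cmod_triangle _ _).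
  apply Rle_trans with (Cmod (g z * a) +
    (Cmod (f z * b) + Cmod ((a + l * h) * (b + m * h))))%R;
    [apply Rplus_le_compat_l, Cmod_triangle|].
  rewrite 3 Cmod_mult.
  assert (G1 : (Cmod (g z) * Cmod a <= Cmod (g z) * (Rabs M1 * x ^ 2))%R)
    by (apply Rmult_le_compat_l; auto).
  assert (G2 : (Cmod (f z) * Cmod b <= Cmod (f z) * (Rabs M2 * x ^ 2))%R)
    by (apply Rmult_le_compat_l; auto).
  assert (G3 : (Cmod (a + l * h) * Cmod (b + m * h)
    <= ((Rabs M1 + Cmod l) * x) * ((Rabs M2 + Cmod m) * x))%R)
    by (apply Rmult_le_compat; auto; apply Cmod_ge_0).
  lra.
Qed.

Lemma Cdiff_Cexp (f : C -> C) (z l : C) :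
  Cdiff f z l -> Cdiff (fun x => Cexp (f x)) z (Cexp (f z) * l).
Proof.
  intros [d [M [Hd H]]].
  set (A := (Rabs M + Cmod l)%R).
  exists (Rmin 1 d), (Cmod (Cexp (f z)) * (A ^ 2 * exp A + Rabs M))%R.
  split; [apply Rmin_glb_lt; auto; lra|]; intros h Hh.
  assert (R1 := Rmin_l 1 d); assert (R2 := Rmin_r 1 d).
  specialize (H h ltac:(lra)).
  set (a := f (z + h) - f z - l * h) in *.
  replace (f (z + h)) with (f z + (a + l * h)) by (unfold a; ring).
  rewrite Cexp_plus.
  replace (Cexp (f z) * Cexp (a + l * h) - Cexp (f z) - Cexp (f z) * l * h)
    with (Cexp (f z) * ((Cexp (a + l * h) - 1 - (a + l * h)) + a)) by ring.
  rewrite Cmod_mult, Rmult_assoc; apply Rmult_le_compat_l; [apply Cmod_ge_0|].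
  apply Rle_trans with (1 := Cmod_triangle _ _).
  assert (P1 := Rle_abs M); assert (Q1 := Rabs_pos M).
  assert (N1 := Cmod_ge_0 l); assert (N3 := Cmod_ge_0 h).
  set (x := Cmod h) in *.
  assert (X2 : (0 <= x ^ 2)%R) by nra.
  assert (X3 : (x ^ 2 <= x)%R) by nra.
  assert (Ha : (Cmod a <= Rabs M * x ^ 2)%R) by nra.
  assert (Ha' : (Cmod (a + l * h) <= A * x)%R).
  { apply Rle_trans with (1 := Cmod_triangle _ _); rewrite Cmod_mult; fold x; unfold A; nra. }
  assert (HA : (0 <= A)%R) by (unfold A; lra).
  assert (T := Cexp_taylor2 (a + l * h)).
  assert (T2 : (Cmod (a + l * h) ^ 2 * exp (Cmod (a + l * h)) <= (A * x) ^ 2 * exp A)%R).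
  { apply Rmult_le_compat; [apply pow_le, Cmod_ge_0 | left; apply exp_pos| |].
    - apply pow_incr; split; auto; apply Cmod_ge_0.
    - apply exp_le; nra. }
  rewrite Rpow_mult_distr in T2; lra.
Qed.

Lemma Cdiff_quadratic (a b c z : C) :
  Cdiff (fun x => a + b * x + c * x ^ 2) z (b + 2 * c * z).
Proof.
  exists 1%R, (Cmod c); split; [lra|]; intros h _.
  replace (_ - _) with (c * h ^ 2) by ring.
  rewrite Cmod_mult, Cmod_pow; lra.
Qed.

Lemma Cdiff_Cprod (u : nat -> C -> C) (du : nat -> C) (z : C) (n : nat) :
  (forall k, Cdiff (u k) z (du k)) -> exists l, Cdiff (fun x => Cprod (fun k => u k x) n) z l.
Proof.
  intros H; induction n as [|n [l IH]]; simpl.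
  - exists 0; exists 1%R, 0%R; split; [lra|]; intros h _.
    replace (1 - 1 - 0 * h) with (RtoC 0) by ring; rewrite Cmod_0; lra.
  - eexists; apply Cdiff_mult; eauto.
Qed.

(** One majorant controls both the linear coefficients and the quadratic errors. The resulting
    constant depends on [B] alone and not on [n], so the estimate survives the limit. *)
Lemma Cmod_Cprod_sub1_linear (q l : nat -> C) (h : C) (m : nat -> R) (B : R) (n : nat) :
  (Cmod h <= 1)%R -> (0 <= B)%R ->
  (forall k, (k < n)%nat -> Cmod (q k - 1 - l k * h) <= m k * Cmod h ^ 2)%R ->
  (forall k, (k < n)%nat -> Cmod (l k) <= m k)%R -> (Rsum m n <= B)%R ->
  (Cmod (Cprod q n - 1 - Csum l n * h) <= (4 * B ^ 2 * exp (2 * B) + B) * Cmod h ^ 2)%R.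
Proof.
  intros Hh HB Hq Hl Hm.
  set (s := Rsum (fun k => Cmod (q k - 1)) n).
  set (x := Cmod h) in *; assert (Hx : (0 <= x)%R) by apply Cmod_ge_0.
  assert (Hs0 : (0 <= s)%R) by (apply Rsum_ge0; intros; apply Cmod_ge_0).
  assert (Hs : (s <= 2 * x * B)%R).
  { apply Rle_trans with (Rsum (fun k => 2 * x * m k)%R n); [apply Rsum_le|].
    - intros k Hk; specialize (Hq k Hk); specialize (Hl k Hk).
      assert (T := Cmod_triangle (q k - 1 - l k * h) (l k * h)).
      replace (q k - 1 - l k * h + l k * h) with (q k - 1) in T by ring.
      rewrite Cmod_mult in T; fold x in T; assert (T2 := Cmod_ge_0 (l k)).
      assert (x ^ 2 <= x)%R by nra; nra.
    - rewrite Rsum_scal; nra. }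
  assert (T1 := Cmod_Cprod_sub1_lin q n); cbv zeta in T1; fold s in T1.
  assert (T2 : (Cmod (Csum (fun k => q k - 1 - l k * h)%C n) <= x ^ 2 * B)%R).
  { apply Rle_trans with (1 := Cmod_Csum _ _).
    apply Rle_trans with (Rsum (fun k => x ^ 2 * m k)%R n); [apply Rsum_le|].
    - intros k Hk; rewrite Rmult_comm; apply Hq, Hk.
    - rewrite Rsum_scal; apply Rmult_le_compat_l; auto; nra. }
  rewrite (Csum_minus (fun k => q k - 1)) in T2.
  assert (E : Csum (fun k => l k * h) n = Csum l n * h).
  { rewrite (Cmult_comm (Csum l n)), <- Csum_scal; apply Csum_ext; intros; ring. }
  rewrite E in T2.
  replace (Cprod q n - 1 - Csum l n * h) with
    ((Cprod q n - 1 - Csum (fun k => q k - 1) n) + (Csum (fun k => q k - 1) n - Csum l n * h))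
    by ring.
  apply Rle_trans with (1 := Cmod_triangle _ _).
  assert (T3 := exp_sub2_le s Hs0).
  assert (T4 : (s ^ 2 * exp s <= (2 * x * B) ^ 2 * exp (2 * B))%R).
  { apply Rmult_le_compat; [nra | left; apply exp_pos| |].
    - apply pow_incr; lra.
    - apply exp_le; nra. }
  replace ((2 * x * B) ^ 2 * exp (2 * B))%R with (4 * B ^ 2 * exp (2 * B) * x ^ 2)%R in T4
    by ring.
  lra.
Qed.

(* Logarithmic differentiation of an infinite product, without logarithms:
   f (z + h) / f z is the product of the quotients u k (z + h) / u k z. *)
Lemma Cdiff_infprod (u : nat -> C -> C) (f : C -> C) (z L : C) (l : nat -> C)
    (m : nat -> R) (d : R) :
  (0 < d)%R -> (forall k, 0 <= m k)%R -> ex_series m ->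
  (forall k, u k z <> 0) ->
  (forall k h, Cmod h < d -> Cmod (u k (z + h)%C / u k z - 1 - l k * h) <= m k * Cmod h ^ 2)%R ->
  (forall k, Cmod (l k) <= m k)%R ->
  (forall h, (Cmod h < d)%R -> Ccv (Cprod (fun k => u k (z + h))) (f (z + h))) ->
  f z <> 0 -> Ccv (Csum l) L ->
  Cdiff f z (f z * L).
Proof.
  intros Hd Hm0 Hm Hu Hq Hl Hf Hfz HL.
  destruct (ex_series_Rsum_bound m Hm0 Hm) as [B [HB0 HB]].
  set (M := (4 * B ^ 2 * exp (2 * B) + B)%R).
  exists (Rmin 1 d), (Cmod (f z) * M)%R; split; [apply Rmin_glb_lt; lra|]; intros h Hh.
  assert (R1 := Rmin_l 1 d); assert (R2 := Rmin_r 1 d).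
  assert (Hz : Ccv (Cprod (fun k => u k z)) (f z)).
  { assert (H0 := Hf 0); replace (z + 0) with z in H0 by ring; apply H0.
    rewrite Cmod_0; lra. }
  assert (Hlim : Ccv (fun n => Cprod (fun k => u k (z + h) / u k z) n - 1 - Csum l n * h)
    (f (z + h) / f z - 1 - L * h)).
  { apply Ccv_minus; [apply Ccv_minus; [|apply Ccv_const]|].
    - apply Ccv_ext with (fun n => Cprod (fun k => u k (z + h)) n * / Cprod (fun k => u k z) n).
      + intros n; rewrite <- (Cmult_1_r (Cprod (fun k => _ / _) n)).
        rewrite <- (Cinv_r (Cprod (fun k => u k z) n)) by (apply Cprod_neq_0; auto).
        rewrite Cmult_assoc, <- Cprod_mult; f_equal.
        apply Cprod_ext; intros k _; field; auto.
      + apply Ccv_mult; [apply Hf; lra | apply Ccv_inv; auto].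
    - apply Ccv_mult; [auto | apply Ccv_const]. }
  replace (f (z + h) - f z - f z * L * h) with (f z * (f (z + h) / f z - 1 - L * h))
    by (field; auto).
  rewrite Cmod_mult, Rmult_assoc; apply Rmult_le_compat_l; [apply Cmod_ge_0|].
  assert (Hle : forall n, (Cmod (Cprod (fun k => u k (z + h) / u k z)%C n - 1 - Csum l n * h)
    <= M * Cmod h ^ 2)%R).
  { intros n; apply Cmod_Cprod_sub1_linear with m; auto; [lra|].
    intros k _; apply Hq; lra. }
  set (g := f (z + h) / f z - 1 - L * h) in *; set (v := fun n => _) in Hlim.
  assert (Hle' : forall n, (Cmod g <= Cmod (v n - g) + M * Cmod h ^ 2)%R).
  { intros n; assert (T := Cmod_triangle_rev g (v n)); rewrite Cmod_sub_sym in T.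
    specialize (Hle n); fold (v n) in Hle; lra. }
  apply (is_lim_seq_le (fun _ => Cmod g) (fun n => Cmod (v n - g) + M * Cmod h ^ 2)%R
    (Cmod g) (0 + M * Cmod h ^ 2)%R) in Hle'.
  - simpl in Hle' |- *; lra.
  - apply is_lim_seq_const.
  - apply is_lim_seq_plus'; [exact Hlim | apply is_lim_seq_const].
Qed.

(** * Euler's constant *)

Definition harmonic (n : nat) : R := Rsum (fun k => / INR (S k))%R n.

Lemma INR_S_pos (n : nat) : (0 < INR (S n))%R.
Proof. apply lt_0_INR; lia. Qed.

Lemma INR_S_ge1 (n : nat) : (1 <= INR (S n))%R.
Proof. replace 1%R with (INR 1) by reflexivity; apply le_INR; lia. Qed.

Lemma INR_S_neq_0 (n : nat) : RtoC (INR (S n)) <> 0.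
Proof. intros H; apply RtoC_inj in H; assert (T := INR_S_pos n); lra. Qed.

Lemma ln_le_sub1 (x : R) : (0 < x -> ln x <= x - 1)%R.
Proof.
  intros H; assert (T := exp_ineq1_le (ln x)); rewrite exp_ln in T by auto; lra.
Qed.

Lemma ln_succ_bounds (n : nat) : (0 < n)%nat ->
  (/ INR (S n) <= ln (INR (S n)) - ln (INR n) <= / INR n)%R.
Proof.
  intros Hn; assert (H : (0 < INR n)%R) by (apply lt_0_INR; auto).
  assert (HS := INR_S_pos n); split.
  - assert (T := ln_le_sub1 (INR n / INR (S n)) ltac:(apply Rdiv_lt_0_compat; auto)).
    rewrite ln_div in T by auto; rewrite S_INR in *.
    replace (INR n / (INR n + 1) - 1)%R with (- / (INR n + 1))%R in T by (field; lra); lra.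
  - assert (T := ln_le_sub1 (INR (S n) / INR n) ltac:(apply Rdiv_lt_0_compat; auto)).
    rewrite ln_div in T by auto; rewrite S_INR in *.
    replace ((INR n + 1) / INR n - 1)%R with (/ INR n)%R in T by (field; lra); lra.
Qed.

Lemma harmonic_sum_n_m (n : nat) : sum_n_m (fun k => / INR k)%R 1 n = harmonic n.
Proof.
  induction n as [|n IH]; [rewrite sum_n_m_zero by lia; reflexivity|].
  rewrite sum_n_Sm by lia; rewrite IH; reflexivity.
Qed.

(** H_n - ln n decreases and H_n - ln (n + 1) increases to the same limit. The two-sided bounds are
    what the numerical inequalities later use, with n = 3 and n = 5. *)
Lemma euler_const_lim :
  is_lim_seq (fun n => harmonic n - ln (INR n))%R euler_const /\
  (forall n, (0 < n)%nat ->
     harmonic n - ln (INR (S n)) <= euler_const <= harmonic n - ln (INR n))%R.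
Proof.
  assert (Hdecr : forall n, (harmonic (S (S n)) - ln (INR (S (S n)))
    <= harmonic (S n) - ln (INR (S n)))%R).
  { intros n; assert (T := ln_succ_bounds (S n) ltac:(lia)).
    change (harmonic (S (S n))) with (harmonic (S n) + / INR (S (S n)))%R; lra. }
  assert (Hincr : forall n, (harmonic n - ln (INR (S n))
    <= harmonic (S n) - ln (INR (S (S n))))%R).
  { intros n; assert (T := ln_succ_bounds (S n) ltac:(lia)).
    change (harmonic (S n)) with (harmonic n + / INR (S n))%R; lra. }
  assert (Hpos : forall n, (0 <= harmonic n - ln (INR (S n)))%R).
  { intros n; induction n as [|n IH]; [change (INR 1) with 1%R; rewrite ln_1;
      unfold harmonic; simpl; lra|]; specialize (Hincr n); lra. }
  destruct (ex_finite_lim_seq_decr (fun n => harmonic (S n) - ln (INR (S n)))%R 0 Hdecr)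
    as [g Hg].
  { intros n; specialize (Hpos n); change (harmonic (S n)) with (harmonic n + / INR (S n))%R.
    assert (T := Rinv_0_lt_compat _ (INR_S_pos n)); lra. }
  assert (Hg' : is_lim_seq (fun n => harmonic n - ln (INR n))%R g)
    by (apply is_lim_seq_incr_1; exact Hg).
  assert (E : euler_const = g).
  { unfold euler_const; rewrite (Lim_seq_ext _ (fun n => harmonic n - ln (INR n))%R).
    - rewrite (is_lim_seq_unique _ _ Hg'); reflexivity.
    - intros n; rewrite harmonic_sum_n_m; reflexivity. }
  rewrite E; split; [exact Hg'|]; intros n Hn; split.
  - apply (is_lim_seq_incr_compare (fun n => harmonic n - ln (INR (S n)))%R); auto.
    (* The increasing sequence is the shifted decreasing one minus 1 / (n + 1), hence has the same
       limit. *)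
    apply is_lim_seq_ext with (fun n => (harmonic (S n) - ln (INR (S n))) + - / INR (S n))%R.
    { intros k; change (harmonic (S k)) with (harmonic k + / INR (S k))%R; ring. }
    replace g with (g + - 0)%R by ring; apply is_lim_seq_plus'; auto.
    apply (is_lim_seq_opp _ 0%R), (is_lim_seq_incr_1 (fun n => / INR n)%R).
    replace (Finite 0) with (Rbar_inv p_infty) by reflexivity.
    apply is_lim_seq_inv; [apply is_lim_seq_INR | discriminate].
  - destruct n as [|n]; [lia|].
    apply (is_lim_seq_decr_compare (fun n => harmonic (S n) - ln (INR (S n)))%R); auto.
Qed.

Lemma inv_INR_lim : is_lim_seq (fun n => / INR (S n))%R 0%R.
Proof.
  apply (is_lim_seq_incr_1 (fun n => / INR n)%R).
  replace (Finite 0) with (Rbar_inv p_infty) by reflexivity.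
  apply is_lim_seq_inv; [apply is_lim_seq_INR | discriminate].
Qed.

Lemma ex_series_inv_sqr : ex_series (fun k => / INR (S k) ^ 2)%R.
Proof.
  destruct (ex_finite_lim_seq_incr (Rsum (fun k => / INR (S k) ^ 2)%R) 2) as [l Hl].
  - intros n; cbn [Rsum].
    assert (T := Rinv_0_lt_compat _ (pow_lt _ 2 (INR_S_pos n))); lra.
  - assert (H : forall n, (Rsum (fun k => / INR (S k) ^ 2)%R (S n) <= 2 - / INR (S n))%R).
    { induction n as [|n IH]; [simpl; lra|].
      change (Rsum (fun k => / INR (S k) ^ 2)%R (S (S n))) with
        (Rsum (fun k => / INR (S k) ^ 2)%R (S n) + / INR (S (S n)) ^ 2)%R.
      rewrite (S_INR (S n)) in *; assert (T := INR_S_pos n); set (x := INR (S n)) in *.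
      assert (E : (/ (x + 1) ^ 2 <= / x - / (x + 1))%R).
      { replace (/ x - / (x + 1))%R with (/ (x * (x + 1)))%R by (field; lra).
        apply Rinv_le_contravar; nra. }
      lra. }
    intros [|n]; [simpl; lra|]; specialize (H n).
    assert (T := Rinv_0_lt_compat _ (INR_S_pos n)); lra.
  - exists l; apply is_lim_seq_incr_1 in Hl.
    apply is_lim_seq_ext with (2 := Hl); intros n; apply Rsum_sum_n.
Qed.

Lemma ex_series_scal_inv_sqr (M : R) : ex_series (fun k => M * / INR (S k) ^ 2)%R.
Proof. apply (ex_series_scal_l (K := R_AbsRing) M (fun k => / INR (S k) ^ 2)%R), ex_series_inv_sqr. Qed.

Lemma inv_sqr_ge0 (M : R) (k : nat) : (0 <= M -> 0 <= M * / INR (S k) ^ 2)%R.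
Proof.
  intros H; apply Rmult_le_pos; auto; left; apply Rinv_0_lt_compat, pow_lt, INR_S_pos.
Qed.

(** * Canonical products of genus one *)

(** Weierstrass's primary factor of genus one. Its expansion at 0 has no linear term, so zeros
    growing linearly make the product converge. *)
Definition E1 (w : C) : C := (1 - w) * Cexp w.

Lemma E1_sub1 (w : C) : (Cmod (E1 w - 1) <= 2 * Cmod w ^ 2 * exp (Cmod w))%R.
Proof.
  unfold E1; replace ((1 - w) * Cexp w - 1) with ((Cexp w - 1 - w) - w * (Cexp w - 1)) by ring.
  apply Rle_trans with (1 := Cmod_sub_le _ _); rewrite Cmod_mult.
  assert (T1 := Cexp_taylor1 w); assert (T2 := Cexp_taylor2 w); assert (T := Cmod_ge_0 w).
  assert (Cmod w * Cmod (Cexp w - 1) <= Cmod w * (Cmod w * exp (Cmod w)))%R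
    by (apply Rmult_le_compat_l; auto).
  lra.
Qed.

Lemma Ccv_E1 (u : nat -> C) (l : C) : Ccv u l -> Ccv (fun n => E1 (u n)) (E1 l).
Proof.
  intros H; apply Ccv_mult; [apply Ccv_minus; [apply Ccv_const|] | apply Ccv_Cexp]; auto.
Qed.

Lemma E1_div_sub1 (z a : C) (c : R) (k : nat) :
  (0 < c)%R -> (c * INR (S k) <= Cmod a)%R ->
  (Cmod (E1 (z / a) - 1) <= 2 * (Cmod z / c) ^ 2 * exp (Cmod z / c) * / INR (S k) ^ 2)%R.
Proof.
  intros Hc Ha; assert (HS := INR_S_pos k); assert (HS1 := INR_S_ge1 k).
  assert (Hck : (0 < c * INR (S k))%R) by (apply Rmult_lt_0_compat; auto).
  assert (Ha0 : a <> 0) by (apply Cmod_gt_0; lra).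
  assert (Hz := Cmod_ge_0 z).
  apply Rle_trans with (1 := E1_sub1 _); rewrite Cmod_div by auto.
  assert (H1 : (0 <= Cmod z / Cmod a)%R) by (apply Rdiv_le_0_compat; lra).
  assert (H2 : (Cmod z / Cmod a <= Cmod z / c * / INR (S k))%R).
  { replace (Cmod z / c * / INR (S k))%R with (Cmod z * / (c * INR (S k)))%R by (field; lra).
    apply Rmult_le_compat_l; auto; apply Rinv_le_contravar; auto. }
  assert (H3 : (0 <= Cmod z / c)%R) by (apply Rdiv_le_0_compat; lra).
  assert (H4 : (/ INR (S k) <= 1)%R) by (rewrite <- Rinv_1; apply Rinv_le_contravar; lra).
  assert (H5 : (Cmod z / Cmod a <= Cmod z / c)%R) by nra.
  replace (2 * (Cmod z / c) ^ 2 * exp (Cmod z / c) * / INR (S k) ^ 2)%R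
    with (2 * (Cmod z / c * / INR (S k)) ^ 2 * exp (Cmod z / c))%R by (field; lra).
  apply Rmult_le_compat; [|left; apply exp_pos| |apply exp_le; auto].
  - assert (T := pow2_ge_0 (Cmod z / Cmod a)); lra.
  - apply Rmult_le_compat_l; [lra | apply pow_incr; auto].
Qed.

Lemma E1_infprod (a : nat -> C) (c : R) (z : C) :
  (0 < c)%R -> (forall k, c * INR (S k) <= Cmod (a k))%R ->
  exists P, is_infprod (fun k => E1 (z / a k)) P.
Proof.
  intros Hc Ha; eapply infprod_exists with (K := 0%nat); [apply ex_series_scal_inv_sqr|].
  intros k _; apply E1_div_sub1 with (c := c); auto.
Qed.

Lemma Cneq_pos_INR_mult (c : R) (a : C) (k : nat) :
  (0 < c)%R -> (c * INR (S k) <= Cmod a)%R -> a <> 0.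
Proof.
  intros Hc H; apply Cmod_gt_0.
  assert (T := Rmult_lt_0_compat _ _ Hc (INR_S_pos k)); lra.
Qed.

Lemma E1_eq_0 (z a : C) : a <> 0 -> E1 (z / a) = 0 <-> z = a.
Proof.
  intros Ha; unfold E1; split; intros H.
  - destruct (Cmult_integral _ _ H) as [H1|H1]; [|destruct (Cexp_neq_0 _ H1)].
    replace z with (a * (1 - (1 - z / a))) by (field; auto); rewrite H1; ring.
  - subst z; field; auto.
Qed.

(** The quotient is again of the form (1 - x) exp y with x and y linear in h; its linear part y - x
    shows the logarithmic derivative 1 / a - 1 / (a - z). *)
Lemma E1_quotient (z a h : C) :
  a <> 0 -> z <> a ->
  E1 ((z + h) / a) / E1 (z / a) = (1 - h / (a - z)) * Cexp (h / a).
Proof.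
  intros Ha Hz.
  assert (Hz' : a - z <> 0) by (apply Cminus_eq_contra; auto).
  assert (HE : E1 (z / a) <> 0) by (intros H; apply Hz, (E1_eq_0 z a Ha), H).
  assert (E : E1 ((z + h) / a) = (1 - h / (a - z)) * Cexp (h / a) * E1 (z / a)).
  { unfold E1; replace ((z + h) / a) with (h / a + z / a) by (field; auto).
    rewrite Cexp_plus; field; auto. }
  rewrite E; field; repeat split; auto.
Qed.

Lemma E1_linear (x y : C) :
  (Cmod ((1 - x) * Cexp y - 1 - (y - x)) <= (Cmod y ^ 2 + Cmod x * Cmod y) * exp (Cmod y))%R.
Proof.
  replace ((1 - x) * Cexp y - 1 - (y - x)) with ((Cexp y - 1 - y) - x * (Cexp y - 1)) by ring.
  apply Rle_trans with (1 := Cmod_sub_le _ _); rewrite Cmod_mult.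
  assert (T1 := Cexp_taylor1 y); assert (T2 := Cexp_taylor2 y); assert (T := Cmod_ge_0 x).
  assert (Cmod x * Cmod (Cexp y - 1) <= Cmod x * (Cmod y * exp (Cmod y)))%R
    by (apply Rmult_le_compat_l; auto).
  lra.
Qed.

Lemma Csum_cv (u : nat -> C) (m : nat -> R) :
  (forall k, 0 <= m k)%R -> ex_series m -> (forall k, Cmod (u k) <= m k)%R ->
  exists L, Ccv (Csum u) L.
Proof.
  intros Hm Hs Hu; apply Cauchy_Ccv; intros eps; assert (He := cond_pos eps).
  destruct (ex_series_Rsum_tail m Hm Hs (mkposreal (eps / 3) ltac:(lra))) as [N HN];
    simpl in HN.
  assert (H : forall n, (N <= n)%nat -> (Cmod (Csum u n - Csum u N) <= eps / 3)%R).
  { intros n Hn; replace n with (N + (n - N))%nat by lia; set (p := (n - N)%nat).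
    apply Rle_trans with (2 := HN N p (le_n _)); generalize p; clear p; intros p.
    induction p as [|p IH].
    - rewrite Nat.add_0_r; replace (Csum u N - Csum u N) with (RtoC 0) by ring.
      rewrite Cmod_0; simpl; lra.
    - rewrite Nat.add_succ_r; simpl.
      replace (Csum u (N + p) + u (N + p)%nat - Csum u N)
        with ((Csum u (N + p) - Csum u N) + u (N + p)%nat) by ring.
      assert (T := Cmod_triangle (Csum u (N + p) - Csum u N) (u (N + p)%nat)).
      specialize (Hu (N + p)%nat); lra. }
  exists N; intros n p Hn Hp; assert (H1 := H n Hn); assert (H2 := H p Hp).
  replace (Csum u n - Csum u p) with ((Csum u n - Csum u N) - (Csum u p - Csum u N)) by ring.
  assert (T := Cmod_sub_le (Csum u n - Csum u N) (Csum u p - Csum u N)); lra.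
Qed.

Lemma infprod_shift (u : nat -> C) (N : nat) (P : C) :
  is_infprod (fun k => u (N + k)%nat) P -> is_infprod u (Cprod u N * P).
Proof.
  intros [K [q [Hq [H E]]]]; exists (N + K)%nat, q; split; [|split]; auto.
  - apply Ccv_filterlim; apply Ccv_filterlim in H; apply Ccv_ext with (2 := H); intros n.
    apply Cprod_ext; intros k _; rewrite Nat.add_assoc; auto.
  - rewrite E, Cprod_split; ring.
Qed.

(** Zeros of modulus at least 2 (|z| + 1) satisfy |a k - z| >= |a k| / 2. Then the product does not
    vanish at z and logarithmic differentiation applies with a majorant of order 1 / k^2. *)
Lemma E1_product_Cdiff_away (a : nat -> C) (c : R) (f : C -> C) (z : C) :
  (0 < c)%R -> (forall k, c * INR (S k) <= Cmod (a k))%R ->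
  (forall k, Cmod z + 1 <= Cmod (a k) / 2)%R ->
  (forall x, is_infprod (fun k => E1 (x / a k)) (f x)) ->
  exists l, Cdiff f z l.
Proof.
  intros Hc Ha Hz Hf.
  assert (Ha0 : forall k, a k <> 0) by (intros k; apply (Cneq_pos_INR_mult c _ k); auto).
  assert (Hck : forall k, (0 < c * INR (S k))%R)
    by (intros; apply Rmult_lt_0_compat; auto; apply INR_S_pos).
  assert (Haz : forall k, (c * INR (S k) / 2 <= Cmod (a k - z))%R).
  { intros k; specialize (Hz k); specialize (Ha k); specialize (Hck k).
    assert (T := Cmod_triangle_rev (a k) z); assert (T1 := Cmod_ge_0 z); lra. }
  assert (Haz0 : forall k, a k - z <> 0).
  { intros k; apply Cmod_gt_0; specialize (Haz k); specialize (Hck k); lra. }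
  assert (Hza : forall k, z <> a k) by (intros k E; apply (Haz0 k); rewrite E; ring).
  assert (Hzp := Cmod_ge_0 z).
  (* The summand 2 |z| / c^2 serves the linear coefficients, and 3 / c^2 with the exponential serves
     the quadratic remainders, since p^2 + q p <= 3 / (c (k + 1))^2 for p = 1 / |a k| and q = 1 / |a
     k - z|. *)
  set (A := ((2 * Cmod z + 3) / c ^ 2 * exp (/ c))%R).
  assert (Hc2 : (0 < c ^ 2)%R) by (apply pow_lt; auto).
  assert (HA : (0 <= A)%R).
  { apply Rmult_le_pos; [apply Rdiv_le_0_compat; lra | left; apply exp_pos]. }
  assert (He1 : (1 <= exp (/ c))%R).
  { assert (T := exp_ineq1_le (/ c)); assert (T2 := Rinv_0_lt_compat c Hc); lra. }
  set (l := fun k => / a k - / (a k - z)).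
  assert (Hinva : forall k, (/ Cmod (a k) <= / c * / INR (S k))%R).
  { intros k; rewrite <- Rinv_mult; apply Rinv_le_contravar; auto. }
  assert (Hinvz : forall k, (/ Cmod (a k - z) <= 2 * / c * / INR (S k))%R).
  { intros k; assert (HSk := INR_S_pos k).
    replace (2 * / c * / INR (S k))%R with (/ (c * INR (S k) / 2))%R by (field; lra).
    apply Rinv_le_contravar; auto; specialize (Hck k); lra. }
  assert (Hp1 : forall k, (0 < / Cmod (a k))%R)
    by (intros k; apply Rinv_0_lt_compat, Cmod_gt_0, Ha0).
  assert (Hp2 : forall k, (0 < / Cmod (a k - z))%R)
    by (intros k; apply Rinv_0_lt_compat, Cmod_gt_0, Haz0).
  assert (Hcp := Rinv_0_lt_compat c Hc).
  assert (Hl : forall k, (Cmod (l k) <= A * / INR (S k) ^ 2)%R).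
  { intros k; unfold l.
    replace (/ a k - / (a k - z)) with (- z * (/ a k * / (a k - z))) by (field; auto).
    rewrite 2 Cmod_mult, Cmod_opp, 2 Cmod_inv by auto.
    assert (H : (/ Cmod (a k) * / Cmod (a k - z)
      <= (/ c * / INR (S k)) * (2 * / c * / INR (S k)))%R)
      by (apply Rmult_le_compat; auto; left; auto).
    assert (HSk := INR_S_pos k).
    apply Rle_trans with (Cmod z * ((/ c * / INR (S k)) * (2 * / c * / INR (S k))))%R;
      [apply Rmult_le_compat_l; auto|].
    replace (Cmod z * (/ c * / INR (S k) * (2 * / c * / INR (S k))))%R
      with (2 * Cmod z / c ^ 2 * / INR (S k) ^ 2)%R by (field; lra).
    apply Rmult_le_compat_r; [left; apply Rinv_0_lt_compat, pow_lt; auto|].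
    unfold A; apply Rle_trans with ((2 * Cmod z + 3) / c ^ 2 * 1)%R.
    - rewrite Rmult_1_r; apply Rmult_le_compat_r; [left; apply Rinv_0_lt_compat|]; lra.
    - apply Rmult_le_compat_l; auto; apply Rdiv_le_0_compat; lra. }
  destruct (Csum_cv l _ (fun k => inv_sqr_ge0 A k HA) (ex_series_scal_inv_sqr A) Hl) as [L HL].
  exists (f z * L).
  apply Cdiff_infprod with (u := fun k x => E1 (x / a k)) (l := l)
    (m := fun k => (A * / INR (S k) ^ 2)%R) (d := 1%R); auto.
  - lra.
  - intros k; apply inv_sqr_ge0, HA.
  - apply ex_series_scal_inv_sqr.
  - intros k E; apply (E1_eq_0 z (a k)) in E; auto; apply (Hza k E).
  - intros k h Hh; rewrite E1_quotient by auto; unfold l.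
    replace ((/ a k - / (a k - z)) * h) with (h / a k - h / (a k - z)) by (field; auto).
    apply Rle_trans with (1 := E1_linear _ _).
    rewrite 2 Cmod_div by auto; unfold Rdiv.
    set (x := Cmod h) in *; assert (Hx : (0 <= x)%R) by apply Cmod_ge_0.
    assert (HSk := INR_S_pos k); assert (HS1 := INR_S_ge1 k).
    assert (Hi : (/ INR (S k) <= 1)%R) by (rewrite <- Rinv_1; apply Rinv_le_contravar; lra).
    assert (Hi0 := Rinv_0_lt_compat _ HSk).
    specialize (Hinva k); specialize (Hinvz k); specialize (Hp1 k); specialize (Hp2 k).
    set (p := (/ Cmod (a k))%R) in *; set (q := (/ Cmod (a k - z))%R) in *.
    set (i := (/ INR (S k))%R) in *.
    assert (Hexp : (exp (x * p) <= exp (/ c))%R).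
    { apply exp_le; apply Rle_trans with (1 * (/ c * 1))%R; [|lra].
      apply Rmult_le_compat; try lra; apply Rle_trans with (1 := Hinva).
      apply Rmult_le_compat_l; lra. }
    replace ((x * p) ^ 2 + x * q * (x * p))%R with ((p * p + q * p) * x ^ 2)%R by ring.
    assert (Hpq : (p * p + q * p <= 3 * (/ c) ^ 2 * i ^ 2)%R).
    { assert (G1 : (p * p <= (/ c * i) * (/ c * i))%R) by (apply Rmult_le_compat; lra).
      assert (G2 : (q * p <= (2 * / c * i) * (/ c * i))%R) by (apply Rmult_le_compat; lra).
      lra. }
    replace (A * / INR (S k) ^ 2 * x ^ 2)%R with
      ((2 * Cmod z + 3) * (/ c) ^ 2 * i ^ 2 * x ^ 2 * exp (/ c))%R
      by (unfold A, i; field; lra).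
    assert (Hx2 := pow2_ge_0 x).
    apply Rmult_le_compat; auto; [|left; apply exp_pos|].
    + apply Rmult_le_pos; auto; nra.
    + apply Rmult_le_compat_r; auto; apply Rle_trans with (1 := Hpq).
      assert (0 <= (/ c) ^ 2 * i ^ 2)%R by (apply Rmult_le_pos; apply pow2_ge_0); nra.
  - intros h _; apply infprod_Ccv, Hf.
  - intros E; apply (infprod_eq_0 _ _ (Hf z)) in E; destruct E as [k E].
    apply (E1_eq_0 z (a k)) in E; auto; apply (Hza k E).
Qed.

Lemma Cdiff_E1 (a z : C) :
  Cdiff (fun x => E1 (x / a)) z
    (- / a * Cexp (z / a) + (1 - z / a) * (Cexp (z / a) * / a)).
Proof.
  apply (Cdiff_mult (fun x => 1 - x / a) (fun x => Cexp (x / a)));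
    [|apply (Cdiff_Cexp (fun x => x / a))].
  - replace (- / a) with (- / a + 2 * 0 * z) by ring.
    apply Cdiff_ext with (2 := Cdiff_quadratic 1 (- / a) 0 z); intros x; unfold Cdiv; ring.
  - replace (/ a) with (/ a + 2 * 0 * z) by ring.
    apply Cdiff_ext with (2 := Cdiff_quadratic 0 (/ a) 0 z); intros x; unfold Cdiv; ring.
Qed.

(** It lets a product be written as a function of z through [Clim_seq], without choosing a limit for
    each z. *)
Lemma infprod_Clim_seq (u : nat -> C) :
  (exists P, is_infprod u P) -> is_infprod u (Clim_seq (Cprod u)).
Proof.
  intros [P HP]; rewrite (Ccv_Clim_seq _ P); auto; apply infprod_Ccv, HP.
Qed.

(** Logarithmic differentiation fails at the zeros of the product. The finitely many factors whose
    zeros may be near z are therefore split off and differentiated by the product rule. *)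
Lemma E1_product_Cdiff (a : nat -> C) (c : R) (f : C -> C) (z : C) :
  (0 < c)%R -> (forall k, c * INR (S k) <= Cmod (a k))%R ->
  (forall x, is_infprod (fun k => E1 (x / a k)) (f x)) ->
  exists l, Cdiff f z l.
Proof.
  intros Hc Ha Hf.
  destruct (INR_unbounded (2 * (Cmod z + 1) / c)) as [N HN].
  assert (HN' : (Cmod z + 1 <= c * INR N / 2)%R).
  { apply Rmult_le_reg_l with (2 / c)%R; [apply Rdiv_lt_0_compat; lra|].
    replace (2 / c * (c * INR N / 2))%R with (INR N) by (field; lra).
    replace (2 / c * (Cmod z + 1))%R with (2 * (Cmod z + 1) / c)%R by (field; lra); lra. }
  set (b := fun k => a (N + k)%nat).
  assert (Hb : forall k, (c * INR (S k) <= Cmod (b k))%R).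
  { intros k; unfold b; apply Rle_trans with (2 := Ha (N + k)%nat).
    apply Rmult_le_compat_l; [lra | apply le_INR; lia]. }
  set (g := fun x => Clim_seq (Cprod (fun k => E1 (x / b k)))).
  assert (Hg : forall x, is_infprod (fun k => E1 (x / b k)) (g x))
    by (intros x; apply infprod_Clim_seq, E1_infprod with c; auto).
  destruct (E1_product_Cdiff_away b c g z Hc Hb) as [l Hl]; auto.
  { intros k; unfold b; apply Rle_trans with (1 := HN').
    apply Rmult_le_compat_r; [lra|]; apply Rle_trans with (2 := Ha (N + k)%nat).
    apply Rmult_le_compat_l; [lra | apply le_INR; lia]. }
  destruct (Cdiff_Cprod (fun k x => E1 (x / a k)) (fun k => (- / a k) * Cexp (z / a k) +
    (1 - z / a k) * (Cexp (z / a k) * / a k)) z N) as [m Hm].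
  { intros k; apply Cdiff_E1. }
  exists (m * g z + Cprod (fun k => E1 (z / a k)) N * l).
  apply Cdiff_ext with (fun x => Cprod (fun k => E1 (x / a k)) N * g x);
    [|apply Cdiff_mult; auto].
  intros x; apply Ccv_unique with (Cprod (fun k => E1 (x / a k))); apply infprod_Ccv; auto.
  apply infprod_shift, Hg.
Qed.

(** * The Gamma function *)

Definition Gamma_seq (z : C) (n : nat) : C :=
  INR (fact n) * Cexp (z * ln (INR n)) / Cprod (fun k => z + INR k) (S n).

Lemma nonpos_integer_neq (z : C) (k : nat) : ~ nonpos_integer z -> z + INR k <> 0.
Proof.
  intros H E; apply H; exists k.
  replace z with (z + INR k - INR k) by ring; rewrite E; ring.
Qed.

Lemma rising_product (z : C) (n : nat) :
  Cprod (fun k => z + INR k) (S n)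
  = INR (fact n) * z * Cprod (fun k => E1 (z / - INR (S k))) n * Cexp (z * harmonic n).
Proof.
  induction n as [|n IH].
  - simpl; unfold harmonic; simpl; rewrite Cmult_0_r, Cexp_0; ring.
  - change (Cprod (fun k => z + INR k) (S (S n)))
      with (Cprod (fun k => z + INR k) (S n) * (z + INR (S n))).
    change (Cprod (fun k => E1 (z / - INR (S k))) (S n))
      with (Cprod (fun k => E1 (z / - INR (S k))) n * E1 (z / - INR (S n))).
    rewrite IH; change (harmonic (S n)) with (harmonic n + / INR (S n))%R.
    rewrite fact_simpl, mult_INR, RtoC_mult, RtoC_plus, RtoC_inv
      by (apply Rgt_not_eq, INR_S_pos).
    assert (H := INR_S_neq_0 n); unfold E1.
    replace (z * (harmonic n + / INR (S n))) with (z * harmonic n + - (z / - INR (S n)))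
      by (field; auto).
    rewrite Cexp_plus, Cexp_opp; field; split; auto; apply Cexp_neq_0.
Qed.

(** By [rising_product], Euler's sequence is the reciprocal of partial products of z exp (gamma z)
    prod (1 + z / k) exp (- z / k), with H_n - ln n in place of gamma. Only the non-positive
    integers make a factor vanish. *)
Lemma Gamma_seq_cv (z : C) :
  ~ nonpos_integer z -> Ccv (Gamma_seq z) (Gamma z) /\ Gamma z <> 0.
Proof.
  intros Hz.
  assert (Hz0 : z <> 0).
  { intros E; apply (nonpos_integer_neq z 0 Hz); rewrite E; simpl; ring. }
  destruct (E1_infprod (fun k => - INR (S k)) 1 z) as [P HP]; [lra| |].
  { intros k; rewrite Cmod_opp, Cmod_R, Rabs_pos_eq by apply pos_INR; lra. }
  assert (HP0 : P <> 0).
  { intros E; apply (infprod_eq_0 _ _ HP) in E; destruct E as [k E].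
    apply (E1_eq_0 z (- INR (S k))) in E; [apply Hz; exists (S k); exact E|].
    intros H0; apply (INR_S_neq_0 k).
    replace (RtoC (INR (S k))) with (- - INR (S k)) by ring; rewrite H0; ring. }
  set (R := z * P * Cexp (z * euler_const)).
  assert (HR : R <> 0)
    by (unfold R; repeat apply Cmult_neq_0; auto; apply Cexp_neq_0).
  assert (H : Ccv (Gamma_seq z) (/ R)).
  { apply Ccv_ext with (fun n => / (z * Cprod (fun k => E1 (z / - INR (S k))) n
      * Cexp (z * (harmonic n - ln (INR n))%R))).
    - intros n; unfold Gamma_seq; rewrite rising_product, RtoC_minus.
      replace (z * (harmonic n - ln (INR n))) with (z * harmonic n + - (z * ln (INR n))) by ring.
      rewrite Cexp_plus, Cexp_opp.
      assert (H1 : RtoC (INR (fact n)) <> 0)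
        by (intros H; apply RtoC_inj in H; apply (INR_fact_neq_0 n); auto).
      assert (H2 := Cexp_neq_0 (z * ln (INR n))); assert (H3 := Cexp_neq_0 (z * harmonic n)).
      assert (H4 : Cprod (fun k => E1 (z / - INR (S k))) n <> 0).
      { apply Cprod_neq_0; intros k _ E; apply HP0, (infprod_eq_0 _ _ HP); exists k; auto. }
      field; auto.
    - apply Ccv_inv; auto; apply Ccv_mult; [apply Ccv_scal, infprod_Ccv, HP|].
      apply Ccv_Cexp, Ccv_scal, Ccv_RtoC, euler_const_lim. }
  assert (E : Gamma z = / R) by (apply Ccv_Clim_seq, H).
  rewrite E; split; auto; intros E0; apply C1_nz.
  rewrite <- (Cinv_r R), E0 by auto; ring.
Qed.

(** * The logarithmic derivative of the Barnes function *)

(** The primary factor of genus two at - x. The k-th Barnes factor, k >= 1, is its k-th power at w /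
    k; the cubic error of [E2] leaves O(1 / k^2) after the power is taken. *)
Definition E2 (x : C) : C := (1 + x) * Cexp (- x + x ^ 2 / 2).

Lemma C2_neq_0 : RtoC 2 <> 0.
Proof. intros H; apply RtoC_inj in H; lra. Qed.

Lemma E2_sub1 : exists M, (0 <= M)%R /\
  forall x, (Cmod x <= 1)%R -> (Cmod (E2 x - 1) <= M * Cmod x ^ 3)%R.
Proof.
  exists (2 + 16 * exp 2)%R; split; [assert (T := exp_pos 2); lra|].
  intros x Hx; assert (Hx0 := Cmod_ge_0 x); set (y := - x + x ^ 2 / 2).
  assert (Hy : (Cmod y <= 2 * Cmod x)%R).
  { unfold y; apply Rle_trans with (1 := Cmod_triangle _ _).
    rewrite Cmod_opp, Cmod_div, Cmod_pow, Cmod_R, Rabs_pos_eq by (lra || apply C2_neq_0).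
    nra. }
  (* In (1 + x) (1 + y + y^2 / 2) the terms in x and x^2 cancel, which leaves 1 + x^3 (1/2 - 3 x / 8
     + x^2 / 8). *)
  replace (E2 x - 1) with ((1 + x) * (Cexp y - 1 - y - y ^ 2 / 2)
    + x ^ 3 * (/ 2 - 3 / 8 * x + x ^ 2 / 8)).
  2:{ unfold E2; fold y; unfold y; field; intros H; apply RtoC_inj in H; lra. }
  apply Rle_trans with (1 := Cmod_triangle _ _); rewrite 2 Cmod_mult, Cmod_pow.
  assert (T1 : (Cmod (1 + x) <= 2)%R).
  { apply Rle_trans with (1 := Cmod_triangle _ _); rewrite Cmod_1; lra. }
  assert (T2 : (Cmod (Cexp y - 1 - y - y ^ 2 / 2) <= 8 * Cmod x ^ 3 * exp 2)%R).
  { apply Rle_trans with (1 := Cexp_taylor3 y).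
    replace (8 * Cmod x ^ 3)%R with ((2 * Cmod x) ^ 3)%R by ring.
    apply Rmult_le_compat; [apply pow_le, Cmod_ge_0 | left; apply exp_pos| |].
    - apply pow_incr; split; auto; apply Cmod_ge_0.
    - apply exp_le; lra. }
  assert (T3 : (Cmod (/ 2 - 3 / 8 * x + x ^ 2 / 8) <= 2)%R).
  { replace (/ 2 - 3 / 8 * x + x ^ 2 / 8) with ((/ 2)%R + ((- (3 / 8))%R * x + (/ 8)%R * x ^ 2)).
    - apply Rle_trans with (1 := Cmod_triangle _ _).
      assert (T := Cmod_triangle ((- (3 / 8))%R * x) ((/ 8)%R * x ^ 2)).
      rewrite 2 Cmod_mult, Cmod_pow, 2 Cmod_R, Rabs_left, Rabs_pos_eq in T by lra.
      rewrite Cmod_R, Rabs_pos_eq by lra; nra.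
    - rewrite RtoC_opp, RtoC_div, 2 RtoC_inv by lra; field. }
  assert (T4 : (0 <= Cmod x ^ 3)%R) by (apply pow_le, Hx0).
  assert (G1 : (Cmod (1 + x) * Cmod (Cexp y - 1 - y - y ^ 2 / 2)
    <= 2 * (8 * Cmod x ^ 3 * exp 2))%R)
    by (apply Rmult_le_compat; auto; apply Cmod_ge_0).
  assert (G2 : (Cmod x ^ 3 * Cmod (/ 2 - 3 / 8 * x + x ^ 2 / 8) <= Cmod x ^ 3 * 2)%R)
    by (apply Rmult_le_compat_l; auto).
  lra.
Qed.

Lemma Cpow_Cprod (c : C) (n : nat) : c ^ n = Cprod (fun _ => c) n.
Proof. induction n as [|n IH]; [reflexivity|]; rewrite Cpow_S, IH; simpl; ring. Qed.

Lemma Rsum_const (a : R) (n : nat) : Rsum (fun _ => a) n = (INR n * a)%R.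
Proof. induction n as [|n IH]; [simpl; ring|]; rewrite S_INR; simpl Rsum; rewrite IH; ring. Qed.

Lemma Cmod_pow_sub1 (c : C) (n : nat) (s : R) :
  (INR n * Cmod (c - 1) <= s -> Cmod (c ^ n - 1) <= s * exp s)%R.
Proof.
  intros H; rewrite Cpow_Cprod; apply Rle_trans with (2 := exp_sub1_le s).
  apply Cmod_Cprod_sub1_bound with (fun _ => Cmod (c - 1)); [intros; lra|].
  rewrite Rsum_const; auto.
Qed.

Definition barnes_factor (z : C) (k : nat) : C :=
  (1 + (z - 1) / INR (S k)) ^ S k * Cexp ((z - 1) ^ 2 / (2 * INR (S k)) - (z - 1)).

Lemma barnes_factor_E2 (z : C) (k : nat) :
  barnes_factor z k = E2 ((z - 1) / INR (S k)) ^ S k.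
Proof.
  unfold barnes_factor, E2; rewrite Cpow_mult_l, <- Cexp_INR; do 2 f_equal.
  assert (H := INR_S_neq_0 k); field; auto.
Qed.

Lemma barnes_infprod (z : C) : exists P, is_infprod (barnes_factor z) P.
Proof.
  destruct E2_sub1 as [M [HM H]]; set (w := z - 1); assert (Hw := Cmod_ge_0 w).
  destruct (INR_unbounded (Cmod w)) as [K HK].
  set (A := (M * Cmod w ^ 3)%R).
  assert (HA : (0 <= A)%R) by (apply Rmult_le_pos; [|apply pow_le]; auto).
  apply infprod_exists with (fun k => A * exp A * / INR (S k) ^ 2)%R K;
    [apply ex_series_scal_inv_sqr|].
  intros k Hk; rewrite barnes_factor_E2; fold w.
  assert (HS := INR_S_pos k); assert (HS1 := INR_S_ge1 k).
  assert (HwS : (Cmod w <= INR (S k))%R).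
  { left; apply Rlt_le_trans with (INR K); [lra | apply le_INR; lia]. }
  assert (Hc : Cmod (w / INR (S k)) = (Cmod w / INR (S k))%R).
  { rewrite Cmod_div by apply INR_S_neq_0; rewrite Cmod_R, Rabs_pos_eq by lra; auto. }
  assert (Hx : (Cmod (w / INR (S k)) <= 1)%R).
  { rewrite Hc; apply Rmult_le_reg_r with (INR (S k)); auto.
    replace (Cmod w / INR (S k) * INR (S k))%R with (Cmod w) by (field; lra); lra. }
  set (s := (A * / INR (S k) ^ 2)%R).
  assert (Hs : (0 <= s <= A)%R).
  { assert (T : (/ INR (S k) ^ 2 <= 1)%R) by (rewrite <- Rinv_1; apply Rinv_le_contravar; nra).
    assert (T2 : (0 < / INR (S k) ^ 2)%R) by (apply Rinv_0_lt_compat, pow_lt; auto).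
    unfold s; nra. }
  replace (A * exp A * / INR (S k) ^ 2)%R with (s * exp A)%R by (unfold s; ring).
  apply Rle_trans with (s * exp s)%R.
  - apply Cmod_pow_sub1.
    apply Rle_trans with (INR (S k) * (M * Cmod (w / INR (S k)) ^ 3))%R;
      [apply Rmult_le_compat_l; [lra | apply H; auto]|].
    rewrite Hc; right; unfold s, A; field; lra.
  - apply Rmult_le_compat_l; [lra | apply exp_le; lra].
Qed.

Lemma finite_positive_lower_bound (f : nat -> R) (N : nat) :
  (forall k, 0 < f k)%R -> exists e, (0 < e)%R /\ forall k, (k < N)%nat -> (e <= f k)%R.
Proof.
  intros Hf; induction N as [|N [e [He IH]]].
  - exists 1%R; split; [lra|]; intros; lia.
  - exists (Rmin e (f N)); split; [apply Rmin_glb_lt; auto|]; intros k Hk.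
    destruct (Nat.eq_dec k N) as [->|Hn]; [apply Rmin_r|].
    apply Rle_trans with (1 := Rmin_l _ _), IH; lia.
Qed.

(** For large k the ratio is at least 1/2 by the triangle inequality, and the finitely many
    remaining ratios are positive. *)
Lemma shifted_lower_bound (z : C) : ~ nonpos_integer z ->
  exists e, (0 < e <= 1)%R /\ forall k, (e * INR (S k) <= Cmod (INR (S k) + (z - 1)))%R.
Proof.
  intros Hz; set (w := z - 1).
  assert (Hw : forall k, INR (S k) + w <> 0).
  { intros k; unfold w; rewrite S_INR, RtoC_plus.
    replace (INR k + 1 + (z - 1)) with (z + INR k) by ring; apply nonpos_integer_neq, Hz. }
  destruct (INR_unbounded (2 * Cmod w)) as [N HN].
  destruct (finite_positive_lower_bound (fun k => Cmod (INR (S k) + w) / INR (S k))%R N)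
    as [e [He H]].
  { intros k; apply Rdiv_lt_0_compat; [apply Cmod_gt_0; auto | apply INR_S_pos]. }
  assert (R1 := Rmin_l e (1 / 2)); assert (R2 := Rmin_r e (1 / 2)).
  exists (Rmin e (1 / 2)); split; [split; [apply Rmin_glb_lt; lra | lra]|].
  intros k; assert (HS := INR_S_pos k); destruct (le_lt_dec N k) as [Hk|Hk].
  - assert (T := Cmod_triangle_rev (INR (S k)) (- w)).
    replace (INR (S k) - - w) with (INR (S k) + w) in T by ring.
    rewrite Cmod_opp, Cmod_R, Rabs_pos_eq in T by lra.
    assert (INR N <= INR (S k))%R by (apply le_INR; lia); nra.
  - specialize (H k Hk); apply Rle_trans with (e * INR (S k))%R; [nra|].
    apply Rmult_le_reg_r with (/ INR (S k))%R; [apply Rinv_0_lt_compat; auto|].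
    rewrite Rmult_assoc, Rinv_r, Rmult_1_r by lra; exact H.
Qed.

(** The logarithmic derivative K / (K + w) + w / K - 1 of the factor with K = k + 1 and w = z - 1,
    brought over one denominator to exhibit its size 1 / K^2. *)
Definition barnes_dlog (z : C) (k : nat) : C :=
  (z - 1) ^ 2 / (INR (S k) * (INR (S k) + (z - 1))).

(** The power of [E2] is 1 + O(h^3 / N^2). Taking it out leaves an exponent whose linear coefficient
    is the logarithmic derivative and whose quadratic coefficient is also O(1 / N^2), so all errors
    are summable. *)
Lemma barnes_factor_quotient (z h : C) (k : nat) :
  let N := RtoC (INR (S k)) in let w := z - 1 in
  N + w <> 0 ->
  barnes_factor (z + h) k / barnes_factor z k =
  E2 (h / (N + w)) ^ S k
  * Cexp (barnes_dlog z k * h + (2 * N * w + w ^ 2) / (2 * N * (N + w) ^ 2) * h ^ 2).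
Proof.
  intros N w Hw; assert (HN : N <> 0) by apply INR_S_neq_0.
  assert (E : barnes_factor (z + h) k = barnes_factor z k *
    (E2 (h / (N + w)) ^ S k
  * Cexp (barnes_dlog z k * h + (2 * N * w + w ^ 2) / (2 * N * (N + w) ^ 2) * h ^ 2))).
  { unfold barnes_factor, barnes_dlog, E2; fold N; fold w.
    replace (z + h - 1) with (w + h) by (unfold w; ring).
    replace (1 + (w + h) / N) with ((1 + w / N) * (1 + h / (N + w))) by (field; auto).
    rewrite !Cpow_mult_l, <- Cexp_INR; fold N.
    set (p := (1 + w / N) ^ S k); set (q := (1 + h / (N + w)) ^ S k).
    match goal with |- _ = p * Cexp ?a * (q * Cexp ?b * Cexp ?c) =>
      replace (p * Cexp a * (q * Cexp b * Cexp c)) with (p * q * (Cexp a * Cexp b * Cexp c))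
        by ring end.
    rewrite <- !Cexp_plus; do 2 f_equal; field; repeat split; auto; apply C2_neq_0. }
  rewrite E; field; unfold barnes_factor; apply Cmult_neq_0; [|apply Cexp_neq_0].
  apply Cpow_nz; fold N; fold w; intros E0; apply Hw.
  replace (N + w) with (N * (1 + w / N)) by (field; auto); rewrite E0; ring.
Qed.

Lemma barnes_product_Cdiff (z : C) (f : C -> C) :
  ~ nonpos_integer z -> (forall x, is_infprod (barnes_factor x) (f x)) ->
  exists L, f z <> 0 /\ Ccv (Csum (barnes_dlog z)) L /\ Cdiff f z (f z * L).
Proof.
  intros Hz Hf.
  destruct (shifted_lower_bound z Hz) as [e [[He He1] Hlow]].
  destruct E2_sub1 as [M [HM HE2]].
  set (w := z - 1) in *; assert (Hw := Cmod_ge_0 w); set (W := Cmod w) in *.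
  assert (HNw : forall k, INR (S k) + w <> 0).
  { intros k; apply Cmod_gt_0; apply Rlt_le_trans with (2 := Hlow k).
    apply Rmult_lt_0_compat; auto; apply INR_S_pos. }
  assert (Hfac : forall k, barnes_factor z k <> 0).
  { intros k; unfold barnes_factor; apply Cmult_neq_0; [|apply Cexp_neq_0].
    apply Cpow_nz; fold w; intros E0; apply (HNw k).
    assert (T := INR_S_neq_0 k).
    replace (INR (S k) + w) with (INR (S k) * (1 + w / INR (S k))) by (field; auto).
    rewrite E0; ring. }
  assert (Hfz : f z <> 0).
  { intros E; apply (infprod_eq_0 _ _ (Hf z)) in E; destruct E as [k E]; apply (Hfac k E). }
  set (r := (/ e)%R); assert (Hr : (0 < r)%R) by (apply Rinv_0_lt_compat; auto).
  assert (Hr1 : (1 <= r)%R) by (unfold r; rewrite <- Rinv_1; apply Rinv_le_contravar; lra).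
  assert (Hinv : forall k, (/ Cmod (INR (S k) + w) <= r * / INR (S k))%R).
  { intros k; unfold r; rewrite <- Rinv_mult; apply Rinv_le_contravar; auto.
    apply Rmult_lt_0_compat; auto; apply INR_S_pos. }
  assert (Hinv0 : forall k, (0 < / Cmod (INR (S k) + w))%R)
    by (intros k; apply Rinv_0_lt_compat, Cmod_gt_0, HNw).
  set (A := (r ^ 2 * (W ^ 2 + W + 1))%R).
  assert (HA : (1 <= A)%R) by (unfold A; nra).
  assert (Hl : forall k, (Cmod (barnes_dlog z k) <= A * / INR (S k) ^ 2)%R).
  { intros k; unfold barnes_dlog; fold w; assert (HS := INR_S_pos k).
    rewrite Cmod_div by (apply Cmult_neq_0; auto; apply INR_S_neq_0).
    rewrite Cmod_pow, Cmod_mult, Cmod_R, Rabs_pos_eq by lra; fold W.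
    unfold Rdiv; rewrite Rinv_mult; specialize (Hinv k); specialize (Hinv0 k).
    assert (Hi := Rinv_0_lt_compat _ HS).
    replace (/ INR (S k) ^ 2)%R with (/ INR (S k) * / INR (S k))%R by (field; lra).
    set (i := (/ INR (S k))%R) in *; set (q := (/ Cmod (INR (S k) + w))%R) in *.
    apply Rle_trans with (W ^ 2 * (i * (r * i)))%R.
    - apply Rmult_le_compat_l; [apply pow2_ge_0|]; apply Rmult_le_compat_l; lra.
    - replace (W ^ 2 * (i * (r * i)))%R with ((r * W ^ 2) * (i * i))%R by ring.
      apply Rmult_le_compat_r; [nra|]; unfold A.
      assert (H1 : (r * W ^ 2 <= r ^ 2 * W ^ 2)%R)
        by (apply Rmult_le_compat_r; [apply pow2_ge_0 | nra]).
      assert (H2 : (0 <= r ^ 2 * (W + 1))%R) by (apply Rmult_le_pos; [apply pow2_ge_0 | lra]).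
      lra. }
  assert (Hq : forall k, (Cmod ((2 * INR (S k) * w + w ^ 2)
    / (2 * INR (S k) * (INR (S k) + w) ^ 2)) <= A * / INR (S k) ^ 2)%R).
  { intros k; assert (HS := INR_S_pos k); assert (HS1 := INR_S_ge1 k).
    assert (HNk := INR_S_neq_0 k).
    rewrite Cmod_div.
    2:{ apply Cmult_neq_0; [apply Cmult_neq_0; auto; apply C2_neq_0 | apply Cpow_nz; auto]. }
    rewrite 2 Cmod_mult, Cmod_pow, 2 Cmod_R, 2 Rabs_pos_eq by lra.
    unfold Rdiv; rewrite 2 Rinv_mult, <- pow_inv.
    specialize (Hinv k); specialize (Hinv0 k).
    set (q := (/ Cmod (INR (S k) + w))%R) in *; set (N := INR (S k)) in *.
    assert (T : (Cmod (2 * N * w + w ^ 2) <= 2 * N * W + W ^ 2)%R).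
    { apply Rle_trans with (1 := Cmod_triangle _ _).
      rewrite 2 Cmod_mult, Cmod_pow, 2 Cmod_R, 2 Rabs_pos_eq by lra; fold W; lra. }
    assert (Hi := Rinv_0_lt_compat _ HS).
    assert (Q : (q ^ 2 <= (r * / N) ^ 2)%R) by (apply pow_incr; lra).
    apply Rle_trans with ((2 * N * W + W ^ 2) * (/ 2 * / N * (r * / N) ^ 2))%R.
    - apply Rmult_le_compat; auto; [apply Cmod_ge_0| |].
      + apply Rmult_le_pos; [nra | apply pow2_ge_0].
      + apply Rmult_le_compat_l; [nra | auto].
    - replace ((2 * N * W + W ^ 2) * (/ 2 * / N * (r * / N) ^ 2))%R
        with (r ^ 2 * (W + W ^ 2 / 2 * / N) * / N ^ 2)%R by (field; lra).
      apply Rmult_le_compat_r; [left; apply Rinv_0_lt_compat, pow_lt; auto|].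
      unfold A; apply Rmult_le_compat_l; [apply pow2_ge_0|].
      assert (/ N <= 1)%R by (rewrite <- Rinv_1; apply Rinv_le_contravar; lra).
      assert (0 <= W ^ 2)%R by apply pow2_ge_0; nra. }
  set (D := (M * r ^ 3)%R).
  assert (HD : (0 <= D)%R) by (apply Rmult_le_pos; [|apply pow_le]; lra).
  (* The three summands pay for the power of [E2] (through [D]), the Taylor remainder of the
     exponential, and the h^2 term of its exponent; [A] bounds both coefficients of the exponent. *)
  set (B := (D * exp D * exp (2 * A) + 4 * A ^ 2 * exp (2 * A) + A)%R).
  assert (He2 := exp_pos (2 * A)); assert (HeD := exp_pos D).
  assert (HB : (A <= B)%R).
  { unfold B; assert (0 <= D * exp D * exp (2 * A))%R
      by (repeat apply Rmult_le_pos; lra).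
    assert (0 <= 4 * A ^ 2 * exp (2 * A))%R
      by (assert (T := pow2_ge_0 A); apply Rmult_le_pos; lra); lra. }
  destruct (Csum_cv (barnes_dlog z) _ (fun k => inv_sqr_ge0 A k ltac:(lra))
    (ex_series_scal_inv_sqr A) Hl) as [L HL].
  exists L; split; auto; split; auto.
  (* Within the radius [e] the argument h / (N + w) has modulus at most 1, as [E2_sub1] requires. *)
  apply Cdiff_infprod with (u := fun k x => barnes_factor x k) (l := barnes_dlog z)
    (m := fun k => (B * / INR (S k) ^ 2)%R) (d := e); auto.
  - intros k; apply inv_sqr_ge0; lra.
  - apply ex_series_scal_inv_sqr.
  - intros k h Hh; rewrite barnes_factor_quotient by apply HNw; fold w.
    specialize (Hl k); specialize (Hq k); specialize (Hinv k); specialize (Hinv0 k).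
    specialize (Hlow k); specialize (HNw k).
    set (l := barnes_dlog z k) in *.
    set (q := (2 * INR (S k) * w + w ^ 2) / (2 * INR (S k) * (INR (S k) + w) ^ 2)) in *.
    set (x := h / (INR (S k) + w)).
    assert (HS := INR_S_pos k); assert (HS1 := INR_S_ge1 k); set (N := INR (S k)) in *.
    assert (Hh0 := Cmod_ge_0 h); set (t := Cmod h) in *.
    assert (Hx : (Cmod x <= t * (r * / N))%R).
    { unfold x; rewrite Cmod_div by auto; apply Rmult_le_compat_l; auto. }
    assert (Hi0 := Rinv_0_lt_compat _ HS).
    assert (Hi1 : (/ N <= 1)%R) by (rewrite <- Rinv_1; apply Rinv_le_contravar; lra).
    assert (Htr : (t * r <= 1)%R).
    { apply Rle_trans with (e * r)%R; [apply Rmult_le_compat_r; lra|].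
      unfold r; rewrite Rinv_r; lra. }
    assert (Ht1 : (t <= 1)%R) by nra.
    assert (Hx1 : (Cmod x <= 1)%R) by nra.
    set (y := E2 x ^ S k) in *.
    set (i2 := (/ N ^ 2)%R) in *.
    assert (Hi2 : (0 < i2 <= 1)%R).
    { split; [apply Rinv_0_lt_compat, pow_lt; auto|].
      unfold i2; rewrite <- Rinv_1; apply Rinv_le_contravar; nra. }
    assert (Hy : (Cmod (y - 1) <= D * t ^ 2 * i2 * exp D)%R).
    { apply Rle_trans with (D * t ^ 2 * i2 * exp (D * t ^ 2 * i2))%R.
      - apply Cmod_pow_sub1; fold N.
        apply Rle_trans with (N * (M * (t * (r * / N)) ^ 3))%R.
        + apply Rmult_le_compat_l; [lra|]; apply Rle_trans with (1 := HE2 x Hx1).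
          apply Rmult_le_compat_l; auto; apply pow_incr; split; auto; apply Cmod_ge_0.
        + replace (N * (M * (t * (r * / N)) ^ 3))%R with (D * t ^ 2 * i2 * t)%R
            by (unfold D, i2; field; lra).
          rewrite <- (Rmult_1_r (D * t ^ 2 * i2)) at 2.
          apply Rmult_le_compat_l; auto; repeat apply Rmult_le_pos; auto; nra.
      - apply Rmult_le_compat_l; [repeat apply Rmult_le_pos; auto; nra|].
        apply exp_le; rewrite Rmult_assoc; rewrite <- (Rmult_1_r D) at 2.
        apply Rmult_le_compat_l; auto; nra. }
    set (E := l * h + q * h ^ 2).
    assert (HE : (Cmod E <= 2 * A * i2 * t)%R).
    { unfold E; apply Rle_trans with (1 := Cmod_triangle _ _).
      rewrite 2 Cmod_mult, Cmod_pow; fold t.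
      assert (Cmod l * t <= A * i2 * t)%R by (apply Rmult_le_compat_r; auto).
      assert (Cmod q * t ^ 2 <= A * i2 * t)%R; [|lra].
      apply Rmult_le_compat; auto; [apply Cmod_ge_0 | apply pow2_ge_0 | nra]. }
    assert (HE' : (Cmod E <= 2 * A)%R).
    { apply Rle_trans with (1 := HE); rewrite Rmult_assoc; rewrite <- (Rmult_1_r (2 * A)) at 2.
      apply Rmult_le_compat_l; [lra | nra]. }
    replace (y * Cexp E - 1 - l * h) with ((y - 1) * Cexp E + ((Cexp E - 1 - E) + q * h ^ 2))
      by (unfold E; ring).
    apply Rle_trans with (1 := Cmod_triangle _ _).
    apply Rle_trans with (Cmod ((y - 1) * Cexp E) + (Cmod (Cexp E - 1 - E) + Cmod (q * h ^ 2)))%R;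
      [apply Rplus_le_compat_l, Cmod_triangle|].
    rewrite 2 Cmod_mult, Cmod_pow; fold t.
    assert (G1 : (Cmod (y - 1) * Cmod (Cexp E) <= (D * t ^ 2 * i2 * exp D) * exp (2 * A))%R).
    { apply Rmult_le_compat; auto; try apply Cmod_ge_0.
      apply Rle_trans with (1 := Cmod_Cexp_le E), exp_le, HE'. }
    assert (G2 : (Cmod (Cexp E - 1 - E) <= (4 * A ^ 2 * i2 * t ^ 2) * exp (2 * A))%R).
    { apply Rle_trans with (1 := Cexp_taylor2 E).
      apply Rmult_le_compat; [apply pow2_ge_0 | left; apply exp_pos| |apply exp_le, HE'].
      apply Rle_trans with ((2 * A * i2 * t) ^ 2)%R;
        [apply pow_incr; split; auto; apply Cmod_ge_0|].
      replace ((2 * A * i2 * t) ^ 2)%R with (4 * A ^ 2 * t ^ 2 * i2 * i2)%R by ring.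
      replace (4 * A ^ 2 * i2 * t ^ 2)%R with (4 * A ^ 2 * t ^ 2 * i2 * 1)%R by ring.
      apply Rmult_le_compat_l; [|lra].
      assert (T1 := pow2_ge_0 A); assert (T2 := pow2_ge_0 t); apply Rmult_le_pos; [apply Rmult_le_pos|]; lra. }
    assert (G3 : (Cmod q * t ^ 2 <= A * i2 * t ^ 2)%R)
      by (apply Rmult_le_compat_r; auto; apply pow2_ge_0).
    unfold B; lra.
  - intros k; apply Rle_trans with (1 := Hl k), Rmult_le_compat_r; auto.
    left; apply Rinv_0_lt_compat, pow_lt, INR_S_pos.
  - intros h _; apply infprod_Ccv, Hf.
Qed.

(** The value psi_G(1): the given formula reads psi_G(z) = kappa + (z - 1) (psi(z) - 1). *)
Definition kappa : R := ((ln (2 * PI) - 1) / 2)%R.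

Lemma psi_G_series (z : C) : ~ nonpos_integer z ->
  exists L, Ccv (Csum (barnes_dlog z)) L /\
    psi_G z = kappa - (1 + euler_const) * (z - 1) + L.
Proof.
  intros Hz; set (f := fun x => Clim_seq (Cprod (barnes_factor x))).
  assert (Hf : forall x, is_infprod (barnes_factor x) (f x))
    by (intros x; apply infprod_Clim_seq, barnes_infprod).
  destruct (barnes_product_Cdiff z f Hz Hf) as [L [Hfz [HL Hd]]].
  exists L; split; auto.
  set (a := fun x : C => (x - 1) / 2 * ln (2 * PI)%R).
  set (b := fun x : C => - (x - 1 + (1 + euler_const) * (x - 1) ^ 2) / 2).
  set (t := RtoC (ln (2 * PI))); set (g := RtoC euler_const).
  assert (Ha : Cdiff a z (t / 2)).
  { replace (t / 2) with (t / 2 + 2 * 0 * z) by ring.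
    apply Cdiff_ext with (2 := Cdiff_quadratic (- (t / 2)) (t / 2) 0 z); intros x.
    unfold a; fold t; field; apply C2_neq_0. }
  assert (Hb : Cdiff b z (- / 2 - (1 + g) * (z - 1))).
  { replace (- / 2 - (1 + g) * (z - 1)) with
      (- / 2 + (1 + g) + 2 * (- (1 + g) / 2) * z) by (field; apply C2_neq_0).
    apply Cdiff_ext with (2 := Cdiff_quadratic (/ 2 - (1 + g) / 2) (- / 2 + (1 + g))
      (- (1 + g) / 2) z).
    intros x; unfold b; fold g; field; apply C2_neq_0. }
  assert (E : forall x, Cexp (a x) * Cexp (b x) * f x = BarnesG x) by reflexivity.
  assert (H := Cdiff_mult _ _ _ _ _ (Cdiff_mult _ _ _ _ _
    (Cdiff_Cexp _ _ _ Ha) (Cdiff_Cexp _ _ _ Hb)) Hd); cbv beta in H.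
  apply (Cdiff_ext _ _ _ _ E), Cdiff_C_derive in H.
  unfold psi_G; rewrite H, <- E; unfold kappa; rewrite RtoC_div, RtoC_minus by lra; fold t; fold g.
  field; repeat split; auto; apply Cexp_neq_0.
Qed.

(** Splitting w^2 / (k (k + w)) = w (1 / k - 1 / (k + w)) turns the partial sums of the series into
    harmonic numbers minus the sums of the 1 / (z + k). Then H_n - ln n absorbs gamma. *)
Lemma psi_G_limit (z : C) : ~ nonpos_integer z ->
  Ccv (fun n => kappa + (z - 1) * (ln (INR n) - 1 - Csum (fun k => / (z + INR k)) (S n)))
    (psi_G z).
Proof.
  intros Hz; destruct (psi_G_series z Hz) as [L [HL E]]; rewrite E.
  apply Ccv_ext with (fun n => kappa - (z - 1) +
    (z - 1) * (-(1) * (harmonic n - ln (INR n))%R - (/ INR (S n))%R)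
    + Csum (barnes_dlog z) (S n)).
  - intros n.
    assert (Hs : forall m, Csum (barnes_dlog z) m =
      (z - 1) * (harmonic m - Csum (fun k => / (z + INR k)) m)).
    { induction m as [|m IH]; [unfold harmonic; simpl; ring|].
      change (harmonic (S m)) with (harmonic m + / INR (S m))%R; simpl Csum.
      rewrite IH, RtoC_plus, RtoC_inv by (apply Rgt_not_eq, INR_S_pos).
      assert (H1 := INR_S_neq_0 m); assert (H2 := nonpos_integer_neq z m Hz).
      assert (H3 : RtoC (INR (S m)) = INR m + 1) by (rewrite S_INR, RtoC_plus; auto).
      unfold barnes_dlog; rewrite H3 in *.
      replace (INR m + 1 + (z - 1)) with (z + INR m) by ring; field; auto. }
    rewrite Hs; change (harmonic (S n)) with (harmonic n + / INR (S n))%R.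
    rewrite RtoC_plus, RtoC_minus; ring.
  - replace (kappa - (1 + euler_const) * (z - 1) + L) with
      (kappa - (z - 1) + (z - 1) * (-(1) * euler_const - 0) + L) by ring.
    apply Ccv_plus; [|apply (Ccv_incr_n _ 1), HL].
    apply Ccv_plus; [apply Ccv_const|]; apply Ccv_scal, Ccv_minus.
    + apply Ccv_scal, Ccv_RtoC, euler_const_lim.
    + apply Ccv_RtoC, inv_INR_lim.
Qed.

(** * Polynomials and their roots *)

Fixpoint peval (l : list C) (z : C) : C :=
  match l with
  | nil => 0
  | cons a l' => a + z * peval l' z
  end.

(* [d] bounds the number of coefficients, not the degree. *)
Definition is_poly (d : nat) (f : C -> C) : Prop :=
  exists l, (length l <= d)%nat /\ forall z, f z = peval l z.

Lemma is_poly_ext (d : nat) (f g : C -> C) :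
  (forall z, f z = g z) -> is_poly d f -> is_poly d g.
Proof. intros E [l [Hl H]]; exists l; split; auto; intros z; rewrite <- E; auto. Qed.

Lemma is_poly_le (d e : nat) (f : C -> C) : (d <= e)%nat -> is_poly d f -> is_poly e f.
Proof. intros H [l [Hl E]]; exists l; split; auto; lia. Qed.

Lemma is_poly_const (c : C) : is_poly 1 (fun _ => c).
Proof. exists (cons c nil); split; auto; intros z; simpl; ring. Qed.

Lemma is_poly_scal (d : nat) (c : C) (f : C -> C) : is_poly d f -> is_poly d (fun z => c * f z).
Proof.
  intros [l [Hl H]]; exists (List.map (Cmult c) l); split; [rewrite List.length_map; auto|].
  intros z; rewrite H; clear; induction l as [|a l IH]; simpl; [ring | rewrite <- IH; ring].
Qed.

Lemma is_poly_plus (d : nat) (f g : C -> C) :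
  is_poly d f -> is_poly d g -> is_poly d (fun z => f z + g z).
Proof.
  intros [l [Hl Hf]] [m [Hm Hg]].
  assert (H : exists p, (length p <= d)%nat /\ forall z, peval p z = peval l z + peval m z).
  { clear f g Hf Hg; revert l m Hl Hm; induction d as [|d IH]; intros l m Hl Hm.
    - exists nil; split; auto; intros z.
      destruct l; [|simpl in Hl; lia]; destruct m; [|simpl in Hm; lia]; simpl; ring.
    - destruct l as [|a l]; [exists m; split; auto; intros z; simpl; ring|].
      destruct m as [|b m]; [exists (cons a l); split; auto; intros z; simpl; ring|].
      simpl in Hl, Hm; destruct (IH l m ltac:(lia) ltac:(lia)) as [p [Hp E]].
      exists (cons (a + b) p); split; [simpl; lia|]; intros z; simpl; rewrite E; ring. }
  destruct H as [p [Hp E]]; exists p; split; auto; intros z; rewrite E, Hf, Hg; auto.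
Qed.

Lemma is_poly_mult_linear (d : nat) (a b : C) (f : C -> C) :
  is_poly d f -> is_poly (S d) (fun z => (a + b * z) * f z).
Proof.
  intros H; apply is_poly_ext with (fun z => a * f z + z * (b * f z)); [intros; ring|].
  apply is_poly_plus; [apply is_poly_le with d; auto; apply is_poly_scal, H|].
  destruct (is_poly_scal d b f H) as [l [Hl E]].
  exists (cons (RtoC 0) l); split; [simpl; lia|]; intros z; simpl; rewrite E; ring.
Qed.

Lemma peval_divide (l : list C) (r : C) :
  exists q, length q = pred (length l) /\
    forall z, peval l z = (z - r) * peval q z + peval l r.
Proof.
  induction l as [|a l [q [Hq IH]]]; [exists nil; split; auto; intros; simpl; ring|].
  destruct l as [|b l]; [exists nil; split; auto; intros; simpl; ring|].
  exists (cons (peval (cons b l) r) q); split; [simpl in *; lia|]; intros z.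
  change (a + z * peval (cons b l) z = (z - r) * (peval (cons b l) r + z * peval q z)
    + (a + r * peval (cons b l) r)).
  rewrite (IH z); ring.
Qed.

(** With at most [d] + 1 coefficients, dividing out [d] roots one at a time leaves a constant; as it
    may be 0, no exact degree has to be known. *)
Lemma is_poly_roots (d : nat) (f : C -> C) (r : nat -> C) :
  is_poly (S d) f -> (forall j, (j < d)%nat -> f (r j) = 0) ->
  (forall i j, (i < j < d)%nat -> r i <> r j) ->
  exists c, forall z, f z = c * Cprod (fun j => z - r j) d.
Proof.
  revert f; induction d as [|d IH]; intros f Hf Hr Hd.
  - destruct Hf as [l [Hl H]]; destruct l as [|a [|b l]].
    + exists 0; intros z; rewrite H; simpl; ring.
    + exists a; intros z; rewrite H; simpl; ring.
    + simpl in Hl; lia.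
  - destruct Hf as [l [Hl H]]; destruct (peval_divide l (r d)) as [q [Hq E]].
    assert (E' : forall z, f z = (z - r d) * peval q z).
    { intros z; rewrite H, E, <- H, Hr by lia; ring. }
    destruct (IH (peval q)) as [c Hc].
    + exists q; split; auto; lia.
    + intros j Hj; assert (H0 := Hr j ltac:(lia)); rewrite E' in H0.
      destruct (Cmult_integral _ _ H0) as [H1|H1]; auto.
      exfalso; apply (Hd j d ltac:(lia)), Ceq_minus, H1.
    + intros i j Hij; apply Hd; lia.
    + exists c; intros z; rewrite E', Hc; simpl; ring.
Qed.

(** * Rational truncations of psi_G *)

Fixpoint rising (n : nat) (z : C) : C :=
  match n with
  | O => 1
  | S m => rising m z * (z + INR m)
  end.

(** The derivative of [rising n] by the product rule, so that drising / rising is the sum of the 1 /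
    (z + k). *)
Fixpoint drising (n : nat) (z : C) : C :=
  match n with
  | O => 0
  | S m => drising m z * (z + INR m) + rising m z
  end.

Lemma rising_Cprod (n : nat) (z : C) : rising n z = Cprod (fun k => z + INR k) n.
Proof. induction n as [|n IH]; simpl; auto; rewrite IH; auto. Qed.

Lemma drising_eq (n : nat) (z : C) : (forall k, z + INR k <> 0) ->
  drising n z = rising n z * Csum (fun k => / (z + INR k)) n.
Proof.
  intros H; induction n as [|n IH]; simpl; [ring|]; rewrite IH; field; auto.
Qed.

Definition psi_trunc (n : nat) (z : C) : C :=
  kappa + (z - 1) * (ln (INR n) - 1 - Csum (fun k => / (z + INR k)) (S n)).

(** The product of [psi_trunc n] with the reciprocal of Euler's quotient, stripped of n^z and with
    the poles cleared. Dividing by n! makes the value at 0 equal to 1. *)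
Definition trunc_poly (n : nat) (z : C) : C :=
  ((kappa + (z - 1) * (ln (INR n) - 1)) * rising (S n) z - (z - 1) * drising (S n) z)
  / INR (fact n).

Lemma INR_fact_C (n : nat) : RtoC (INR (fact n)) <> 0.
Proof. intros H; apply RtoC_inj in H; apply (INR_fact_neq_0 n); auto. Qed.

Lemma trunc_poly_psi (n : nat) (z : C) : (forall k, z + INR k <> 0) ->
  trunc_poly n z = psi_trunc n z * rising (S n) z / INR (fact n).
Proof.
  intros H; unfold trunc_poly, psi_trunc; rewrite drising_eq by auto.
  field; apply INR_fact_C.
Qed.

Lemma is_poly_rising (n : nat) : is_poly (S n) (rising n).
Proof.
  induction n as [|n IH]; [apply is_poly_const|].
  apply is_poly_ext with (2 := is_poly_mult_linear _ (INR n) 1 _ IH).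
  intros z; simpl; ring.
Qed.

Lemma is_poly_drising (n : nat) : is_poly (S n) (drising (S n)).
Proof.
  induction n as [|n IH].
  - apply is_poly_ext with (2 := is_poly_const 1); intros z; simpl; ring.
  - apply is_poly_ext with (fun z => (INR (S n) + 1 * z) * drising (S n) z + rising (S n) z).
    + intros z; change (drising (S (S n)) z) with
        (drising (S n) z * (z + INR (S n)) + rising (S n) z); ring.
    + apply is_poly_plus; [apply is_poly_mult_linear, IH | apply is_poly_rising].
Qed.

Lemma is_poly_trunc (n : nat) : is_poly (S (n + 2)) (trunc_poly n).
Proof.
  set (l := ln (INR n) - 1 : C).
  apply is_poly_ext with (fun z => / INR (fact n) *
    (((kappa - l) + l * z) * rising (S n) z + (1 + -(1) * z) * drising (S n) z)).
  { intros z; unfold trunc_poly; fold l; field; apply INR_fact_C. }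
  apply is_poly_scal, is_poly_plus; replace (S (n + 2)) with (S (S (S n))) by lia.
  - apply is_poly_mult_linear, is_poly_rising.
  - apply is_poly_le with (S (S n)); [lia|]; apply is_poly_mult_linear, is_poly_drising.
Qed.

(** These are the first coefficients of z (z + 1) ... (z + n) = n! (z + H_n z^2 + ...) and of its
    derivative. *)
Lemma rising_jet0 (n : nat) :
  rising (S n) 0 = 0 /\ Cdiff (rising (S n)) 0 (INR (fact n)) /\
  drising (S n) 0 = INR (fact n) /\
  Cdiff (drising (S n)) 0 (2 * INR (fact n) * harmonic n).
Proof.
  induction n as [|n [H1 [H2 [H3 H4]]]].
  - simpl; unfold harmonic; simpl; repeat split; try ring.
    + replace (RtoC 1) with (1 + 2 * 0 * 0) by ring.
      apply Cdiff_ext with (2 := Cdiff_quadratic 0 1 0 0); intros z; ring.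
    + replace (2 * 1 * 0) with (0 + 2 * 0 * 0) by ring.
      apply Cdiff_ext with (2 := Cdiff_quadratic 1 0 0 0); intros z; ring.
  - assert (E : RtoC (INR (fact (S n))) = INR (S n) * INR (fact n))
      by (rewrite fact_simpl, mult_INR, RtoC_mult; auto).
    assert (Hl : Cdiff (fun z => z + INR (S n)) 0 1).
    { replace (RtoC 1) with (1 + 2 * 0 * 0) by ring.
      apply Cdiff_ext with (2 := Cdiff_quadratic (INR (S n)) 1 0 0); intros z; ring. }
    assert (HS := INR_S_neq_0 n).
    repeat split.
    + change (rising (S n) 0 * (0 + INR (S n)) = 0); rewrite H1; ring.
    + rewrite E; replace (INR (S n) * INR (fact n)) with
        (INR (fact n) * (0 + INR (S n)) + rising (S n) 0 * 1) by (rewrite H1; ring).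
      apply (Cdiff_mult _ _ _ _ _ H2 Hl).
    + change (drising (S n) 0 * (0 + INR (S n)) + rising (S n) 0 = INR (fact (S n))).
      rewrite H1, H3, E; ring.
    + change (Cdiff (fun z => drising (S n) z * (z + INR (S n)) + rising (S n) z) 0
        (2 * INR (fact (S n)) * harmonic (S n))).
      change (harmonic (S n)) with (harmonic n + / INR (S n))%R.
      rewrite RtoC_plus, RtoC_inv, E by (apply Rgt_not_eq, INR_S_pos).
      replace (2 * (INR (S n) * INR (fact n)) * (harmonic n + / INR (S n))) with
        ((2 * INR (fact n) * harmonic n * (0 + INR (S n)) + drising (S n) 0 * 1) + INR (fact n))
        by (rewrite H3; field; auto).
      apply Cdiff_plus; auto; apply (Cdiff_mult _ _ _ _ _ H4 Hl).
Qed.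

Lemma trunc_poly_0 (n : nat) : trunc_poly n 0 = 1.
Proof.
  destruct (rising_jet0 n) as [H1 [_ [H3 _]]]; unfold trunc_poly; rewrite H1, H3.
  field; apply INR_fact_C.
Qed.

Lemma trunc_poly_derive_0 (n : nat) :
  Cdiff (trunc_poly n) 0 (kappa - ln (INR n) + 2 * harmonic n).
Proof.
  destruct (rising_jet0 n) as [H1 [H2 [H3 H4]]].
  set (f := RtoC (INR (fact n))) in *; assert (Hf : f <> 0) by apply INR_fact_C.
  set (l := RtoC (ln (INR n))).
  assert (L1 : Cdiff (fun z => (kappa + (z - 1) * (l - 1)) / f) 0 ((l - 1) / f)).
  { replace ((l - 1) / f) with ((l - 1) / f + 2 * 0 * 0) by ring.
    apply Cdiff_ext with (2 := Cdiff_quadratic ((kappa - (l - 1)) / f) ((l - 1) / f) 0 0).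
    intros z; field; auto. }
  assert (L2 : Cdiff (fun z => (1 - z) / f) 0 (- / f)).
  { replace (- / f) with (- / f + 2 * 0 * 0) by ring.
    apply Cdiff_ext with (2 := Cdiff_quadratic (/ f) (- / f) 0 0).
    intros z; field; auto. }
  assert (H := Cdiff_plus _ _ _ _ _ (Cdiff_mult _ _ _ _ _ L1 H2) (Cdiff_mult _ _ _ _ _ L2 H4)).
  cbv beta in H; rewrite H1, H3 in H.
  replace (kappa - l + 2 * harmonic n) with
    ((l - 1) / f * 0 + (kappa + (0 - 1) * (l - 1)) / f * f
      + (- / f * f + (1 - 0) / f * (2 * f * harmonic n))) by (field; auto).
  apply Cdiff_ext with (2 := H); intros z; unfold trunc_poly; fold f l; field; auto.
Qed.

Lemma Cprod_1_sub_derive_0 (a : nat -> C) (n : nat) :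
  (forall k, a k <> 0) ->
  Cprod (fun k => 1 - 0 / a k) n = 1 /\
  Cdiff (fun z => Cprod (fun k => 1 - z / a k) n) 0 (- Csum (fun k => / a k) n).
Proof.
  intros Ha; induction n as [|n [IH1 IH2]]; simpl; split; auto.
  - replace (- 0) with (0 + 2 * 0 * 0) by ring.
    apply Cdiff_ext with (2 := Cdiff_quadratic 1 0 0 0); intros z; ring.
  - rewrite IH1; field; auto.
  - assert (L : Cdiff (fun z => 1 - z / a n) 0 (- / a n)).
    { replace (- / a n) with (- / a n + 2 * 0 * 0) by ring.
      apply Cdiff_ext with (2 := Cdiff_quadratic 1 (- / a n) 0 0); intros z; field; auto. }
    assert (H := Cdiff_mult _ _ _ _ _ IH2 L); cbv beta in H; rewrite IH1 in H.
    replace (- (Csum (fun k => / a k) n + / a n)) with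
      (- Csum (fun k => / a k) n * (1 - 0 / a n) + 1 * - / a n) by (field; auto).
    exact H.
Qed.

Lemma Cprod_E1 (a : nat -> C) (z : C) (n : nat) :
  Cprod (fun k => E1 (z / a k)) n
  = Cprod (fun k => 1 - z / a k) n * Cexp (z * Csum (fun k => / a k) n).
Proof.
  unfold E1; rewrite Cprod_mult, Cprod_Cexp; f_equal; f_equal.
  rewrite <- Csum_scal; apply Csum_ext; reflexivity.
Qed.

(** The derivative at 0 is computed twice, from the product over the roots and from the definition
    of [trunc_poly]. Their equality gives the sum of the 1 / r j, which is the correction between
    the factors 1 - z / r j and [E1]. *)
Lemma trunc_poly_factorization (n : nat) (r : nat -> R) (z : C) :
  (forall j, r j <> 0%R) ->
  (forall j, (j < n + 2)%nat -> trunc_poly n (r j) = 0) ->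
  (forall i j, (i < j < n + 2)%nat -> r i <> r j) ->
  trunc_poly n z * Cexp (- (z * ln (INR n))) =
  Cexp ((kappa + 2 * (harmonic n - ln (INR n)))%R * z)
  * Cprod (fun j => E1 (z / r j)) (n + 2).
Proof.
  intros Hr0 Hr Hd.
  assert (Ha : forall j, RtoC (r j) <> 0) by (intros j H; apply RtoC_inj in H; apply (Hr0 j H)).
  destruct (is_poly_roots (n + 2) (trunc_poly n) (fun j => RtoC (r j)) (is_poly_trunc n) Hr)
    as [c Hc].
  { intros i j Hij E; apply RtoC_inj in E; apply (Hd i j Hij E). }
  destruct (Cprod_1_sub_derive_0 (fun j => RtoC (r j)) (n + 2) Ha) as [HP0 HP1].
  assert (E : forall z, trunc_poly n z = Cprod (fun j => 1 - z / r j) (n + 2)).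
  { assert (E1 : forall N z, Cprod (fun j => z - r j) N =
      Cprod (fun j => - RtoC (r j)) N * Cprod (fun j => 1 - z / r j) N).
    { intros N x; rewrite <- Cprod_mult; apply Cprod_ext; intros k _; field; auto. }
    intros x; rewrite Hc, E1.
    assert (H0 := trunc_poly_0 n); rewrite Hc, E1, HP0 in H0.
    rewrite Cmult_assoc; replace (c * _) with (RtoC 1) by (rewrite <- H0; ring); ring. }
  assert (Hs : - Csum (fun j => / RtoC (r j)) (n + 2) = kappa - ln (INR n) + 2 * harmonic n).
  { rewrite <- (Cdiff_C_derive _ _ _ HP1); apply Cdiff_C_derive.
    apply Cdiff_ext with (1 := E), trunc_poly_derive_0. }
  rewrite E, (Cprod_E1 (fun j => RtoC (r j))).
  set (S := Csum _ _) in *; set (p := Cprod _ _).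
  rewrite (Cmult_comm p (Cexp (z * S))), Cmult_assoc, <- Cexp_plus, Cmult_comm.
  do 2 f_equal; rewrite RtoC_plus, RtoC_mult, RtoC_minus.
  replace S with (- (kappa - ln (INR n) + 2 * harmonic n)) by (rewrite <- Hs; ring); ring.
Qed.

Open Scope R_scope.

(** * Numerical bounds *)

(** Positivity is the sign at 1; the upper bound makes 1 - kappa a positive lower bound for slopes
    on the negative axis. *)
Lemma kappa_bounds : 0 < kappa < 1.
Proof.
  assert (HP := PI2_3_2); assert (HP4 := PI_4).
  assert (E3 := exp_le_3); assert (E1 := exp_ineq1 1 ltac:(lra)).
  assert (H1 : 1 < ln (2 * PI)).
  { rewrite <- (ln_exp 1); apply ln_increasing; [apply exp_pos | lra]. }
  assert (H3 : ln (2 * PI) < 3).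
  { rewrite <- (ln_exp 3); apply ln_increasing; [lra|].
    replace 3 with (1 + (1 + 1)) by ring; rewrite 2 exp_plus; nra. }
  unfold kappa; lra.
Qed.

(** It gives 72 pi < 241.2, below the lower estimate 248 for exp (167 / 30) in [kappa_lt_euler]. *)
Lemma PI_upper : PI < 335 / 100.
Proof.
  destruct (PI_ineq 2) as [_ H]; unfold tg_alt, PI_tg in H; simpl in H; lra.
Qed.

(** The inequality exp t >= 1 + t is integrated twice from 0. *)
Lemma exp_taylor4 (x : R) : 0 <= x -> 1 + x + x ^ 2 / 2 + x ^ 3 / 6 <= exp x.
Proof.
  intros Hx.
  assert (D : forall f df : R -> R, (forall t, is_derive f t (df t)) ->
    (forall t, 0 <= t -> 0 <= df t) -> 0 <= f 0 -> forall t, 0 <= t -> 0 <= f t).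
  { intros f df Hd Hp H0 t Ht.
    destruct (MVT_gen f 0 t df) as [c [Hc E]].
    - intros; apply Hd.
    - intros y _; apply derivable_continuous_pt; exists (df y); apply is_derive_Reals, Hd.
    - rewrite Rmin_left in Hc by auto; assert (0 <= df c) by (apply Hp; lra); nra. }
  assert (H1 : forall t, 0 <= t -> 0 <= exp t - (1 + t))
    by (intros t _; assert (T := exp_ineq1_le t); lra).
  assert (H2 : forall t, 0 <= t -> 0 <= exp t - (1 + t + t ^ 2 / 2)).
  { apply (D _ (fun t => exp t - (1 + t))); auto.
    - intros t; auto_derive; auto; field.
    - rewrite exp_0; lra. }
  assert (H3 : 0 <= exp x - (1 + x + x ^ 2 / 2 + x ^ 3 / 6)).
  { apply (D (fun t => exp t - (1 + t + t ^ 2 / 2 + t ^ 3 / 6))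
      (fun t => exp t - (1 + t + t ^ 2 / 2))); auto.
    - intros t; auto_derive; auto; field.
    - rewrite exp_0; lra. }
  lra.
Qed.

(* 2 * (1/2 + H_5) = 167/30, and 167/30 = 8 * (167/240). *)
Lemma kappa_lt_euler : kappa < euler_const.
Proof.
  destruct euler_const_lim as [_ H]; destruct (H 5%nat ltac:(lia)) as [H5 _].
  unfold harmonic in H5; simpl in H5.
  replace (1 + 1 + 1 + 1 + 1 + 1) with 6 in H5 by ring.
  assert (HP := PI_upper); assert (HP0 := PI_RGT_0).
  assert (L : ln (2 * PI) + 2 * ln 6 < 167 / 30).
  { replace (2 * ln 6) with (ln 6 + ln 6) by ring.
    rewrite <- ln_mult, <- ln_mult by lra.
    rewrite <- (ln_exp (167 / 30)); apply ln_increasing; [nra|].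
    assert (T := exp_taylor4 (167 / 240) ltac:(lra)).
    replace (167 / 30) with (167 / 240 + 167 / 240 + (167 / 240 + 167 / 240)
      + (167 / 240 + 167 / 240 + (167 / 240 + 167 / 240))) by field.
    rewrite !exp_plus; set (e := exp (167 / 240)) in *.
    assert (B1 : 1.993 <= e) by lra.
    assert (B2 : 3.972 <= e * e) by nra.
    set (f := e * e) in *; assert (B3 : 15.77 <= f * f) by nra.
    set (g := f * f) in *; assert (B4 : 248 <= g * g) by nra.
    lra. }
  unfold kappa; lra.
Qed.

(** From H_3 = 11/6 and ln 3 >= 1 one gets gamma <= 5/6, and kappa > 0 provides the strict
    inequality. *)
Lemma psi_G_4_pos : 0 < kappa + 5 / 2 - 3 * euler_const.
Proof.
  destruct euler_const_lim as [_ H]; destruct (H 3%nat ltac:(lia)) as [_ H3].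
  unfold harmonic in H3; simpl in H3.
  replace (1 + 1 + 1) with 3 in H3 by ring.
  assert (L : ln (exp 1) <= ln 3) by (apply ln_le; [apply exp_pos | apply exp_le_3]).
  rewrite ln_exp in L.
  assert (K := kappa_bounds); lra.
Qed.

(** * Zeros of the truncations *)

Definition rpsi (n : nat) (x : R) : R :=
  kappa + (x - 1) * (ln (INR n) - 1 - Rsum (fun k => / (x + INR k)) (S n)).

Lemma RtoC_Rsum (u : nat -> R) (n : nat) : RtoC (Rsum u n) = Csum (fun k => RtoC (u k)) n.
Proof. induction n as [|n IH]; simpl; [auto | rewrite RtoC_plus, IH; auto]. Qed.

Lemma psi_trunc_R (n : nat) (x : R) : (forall k, x + INR k <> 0) ->
  psi_trunc n x = rpsi n x.
Proof.
  intros H; unfold psi_trunc, rpsi.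
  rewrite RtoC_plus, RtoC_mult, !RtoC_minus, RtoC_Rsum; do 3 f_equal.
  apply Csum_ext; intros k _; rewrite RtoC_inv, RtoC_plus by auto; auto.
Qed.

Lemma nonpos_integer_R (x : R) : nonpos_integer x <-> exists k, x + INR k = 0.
Proof.
  split; intros [k H]; exists k.
  - rewrite <- RtoC_opp in H; apply RtoC_inj in H; lra.
  - rewrite <- RtoC_opp; f_equal; lra.
Qed.

Lemma rpsi_cv (x : R) : (forall k, x + INR k <> 0) -> is_lim_seq (fun n => rpsi n x) (Re (psi_G x)).
Proof.
  intros H.
  assert (Hz : ~ nonpos_integer x)
    by (rewrite nonpos_integer_R; intros [k Hk]; apply (H k Hk)).
  apply is_lim_seq_ext with (fun n => Re (psi_trunc n x)).
  - intros n; rewrite psi_trunc_R by auto; reflexivity.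
  - apply Ccv_Re, psi_G_limit, Hz.
Qed.

(* For large n, the first n + 2 of these intervals each contain one zero of rpsi n. *)
Definition zero_interval (j : nat) (x : R) : Prop :=
  match j with
  | O => 2 < x < 4
  | S O => 1 < x < 2
  | S (S k) => - INR (S k) < x < - INR k
  end.

Lemma zero_interval_noninteger (j : nat) (x : R) :
  zero_interval j x -> forall k, x + INR k <> 0.
Proof.
  intros H i; assert (Hi := pos_INR i); destruct j as [|[|k]]; simpl in H; try lra.
  change (- INR (S k) < x < - INR k) in H; intros E.
  destruct (le_lt_dec i k) as [Hik|Hik].
  - apply le_INR in Hik; lra.
  - assert (T : (S k <= i)%nat) by lia; apply le_INR in T; lra.
Qed.

Lemma zero_interval_lower (j : nat) (x : R) : zero_interval j x -> - INR j < x < 4.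
Proof.
  intros H; assert (Hj := pos_INR j); destruct j as [|[|k]]; simpl in H; try lra.
  change (- INR (S k) < x < - INR k) in H; rewrite (S_INR (S k)); assert (T := pos_INR k); lra.
Qed.

Lemma Rsum_minus (u v : nat -> R) (n : nat) :
  Rsum u n - Rsum v n = Rsum (fun k => u k - v k) n.
Proof. induction n as [|n IH]; simpl; lra. Qed.

Lemma Rsum_ext (u v : nat -> R) (n : nat) :
  (forall k, (k < n)%nat -> u k = v k) -> Rsum u n = Rsum v n.
Proof.
  induction n as [|n IH]; intros H; simpl; auto.
  rewrite IH, H; auto.
Qed.

Lemma Rsum_ge_two_terms (u : nat -> R) (k n : nat) :
  (forall i, 0 <= u i) -> (S k < n)%nat -> u k + u (S k) <= Rsum u n.
Proof.
  intros Hu H; induction H as [|n H IH]; simpl.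
  - assert (T := Rsum_ge0 u k Hu); lra.
  - specialize (Hu n); lra.
Qed.

(** * Secant slopes of the truncations on both sides of 0 *)

Definition rdiff (n : nat) (x y : R) : R :=
  Rsum (fun k => / ((x + INR k) * (y + INR k))) (S n).

(** Division by x - 1 isolates the partial fractions. Between two neighbouring poles all terms of
    [rdiff] are positive, and only the kappa term works against them. *)
Lemma rpsi_negative_slope (n : nat) (x y : R) :
  (forall k, x + INR k <> 0) -> (forall k, y + INR k <> 0) -> x <> 1 -> y <> 1 ->
  rpsi n x / (x - 1) - rpsi n y / (y - 1)
  = (x - y) * (rdiff n x y - kappa / ((x - 1) * (y - 1))).
Proof.
  intros Hx Hy Hx1 Hy1.
  assert (E : Rsum (fun k => / (y + INR k)) (S n) - Rsum (fun k => / (x + INR k)) (S n)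
    = (x - y) * rdiff n x y).
  { unfold rdiff; rewrite Rsum_minus, <- Rsum_scal; apply Rsum_ext; intros k _.
    specialize (Hx k); specialize (Hy k); field; auto. }
  unfold rpsi; set (A := Rsum (fun k => / (x + INR k)) (S n)) in *.
  set (B := Rsum (fun k => / (y + INR k)) (S n)) in *.
  replace A with (B - (x - y) * rdiff n x y) by lra; field; lra.
Qed.

Lemma zero_interval_same_sign (k : nat) (x y : R) (i : nat) :
  zero_interval (S (S k)) x -> zero_interval (S (S k)) y ->
  0 < (x + INR i) * (y + INR i).
Proof.
  intros Hx Hy; change (- INR (S k) < x < - INR k) in Hx.
  change (- INR (S k) < y < - INR k) in Hy.
  destruct (le_lt_dec i k) as [H|H].
  - apply le_INR in H; nra.
  - assert (T : (S k <= i)%nat) by lia; apply le_INR in T; nra.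
Qed.

(** Of [rdiff] only the terms of the two poles at the ends of the interval are kept. On the negative
    axis (r - 1) (y - 1) >= 1 and |y - 1| >= 1, so the kappa term costs at most kappa and the
    division by y - 1 costs nothing. *)
Lemma rpsi_negative_bound (n k : nat) (r y : R) :
  zero_interval (S (S k)) r -> zero_interval (S (S k)) y -> (S k <= n)%nat ->
  rpsi n r = 0 ->
  Rabs (r - y) * (/ ((r + INR k) * (y + INR k)) + / ((r + INR (S k)) * (y + INR (S k))) - kappa)
  <= Rabs (rpsi n y).
Proof.
  intros Hr Hy Hn H0; assert (K := kappa_bounds).
  assert (Hs := fun i => zero_interval_same_sign k r y i Hr Hy).
  assert (Hr' := zero_interval_noninteger _ _ Hr); assert (Hy' := zero_interval_noninteger _ _ Hy).
  change (- INR (S k) < r < - INR k) in Hr; change (- INR (S k) < y < - INR k) in Hy.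
  assert (Hk := pos_INR k).
  assert (E := rpsi_negative_slope n r y Hr' Hy' ltac:(lra) ltac:(lra)).
  rewrite H0 in E.
  assert (T : / ((r + INR k) * (y + INR k)) + / ((r + INR (S k)) * (y + INR (S k)))
    <= rdiff n r y).
  { apply (Rsum_ge_two_terms (fun i => / ((r + INR i) * (y + INR i)))); [|lia].
    intros i; left; apply Rinv_0_lt_compat, Hs. }
  assert (Q : kappa / ((r - 1) * (y - 1)) <= kappa).
  { apply Rmult_le_reg_r with ((r - 1) * (y - 1)); [nra|].
    replace (kappa / ((r - 1) * (y - 1)) * ((r - 1) * (y - 1))) with (kappa * 1) by (field; lra).
    apply Rmult_le_compat_l; [lra | nra]. }
  apply Rle_trans with (Rabs (r - y) * Rabs (rdiff n r y - kappa / ((r - 1) * (y - 1)))).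
  - apply Rmult_le_compat_l; [apply Rabs_pos|]; apply Rle_trans with (2 := Rle_abs _); lra.
  - rewrite <- Rabs_mult, <- E.
    replace (0 / (r - 1) - rpsi n y / (y - 1)) with (- (rpsi n y * / (y - 1))) by (field; lra).
    rewrite Rabs_Ropp, Rabs_mult.
    apply Rle_trans with (Rabs (rpsi n y) * 1); [|lra].
    apply Rmult_le_compat_l; [apply Rabs_pos|].
    rewrite Rabs_inv, <- Rinv_1; apply Rinv_le_contravar; [lra|].
    rewrite Rabs_left; lra.
Qed.

(** On the positive axis (x - 1) / (x + k) = 1 - (k + 1) / (x + k) gives the secant slope of [rpsi]
    itself, without dividing by x - 1, which vanishes at 1. *)
Definition rsecant (n : nat) (x y : R) : R :=
  ln (INR n) - 1 - Rsum (fun k => INR (S k) / ((x + INR k) * (y + INR k))) (S n).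

Lemma rpsi_secant (n : nat) (x y : R) : 0 < x -> 0 < y ->
  rpsi n x - rpsi n y = (x - y) * rsecant n x y.
Proof.
  intros Hx Hy.
  assert (E : (x - 1) * Rsum (fun k => / (x + INR k)) (S n)
    - (y - 1) * Rsum (fun k => / (y + INR k)) (S n)
    = (x - y) * Rsum (fun k => INR (S k) / ((x + INR k) * (y + INR k))) (S n)).
  { rewrite <- !Rsum_scal, Rsum_minus; apply Rsum_ext; intros k _.
    assert (T := pos_INR k); rewrite S_INR; field; lra. }
  unfold rpsi, rsecant; lra.
Qed.

(** Secant slopes increase: [rpsi n] is convex on the positive half-line. *)
Lemma rsecant_incr (n : nat) (x x' y : R) : 0 < x <= x' -> 0 < y ->
  rsecant n x y <= rsecant n x' y.
Proof.
  intros Hx Hy; unfold rsecant; apply Rplus_le_compat_l, Ropp_le_contravar, Rsum_le.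
  intros k _; assert (T := pos_INR k); apply Rmult_le_compat_l; [apply pos_INR|].
  apply Rinv_le_contravar; [nra|]; nra.
Qed.

(** * Values of the truncations at positive integers *)

Lemma harmonic_shift (a n : nat) :
  Rsum (fun k => / (INR a + INR (S k))) n = harmonic (a + n) - harmonic a.
Proof.
  induction n as [|n IH]; [rewrite Nat.add_0_r; simpl; ring|].
  rewrite Nat.add_succ_r; cbn [Rsum]; rewrite IH.
  change (harmonic (S (a + n))) with (harmonic (a + n) + / INR (S (a + n))).
  rewrite <- plus_INR, Nat.add_succ_r; ring.
Qed.

(** The limit reflects psi(a + 1) = H_a - gamma; here it comes from telescoping harmonic sums. *)
Lemma rpsi_integer_cv (a : nat) :
  is_lim_seq (fun n => rpsi n (INR (S a)))
    (kappa + INR a * (harmonic a - 1 - euler_const)).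
Proof.
  assert (Hr : is_lim_seq (fun n => harmonic (a + n) - harmonic n) 0).
  { induction a as [|b IH].
    - apply is_lim_seq_ext with (fun _ => 0); [intros n; simpl; ring | apply is_lim_seq_const].
    - apply is_lim_seq_ext with (fun n => (harmonic (b + n) - harmonic n) + / INR (S (b + n))).
      + intros n; change (harmonic (S b + n)) with (harmonic (b + n) + / INR (S (b + n))); ring.
      + apply is_lim_seq_plus0; auto.
        apply (is_lim_seq_ext (fun n => / INR (S (n + b)))).
        * intros n; rewrite Nat.add_comm; auto.
        * apply (is_lim_seq_incr_n (fun n => / INR (S n)) b), inv_INR_lim. }
  apply is_lim_seq_ext with (fun n => kappa + INR a *
    (harmonic a - 1 - ((harmonic n - ln (INR n)) + ((harmonic (a + n) - harmonic n)
      + / INR (S (a + n)))))).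
  - intros n; unfold rpsi.
    replace (Rsum (fun k => / (INR (S a) + INR k)) (S n)) with (harmonic (a + S n) - harmonic a).
    + rewrite Nat.add_succ_r.
      change (harmonic (S (a + n))) with (harmonic (a + n) + / INR (S (a + n))).
      rewrite (S_INR a); ring.
    + rewrite <- harmonic_shift; apply Rsum_ext; intros k _; rewrite !S_INR; f_equal; ring.
  - apply is_lim_seq_plus'; [apply is_lim_seq_const|].
    apply (is_lim_seq_scal_l _ (INR a) (harmonic a - 1 - euler_const)).
    apply is_lim_seq_minus'; [apply is_lim_seq_const|].
    replace euler_const with (euler_const + (0 + 0)) by ring.
    apply is_lim_seq_plus'; [apply euler_const_lim|].
    apply is_lim_seq_plus'; [apply Hr|].
    apply (is_lim_seq_ext (fun n => / INR (S (n + a)))).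
    + intros n; rewrite Nat.add_comm; auto.
    + apply (is_lim_seq_incr_n (fun n => / INR (S n)) a), inv_INR_lim.
Qed.

Lemma rpsi_1 (n : nat) : rpsi n 1 = kappa.
Proof. unfold rpsi; ring. Qed.

Lemma rpsi_2_neg : exists d, 0 < d /\ eventually (fun n => rpsi n 2 <= - d).
Proof.
  assert (H := rpsi_integer_cv 1); change (INR 2) with (1 + 1) in H.
  replace (1 + 1) with 2 in H by ring; unfold harmonic in H; simpl in H.
  assert (K := kappa_lt_euler).
  exists ((euler_const - kappa) / 2); split; [lra|].
  apply is_lim_seq_spec in H.
  destruct (H (mkposreal ((euler_const - kappa) / 2) ltac:(lra))) as [N HN]; simpl in HN.
  exists N; intros n Hn; specialize (HN n Hn); apply Rabs_lt_between in HN; lra.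
Qed.

Lemma rpsi_4_pos : eventually (fun n => 0 < rpsi n 4).
Proof.
  assert (H := rpsi_integer_cv 3); unfold harmonic in H; simpl in H.
  replace (1 + 1 + 1 + 1) with 4 in H by ring.
  assert (K := psi_G_4_pos).
  assert (P : 0 < kappa + (1 + 1 + 1) * (0 + / 1 + / (1 + 1) + / (1 + 1 + 1) - 1 - euler_const))
    by lra.
  apply is_lim_seq_spec in H; destruct (H (mkposreal _ P)) as [N HN]; simpl in HN.
  exists N; intros n Hn; specialize (HN n Hn); apply Rabs_lt_between in HN; lra.
Qed.

(** By convexity, a value at most - d at 2 forces slopes at least d / 2 on (2, 4), because r - 2 <
    2, and slopes at most - d on (1, 2). Between negative integers a neighbouring pole contributes
    at least 1 to the slope, against kappa < 1. *)
Lemma zero_stability (j : nat) : exists d, 0 < d /\ eventually (fun n =>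
  forall r y, zero_interval j r -> zero_interval j y -> rpsi n r = 0 ->
  d * Rabs (r - y) <= Rabs (rpsi n y)).
Proof.
  destruct rpsi_2_neg as [d [Hd [N HN]]].
  destruct j as [|[|k]].
  - exists (d / 2); split; [lra|]; exists N; intros n Hn r y Hr Hy H0; simpl in Hr, Hy.
    specialize (HN n Hn).
    assert (E := rpsi_secant n y r ltac:(lra) ltac:(lra)); rewrite H0, Rminus_0_r in E.
    assert (E2 := rpsi_secant n 2 r ltac:(lra) ltac:(lra)); rewrite H0, Rminus_0_r in E2.
    assert (T := rsecant_incr n 2 y r ltac:(lra) ltac:(lra)).
    assert (T2 : d / 2 <= rsecant n 2 r) by nra.
    rewrite E, Rabs_mult, (Rabs_minus_sym y r), Rmult_comm.
    apply Rmult_le_compat_l; [apply Rabs_pos|]; rewrite Rabs_pos_eq; lra.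
  - exists d; split; [lra|]; exists N; intros n Hn r y Hr Hy H0; simpl in Hr, Hy.
    specialize (HN n Hn).
    assert (E := rpsi_secant n y r ltac:(lra) ltac:(lra)); rewrite H0, Rminus_0_r in E.
    assert (E2 := rpsi_secant n 2 r ltac:(lra) ltac:(lra)); rewrite H0, Rminus_0_r in E2.
    assert (T := rsecant_incr n y 2 r ltac:(lra) ltac:(lra)).
    assert (T2 : rsecant n 2 r <= - d) by nra.
    rewrite E, Rabs_mult, (Rabs_minus_sym y r), Rmult_comm.
    apply Rmult_le_compat_l; [apply Rabs_pos|]; rewrite Rabs_left; lra.
  - assert (K := kappa_bounds).
    exists (1 - kappa); split; [lra|]; exists (S k); intros n Hn r y Hr Hy H0.
    apply Rle_trans with (2 := rpsi_negative_bound n k r y Hr Hy Hn H0).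
    rewrite Rmult_comm; apply Rmult_le_compat_l; [apply Rabs_pos|].
    assert (S1 := zero_interval_same_sign k r y k Hr Hy).
    assert (S2 := zero_interval_same_sign k r y (S k) Hr Hy).
    change (- INR (S k) < r < - INR k) in Hr; change (- INR (S k) < y < - INR k) in Hy.
    rewrite S_INR in *.
    assert (1 <= / ((r + INR k) * (y + INR k))).
    { rewrite <- Rinv_1; apply Rinv_le_contravar; auto; nra. }
    assert (0 < / ((r + (INR k + 1)) * (y + (INR k + 1)))) by (apply Rinv_0_lt_compat; auto).
    lra.
Qed.

(** Convexity places the zero to the left of the point where the chord over [1, 2] crosses the axis;
    that chord descends from kappa to a value at most - d. In the limit this separates the zero from
    2, where the next one may start. *)
Lemma zero_away_from_2 : exists d, 0 < d /\ eventually (fun n =>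
  forall r, zero_interval 1 r -> rpsi n r = 0 -> d * (r - 1) <= kappa * (2 - r)).
Proof.
  destruct rpsi_2_neg as [d [Hd [N HN]]].
  exists d; split; auto; exists N; intros n Hn r Hr H0; simpl in Hr; specialize (HN n Hn).
  assert (E2 := rpsi_secant n 2 r ltac:(lra) ltac:(lra)); rewrite H0, Rminus_0_r in E2.
  assert (E1 := rpsi_secant n 1 r ltac:(lra) ltac:(lra)); rewrite H0, Rminus_0_r, rpsi_1 in E1.
  assert (T := rsecant_incr n 1 2 r ltac:(lra) ltac:(lra)).
  assert (P : (2 - r) * (r - 1) * rsecant n 1 r <= (2 - r) * (r - 1) * rsecant n 2 r)
    by (apply Rmult_le_compat_l; nra).
  rewrite E1; apply Rle_trans with (- rpsi n 2 * (r - 1)); [nra|]; rewrite E2; lra.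
Qed.

(** At the midpoint [y] the truncations converge and so stay bounded, whereas by
    [rpsi_negative_bound] a zero close to a pole would force a large value there. *)
Lemma zero_away_from_integers (k : nat) : exists c, 0 < c /\ eventually (fun n =>
  forall r, zero_interval (S (S k)) r -> rpsi n r = 0 ->
  - INR (S k) + c <= r <= - INR k - c).
Proof.
  set (y := - INR k - / 2).
  assert (Hy : zero_interval (S (S k)) y).
  { change (- INR (S k) < y < - INR k); rewrite S_INR; unfold y; lra. }
  assert (HL := rpsi_cv y (zero_interval_noninteger _ _ Hy)).
  set (L := Re (psi_G y)) in HL; apply is_lim_seq_spec in HL.
  destruct (HL (mkposreal 1 Rlt_0_1)) as [N HN]; simpl in HN.
  set (H := Rabs L + 1); assert (HH : 0 <= H) by (unfold H; assert (T := Rabs_pos L); lra).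
  (* If a zero is at distance a < 1/4 from an end, it is at distance at least 1/4 from [y], and the
     pole at that end yields 1 / (4 a) <= H; hence a cannot be below [c]. *)
  set (c := / (4 * (H + 1))).
  assert (Hc : 0 < c <= 1 / 4).
  { split; [apply Rinv_0_lt_compat; lra|].
    unfold c; replace (1 / 4) with (/ 4) by field; apply Rinv_le_contravar; lra. }
  assert (Hc1 : c * (4 * (H + 1)) = 1) by (unfold c; field; lra).
  exists c; split; [lra|]; exists (S k + N)%nat; intros n Hn r Hr H0.
  assert (B := rpsi_negative_bound n k r y Hr Hy ltac:(lia) H0).
  assert (HB : Rabs (rpsi n y) <= H).
  { specialize (HN n ltac:(lia)); assert (T := Rabs_triang (rpsi n y - L) L).
    replace (rpsi n y - L + L) with (rpsi n y) in T by ring; unfold H; lra. }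
  assert (K := kappa_bounds).
  change (- INR (S k) < r < - INR k) in Hr; rewrite S_INR in *.
  set (a := - INR k - r); assert (Ha : 0 < a < 1) by (unfold a; lra).
  replace (r + INR k) with (- a) in B by (unfold a; ring).
  replace (r + (INR k + 1)) with (1 - a) in B by (unfold a; ring).
  replace (r - y) with (1 / 2 - a) in B by (unfold a, y; field).
  replace (y + INR k) with (- / 2) in B by (unfold y; ring).
  replace (y + (INR k + 1)) with (1 / 2) in B by (unfold y; field).
  replace (/ (- a * - / 2)) with (2 * / a) in B by (field; lra).
  replace (/ ((1 - a) * (1 / 2))) with (2 * / (1 - a)) in B by (field; lra).
  assert (P1 : 1 <= / a) by (rewrite <- Rinv_1; apply Rinv_le_contravar; lra).
  assert (P2 : 1 <= / (1 - a)) by (rewrite <- Rinv_1; apply Rinv_le_contravar; lra).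
  assert (Q1 : a * / a = 1) by (apply Rinv_r; lra).
  assert (Q2 : (1 - a) * / (1 - a) = 1) by (apply Rinv_r; lra).
  set (p := / a) in *; set (q := / (1 - a)) in *.
  enough (c <= a <= 1 - c) by (unfold a in *; lra); split; apply Rnot_lt_le; intros Hac.
  - rewrite Rabs_pos_eq in B by lra.
    assert (1 / 4 * p <= H) by nra; nra.
  - rewrite Rabs_left in B by lra.
    assert (1 / 4 * q <= H) by nra; nra.
Qed.

(** * Convergence of the zeros as n grows *)

Lemma rpsi_step (n : nat) (x X : R) : (0 < n)%nat -> Rabs x <= X -> 2 * X <= INR n ->
  Rabs (rpsi (S n) x - rpsi n x) <= (X + 1) * (1 + 2 * X) * (/ INR n - / INR (S n)).
Proof.
  intros Hn Hx HX; assert (HX0 : 0 <= X) by (apply Rle_trans with (2 := Hx); apply Rabs_pos).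
  assert (Hn0 : 0 < INR n) by (apply lt_0_INR; auto); assert (L := ln_succ_bounds n Hn).
  replace (rpsi (S n) x - rpsi n x) with
    ((x - 1) * (ln (INR (S n)) - ln (INR n) - / (x + INR (S n))))
    by (unfold rpsi; cbn [Rsum]; ring).
  rewrite S_INR in *; set (N := INR n) in *.
  apply Rabs_le_between in Hx.
  rewrite Rabs_mult, Rmult_assoc; apply Rmult_le_compat; try apply Rabs_pos.
  - apply Rabs_le_between; lra.
  - replace (ln (N + 1) - ln N - / (x + (N + 1))) with
      ((ln (N + 1) - ln N - / (N + 1)) + x * (/ (N + 1) * / (x + (N + 1)))) by (field; lra).
    apply Rle_trans with (1 := Rabs_triang _ _); rewrite Rabs_pos_eq by lra.
    assert (E : / N - / (N + 1) = / N * / (N + 1)) by (field; lra).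
    assert (G : / (x + (N + 1)) <= 2 * / N).
    { replace (2 * / N) with (/ (N / 2)) by (field; lra); apply Rinv_le_contravar; lra. }
    assert (G0 : 0 < / (x + (N + 1))) by (apply Rinv_0_lt_compat; lra).
    assert (G1 : 0 < / (N + 1)) by (apply Rinv_0_lt_compat; lra).
    rewrite Rabs_mult, (Rabs_pos_eq (_ * _)) by nra.
    assert (Rabs x * (/ (N + 1) * / (x + (N + 1))) <= X * (/ (N + 1) * (2 * / N))).
    { apply Rmult_le_compat; [apply Rabs_pos | nra | apply Rabs_le_between; auto|].
      apply Rmult_le_compat_l; lra. }
    rewrite E in *; lra.
Qed.

(** The bounds of [rpsi_step] telescope to A / m. The term that changes with n has its pole far from
    the bounded interval, so the nearby poles cancel in the difference and cause no trouble. *)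
Lemma rpsi_uniform_Cauchy (j : nat) (eps : posreal) : exists N, forall m n x,
  (N <= m <= n)%nat -> zero_interval j x -> Rabs (rpsi n x - rpsi m x) < eps.
Proof.
  set (X := INR j + 4); assert (Hj := pos_INR j); assert (He := cond_pos eps).
  set (A := (X + 1) * (1 + 2 * X)).
  assert (HX : 4 <= X) by (unfold X; lra).
  assert (HA : 0 < A) by (unfold A; nra).
  destruct (INR_unbounded (2 * X)) as [N1 HN1]; destruct (INR_unbounded (A / eps)) as [N2 HN2].
  exists (S (N1 + N2)); intros m n x [Hm Hmn] Hx.
  assert (Hx' : Rabs x <= X)
    by (apply zero_interval_lower in Hx; apply Rabs_le_between; unfold X; lra).
  assert (Hm0 : 0 < INR m) by (apply lt_0_INR; lia).
  assert (H : Rabs (rpsi n x - rpsi m x) <= A * (/ INR m - / INR n)).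
  { induction Hmn as [|n Hmn IH].
    - unfold Rminus; rewrite !Rplus_opp_r, Rabs_R0; lra.
    - assert (T := rpsi_step n x X ltac:(lia) Hx').
      assert (INR (N1 + N2) <= INR n) by (apply le_INR; lia); rewrite plus_INR in *.
      assert (T2 := pos_INR N2); specialize (T ltac:(lra)); fold A in T.
      replace (rpsi (S n) x - rpsi m x)
        with ((rpsi (S n) x - rpsi n x) + (rpsi n x - rpsi m x)) by ring.
      apply Rle_trans with (1 := Rabs_triang _ _); lra. }
  apply Rle_lt_trans with (1 := H).
  assert (Hn0 : 0 < / INR n) by (apply Rinv_0_lt_compat, lt_0_INR; lia).
  assert (INR (N1 + N2) <= INR m) by (apply le_INR; lia); rewrite plus_INR in *.
  assert (T1 := pos_INR N1).
  apply Rlt_le_trans with (A * / INR m); [nra|].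
  apply Rmult_le_reg_r with (INR m); auto; rewrite Rmult_assoc, Rinv_l, Rmult_1_r by lra.
  apply Rle_trans with (A / eps * eps); [right; field; lra|].
  rewrite (Rmult_comm eps); apply Rmult_le_compat_r; lra.
Qed.

Lemma zeros_converge (j N : nat) (r : nat -> R) :
  (forall n, zero_interval j (r n)) -> (forall n, (N <= n)%nat -> rpsi n (r n) = 0) ->
  exists l, is_lim_seq r (Finite l).
Proof.
  intros Hr H0; destruct (zero_stability j) as [d [Hd [N1 HN1]]].
  assert (Cv : ex_finite_lim_seq r); [|destruct Cv as [l Hl]; exists l; auto].
  apply ex_lim_seq_cauchy_corr; intros eps.
  assert (He : 0 < d * eps) by (apply Rmult_lt_0_compat; [auto | apply cond_pos]).
  destruct (rpsi_uniform_Cauchy j (mkposreal _ He)) as [N2 HN2]; simpl in HN2.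
  assert (Main : forall m n, (N + N1 + N2 <= m <= n)%nat -> Rabs (r n - r m) < eps).
  { intros m n Hmn.
    (* The zero of the m-th truncation is almost a zero of the n-th; stability turns this small
       value into a small distance. *)
    assert (S := HN1 n ltac:(lia) (r n) (r m) (Hr n) (Hr m) (H0 n ltac:(lia))).
    assert (T := HN2 m n (r m) ltac:(lia) (Hr m)).
    rewrite (H0 m), Rminus_0_r in T by lia.
    apply Rmult_lt_reg_l with d; auto; lra. }
  exists (N + N1 + N2)%nat; intros n m Hn Hm; destruct (le_lt_dec m n) as [H|H].
  - apply Main; lia.
  - rewrite Rabs_minus_sym; apply Main; lia.
Qed.

(** * Existence of the zeros *)

Fixpoint rrising (n : nat) (x : R) : R :=
  match n with
  | O => 1
  | S m => rrising m x * (x + INR m)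
  end.

Fixpoint rdrising (n : nat) (x : R) : R :=
  match n with
  | O => 0
  | S m => rdrising m x * (x + INR m) + rrising m x
  end.

Lemma is_derive_rrising (n : nat) (x : R) : is_derive (rrising n) x (rdrising n x).
Proof.
  induction n as [|n IH]; simpl; [auto_derive; auto|].
  replace (rdrising n x * (x + INR n) + rrising n x) with
    (rdrising n x * (x + INR n) + rrising n x * 1) by ring.
  apply (is_derive_mult (K := R_AbsRing) (rrising n) (fun x => x + INR n)); auto.
  - auto_derive; auto; ring.
  - intros; apply Rmult_comm.
Qed.

Lemma continuity_rdrising (n : nat) : continuity (rdrising n).
Proof.
  assert (H : forall m, continuity (rrising m)).
  { intros m x; apply derivable_continuous_pt; exists (rdrising m x).
    apply is_derive_Reals, is_derive_rrising. }
  induction n as [|n IH].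
  - apply continuity_const; intros x y; reflexivity.
  - apply (continuity_plus (fun x => rdrising n x * (x + INR n)) (rrising n)); auto.
    apply (continuity_mult (rdrising n) (fun x => x + INR n)); auto.
    intros x; apply derivable_continuous_pt; exists 1; apply is_derive_Reals.
    auto_derive; auto; ring.
Qed.

Lemma rdrising_eq (n : nat) (x : R) : (forall k, x + INR k <> 0) ->
  rdrising n x = rrising n x * Rsum (fun k => / (x + INR k)) n.
Proof.
  intros H; induction n as [|n IH]; simpl; [ring|]; rewrite IH; field; auto.
Qed.

Lemma rrising_neq_0 (n : nat) (x : R) : (forall k, x + INR k <> 0) -> rrising n x <> 0.
Proof. intros H; induction n; simpl; [lra | apply Rmult_integral_contrapositive; auto]. Qed.

Lemma rrising_pos (n : nat) (x : R) : 0 < x -> 0 < rrising n x.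
Proof.
  intros H; induction n; simpl; [lra|]; apply Rmult_lt_0_compat; auto.
  assert (T := pos_INR n); lra.
Qed.

Lemma rrising_root (k n : nat) : (k < n)%nat -> rrising n (- INR k) = 0.
Proof.
  intros H; induction H as [|n H IH]; simpl; [ring | rewrite IH; ring].
Qed.

(* Rolle's theorem for exp x * (1 - x)^(-kappa) * n^(-x) * rrising (S n) x, whose derivative
   is a nonvanishing multiple of the n-th truncation. *)
Lemma negative_zero_exists (n k : nat) : (k < n)%nat ->
  exists r, zero_interval (S (S k)) r /\ rpsi n r = 0.
Proof.
  intros Hn; set (l := ln (INR n)).
  set (e := fun x => exp ((1 - l) * x - kappa * ln (1 - x))).
  set (de := fun x => e x * (1 - l + kappa / (1 - x))).
  assert (Hk := pos_INR k); assert (HSk := S_INR k).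
  destruct (MVT_cor2 (fun x => e x * rrising (S n) x)
    (fun x => de x * rrising (S n) x + e x * rdrising (S n) x) (- INR (S k)) (- INR k))
    as [r [E Hr]]; [lra| |].
  - intros x Hx; apply is_derive_Reals.
    apply (is_derive_mult (K := R_AbsRing) e (rrising (S n)));
      [|apply is_derive_rrising | intros; apply Rmult_comm].
    unfold de, e; auto_derive; [lra|]; unfold Rminus; field; lra.
  - exists r; split; [exact Hr|].
    rewrite !rrising_root, !Rmult_0_r, Rminus_0_r in E by lia.
    assert (Hr' := zero_interval_noninteger (S (S k)) r Hr).
    symmetry in E; apply Rmult_integral in E; destruct E as [E|E]; [|lra].
    rewrite rdrising_eq in E by auto; unfold de in E.
    assert (P : e r * rrising (S n) r <> 0).
    { apply Rmult_integral_contrapositive; split; [apply Rgt_not_eq, exp_pos|].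
      apply rrising_neq_0; auto. }
    set (T := Rsum _ _) in E.
    assert (E' : e r * rrising (S n) r * (1 - l + kappa / (1 - r) + T) = 0) by lra.
    apply Rmult_integral in E'; destruct E' as [E'|E']; [destruct (P E')|].
    unfold rpsi; fold l; fold T.
    replace (l - 1 - T) with (kappa / (1 - r)) by lra; field; lra.
Qed.

(** Being continuous on the whole line, unlike [rpsi n], it can be given to the intermediate value
    theorem; for x > 0 the two have the same sign. *)
Definition rtrunc_poly (n : nat) (x : R) : R :=
  (kappa + (x - 1) * (ln (INR n) - 1)) * rrising (S n) x - (x - 1) * rdrising (S n) x.

Lemma rtrunc_poly_eq (n : nat) (x : R) : 0 < x -> rtrunc_poly n x = rpsi n x * rrising (S n) x.
Proof.
  intros H; unfold rtrunc_poly, rpsi; rewrite rdrising_eq; [ring|].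
  intros k; assert (T := pos_INR k); lra.
Qed.

Lemma continuity_rtrunc_poly (n : nat) : continuity (rtrunc_poly n).
Proof.
  assert (L : forall a b, continuity (fun x => a + (x - 1) * b)).
  { intros a b x; apply derivable_continuous_pt; exists b; apply is_derive_Reals.
    auto_derive; auto; ring. }
  apply (continuity_minus (fun x => (kappa + (x - 1) * (ln (INR n) - 1)) * rrising (S n) x)
    (fun x => (x - 1) * rdrising (S n) x)).
  - apply (continuity_mult (fun x => kappa + (x - 1) * (ln (INR n) - 1)) (rrising (S n))); auto.
    intros x; apply derivable_continuous_pt; exists (rdrising (S n) x).
    apply is_derive_Reals, is_derive_rrising.
  - apply (continuity_mult (fun x => x - 1) (rdrising (S n))); [|apply continuity_rdrising].
    intros x; apply derivable_continuous_pt; exists 1; apply is_derive_Reals.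
    auto_derive; auto; ring.
Qed.

Lemma positive_zero_between (n : nat) (a b : R) : 0 < a < b ->
  rpsi n a * rpsi n b < 0 -> exists r, a < r < b /\ rpsi n r = 0.
Proof.
  intros Hab Hs.
  assert (Pa := rrising_pos (S n) a ltac:(lra)); assert (Pb := rrising_pos (S n) b ltac:(lra)).
  assert (Ea := rtrunc_poly_eq n a ltac:(lra)); assert (Eb := rtrunc_poly_eq n b ltac:(lra)).
  destruct (IVT_gen (rtrunc_poly n) a b 0 (continuity_rtrunc_poly n)) as [r [Hr E]].
  - rewrite Ea, Eb; destruct (Rlt_le_dec (rpsi n a) 0) as [H|H].
    + rewrite Rmin_left, Rmax_right by nra; nra.
    + rewrite Rmin_right, Rmax_left by nra; nra.
  - rewrite Rmin_left, Rmax_right in Hr by lra.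
    rewrite rtrunc_poly_eq in E by lra.
    assert (Er : rpsi n r = 0).
    { apply Rmult_integral in E; destruct E as [E|E]; auto.
      assert (T := rrising_pos (S n) r ltac:(lra)); lra. }
    exists r; split; auto; split.
    + destruct (proj1 Hr) as [H|H]; auto; subst r; rewrite Er in Hs; lra.
    + destruct (proj2 Hr) as [H|H]; auto; subst r; rewrite Er in Hs; lra.
Qed.

Lemma zeros_exist : exists N, forall n j, (N <= n)%nat -> (j < n + 2)%nat ->
  exists r, zero_interval j r /\ rpsi n r = 0.
Proof.
  destruct rpsi_2_neg as [d [Hd [N1 HN1]]]; destruct rpsi_4_pos as [N2 HN2].
  exists (N1 + N2)%nat; intros n j Hn Hj.
  specialize (HN1 n ltac:(lia)); specialize (HN2 n ltac:(lia)); assert (K := kappa_bounds).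
  destruct j as [|[|k]]; [| |apply negative_zero_exists; lia];
    (apply positive_zero_between; [lra|]); rewrite ?rpsi_1; nra.
Qed.

Open Scope C_scope.

(** * The limit *)

Lemma zero_interval_inhabited (j : nat) : exists x, zero_interval j x.
Proof.
  destruct j as [|[|k]]; [exists 3%R | exists (3 / 2)%R | exists (- INR k - 1 / 2)%R];
    [simpl; lra | simpl; lra |].
  change (- INR (S k) < - INR k - 1 / 2 < - INR k)%R; rewrite S_INR; lra.
Qed.

(** Entries outside n >= N, j < n + 2 are arbitrary points of their interval, so that every row
    decreases strictly and avoids 0 without side conditions. *)
Definition is_zero_array (N : nat) (r : nat -> nat -> R) : Prop :=
  (forall n j, zero_interval j (r n j)) /\
  (forall n j, (N <= n)%nat -> (j < n + 2)%nat -> rpsi n (r n j) = 0%R).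

Lemma zero_array_exists : exists N r, is_zero_array N r.
Proof.
  destruct zeros_exist as [N HN].
  set (P := fun n j x => zero_interval j x /\
    ((N <= n)%nat -> (j < n + 2)%nat -> rpsi n x = 0%R)).
  assert (HP : forall n j, exists x, P n j x).
  { intros n j; destruct (classic ((N <= n)%nat /\ (j < n + 2)%nat)) as [[H1 H2]|H].
    - destruct (HN n j H1 H2) as [x [Hx Hx0]]; exists x; split; auto.
    - destruct (zero_interval_inhabited j) as [x Hx]; exists x; split; auto.
      intros H1 H2; destruct (H (conj H1 H2)). }
  exists N, (fun n j => proj1_sig (constructive_indefinite_description _ (HP n j))).
  split; intros n j; destruct (constructive_indefinite_description _ (HP n j)) as [x [H1 H2]];
    auto.
Qed.

(** Limits may reach the ends of the open intervals. The strict inequalities recovered here make the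
    limits strictly decreasing and keep them off the non-positive integers. *)
Definition zero_location (j : nat) (x : R) : Prop :=
  match j with
  | O => 2 <= x
  | S O => 1 <= x < 2
  | S (S k) => - INR (S k) < x < - INR k
  end.

Lemma limit_zeros (N : nat) (r : nat -> nat -> R) : is_zero_array N r ->
  exists rho : nat -> R, forall j,
    is_lim_seq (fun n => r n j) (rho j) /\ zero_location j (rho j).
Proof.
  intros [Hr H0].
  assert (Hlim : forall j, is_lim_seq (fun n => r n j) (real (Lim_seq (fun n => r n j)))).
  { intros j; destruct (zeros_converge j (N + j) (fun n => r n j)) as [l Hl]; auto.
    - intros n Hn; apply H0; lia.
    - rewrite (is_lim_seq_unique _ _ Hl); exact Hl. }
  exists (fun j => real (Lim_seq (fun n => r n j))); intros j; split; auto.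
  specialize (Hlim j); set (l := real _) in *; destruct j as [|[|k]].
  - apply (is_lim_seq_le (fun _ => 2%R) (fun n => r n 0%nat) 2%R l); auto.
    + intros n; assert (T := Hr n 0%nat); simpl in T; lra.
    + apply is_lim_seq_const.
  - assert (H1 : (1 <= l)%R).
    { apply (is_lim_seq_le (fun _ => 1%R) (fun n => r n 1%nat) 1%R l); auto.
      + intros n; assert (T := Hr n 1%nat); simpl in T; lra.
      + apply is_lim_seq_const. }
    split; auto.
    destruct zero_away_from_2 as [d [Hd [N1 HN1]]]; assert (K := kappa_bounds).
    assert (H2 : (d * (l - 1) <= kappa * (2 - l))%R); [|nra].
    apply (is_lim_seq_le_loc (fun n => d * (r n 1%nat - 1))%R (fun n => kappa * (2 - r n 1%nat))%R
      (d * (l - 1))%R (kappa * (2 - l))%R).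
    + exists (N + N1)%nat; intros n Hn; apply (HN1 n); [lia | apply Hr | apply H0; lia].
    + apply (is_lim_seq_scal_l _ d (l - 1)%R), is_lim_seq_minus'; auto; apply is_lim_seq_const.
    + apply (is_lim_seq_scal_l _ kappa (2 - l)%R), is_lim_seq_minus'; auto;
        apply is_lim_seq_const.
  - destruct (zero_away_from_integers k) as [c [Hc [N1 HN1]]].
    assert (Hb : forall n, (N + N1 + S k <= n)%nat ->
      (- INR (S k) + c <= r n (S (S k)) <= - INR k - c)%R)
      by (intros n Hn; apply (HN1 n); [lia | apply Hr | apply H0; lia]).
    assert (H1 : (- INR (S k) + c <= l)%R).
    { apply (is_lim_seq_le_loc (fun _ => - INR (S k) + c)%R (fun n => r n (S (S k)))
        (- INR (S k) + c)%R l); auto; [|apply is_lim_seq_const].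
      exists (N + N1 + S k)%nat; intros n Hn; apply Hb, Hn. }
    assert (H2 : (l <= - INR k - c)%R).
    { apply (is_lim_seq_le_loc (fun n => r n (S (S k))) (fun _ => - INR k - c)%R
        l (- INR k - c)%R); auto; [|apply is_lim_seq_const].
      exists (N + N1 + S k)%nat; intros n Hn; apply Hb, Hn. }
    change (- INR (S k) < l < - INR k)%R; lra.
Qed.

Lemma zero_location_decr (j : nat) (x y : R) :
  zero_location j x -> zero_location (S j) y -> (y < x)%R.
Proof.
  destruct j as [|[|k]]; intros Hx Hy; [simpl in *; lra | simpl in *; lra |].
  change (- INR (S k) < x < - INR k)%R in Hx.
  change (- INR (S (S k)) < y < - INR (S k))%R in Hy; lra.
Qed.

Lemma zero_location_noninteger (j : nat) (x : R) : zero_location j x -> ~ nonpos_integer x.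
Proof.
  rewrite nonpos_integer_R; intros H [i Hi]; assert (T := pos_INR i).
  destruct j as [|[|k]]; [simpl in H; lra | simpl in H; lra |].
  apply (zero_interval_noninteger (S (S k)) x H i Hi).
Qed.

Lemma strictly_decreasing_lt (u : nat -> R) :
  (forall k, (u (S k) < u k)%R) -> forall i j, (i < j)%nat -> (u j < u i)%R.
Proof.
  intros H i j Hij; induction Hij as [|j Hij IH]; auto.
  apply Rlt_trans with (1 := H j); auto.
Qed.

(** If u k = v i with i < k, then v i = u i by induction, against strict decrease; so i >= k and u k
    <= v k. The argument is symmetric. *)
Lemma decreasing_enumeration_unique (u v : nat -> R) :
  (forall k, (u (S k) < u k)%R) -> (forall k, (v (S k) < v k)%R) ->
  (forall x, (exists k, x = u k) <-> (exists k, x = v k)) -> forall k, u k = v k.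
Proof.
  intros Hu Hv H k; induction k as [k IH] using (well_founded_induction lt_wf).
  assert (Aux : forall a b : nat -> R, (forall k, (a (S k) < a k)%R) ->
    (forall k, (b (S k) < b k)%R) -> (forall i, (i < k)%nat -> a i = b i) ->
    (exists i, a k = b i) -> (a k <= b k)%R).
  { intros a b Ha Hb E [i Hi]; rewrite Hi; destruct (lt_eq_lt_dec i k) as [[C|C]|C].
    - assert (T := strictly_decreasing_lt a Ha i k C); rewrite (E i C) in T; lra.
    - subst; lra.
    - left; apply (strictly_decreasing_lt b Hb), C. }
  apply Rle_antisym.
  - apply Aux; auto; apply H; exists k; auto.
  - apply Aux; auto; [intros; symmetry; auto|]; apply H; exists k; auto.
Qed.

Lemma zero_array_decr (N : nat) (r : nat -> nat -> R) (n i j : nat) :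
  is_zero_array N r -> (i < j)%nat -> (r n j < r n i)%R.
Proof.
  intros [Hr _]; apply (strictly_decreasing_lt (r n)); intros k.
  assert (Hx := Hr n k); assert (Hy := Hr n (S k)).
  destruct k as [|[|k]]; [simpl in *; lra | simpl in *; lra |].
  change (- INR (S k) < r n (S (S k)) < - INR k)%R in Hx.
  change (- INR (S (S k)) < r n (S (S (S k))) < - INR (S k))%R in Hy; lra.
Qed.

(** Here |x| >= k - 2 >= (k + 1) / 4, with equality on the right at k = 3. The interval (-1, 0) of
    index 2 touches 0 and admits no such bound. *)
Lemma zero_interval_abs (k : nat) (x : R) : (3 <= k)%nat ->
  (- INR (k - 1) <= x <= - INR (k - 2))%R -> (1 / 4 * INR (S k) <= Cmod x)%R.
Proof.
  intros Hk Hx; rewrite Cmod_R, Rabs_left1 by (assert (T := pos_INR (k - 2)); lra).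
  rewrite !minus_INR in Hx by lia; rewrite S_INR.
  assert (T : (INR 3 <= INR k)%R) by (apply le_INR; auto); simpl in *; lra.
Qed.

Lemma zero_location_lower_bound (rho : nat -> R) : (forall j, zero_location j (rho j)) ->
  exists c, (0 < c)%R /\ forall k, (c * INR (S k) <= Cmod (rho k))%R.
Proof.
  intros H.
  assert (H0 : forall k, (0 < Cmod (rho k))%R).
  { intros k; apply Cmod_gt_0; intros E; apply (zero_location_noninteger k (rho k) (H k)).
    exists 0%nat; rewrite E; simpl; ring. }
  destruct (finite_positive_lower_bound (fun k => Cmod (rho k) / INR (S k))%R 3) as [e [He Hk]].
  { intros k; apply Rdiv_lt_0_compat; auto; apply INR_S_pos. }
  assert (R1 := Rmin_l e (1 / 4)); assert (R2 := Rmin_r e (1 / 4)).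
  exists (Rmin e (1 / 4)); split; [apply Rmin_glb_lt; lra|]; intros k.
  assert (HS := INR_S_pos k); destruct (le_lt_dec 3 k) as [C|C].
  - apply Rle_trans with (1 / 4 * INR (S k))%R; [apply Rmult_le_compat_r; lra|].
    apply zero_interval_abs; auto; specialize (H k); destruct k as [|[|k]]; try lia.
    change (- INR (S k) < rho (S (S k)) < - INR k)%R in H.
    replace (S (S k) - 1)%nat with (S k) by lia; replace (S (S k) - 2)%nat with k by lia; lra.
  - apply Rle_trans with (e * INR (S k))%R; [apply Rmult_le_compat_r; lra|].
    specialize (Hk k C); apply Rmult_le_reg_r with (/ INR (S k))%R;
      [apply Rinv_0_lt_compat; auto|].
    rewrite Rmult_assoc, Rinv_r, Rmult_1_r by lra; exact Hk.
Qed.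

Lemma trunc_limit_product (N : nat) (r : nat -> nat -> R) (rho : nat -> R) (z P : C) :
  is_zero_array N r -> (forall j, is_lim_seq (fun n => r n j) (rho j)) ->
  (forall j, zero_location j (rho j)) -> is_infprod (fun k => E1 (z / rho k)) P ->
  Ccv (fun n => trunc_poly n z * Cexp (- (z * ln (INR n))))
    (Cexp ((kappa + 2 * euler_const)%R * z) * P).
Proof.
  intros Hr Hlim Hrho HP.
  apply Ccv_ext_loc with (fun n => Cexp ((kappa + 2 * (harmonic n - ln (INR n)))%R * z)
    * Cprod (fun j => E1 (z / r n j)) (n + 2)).
  { exists N; intros n Hn; symmetry; apply trunc_poly_factorization.
    - intros j E; apply (zero_interval_noninteger j (r n j) (proj1 Hr n j) 0%nat).
      rewrite E; simpl; ring.
    - intros j Hj; assert (Hni := zero_interval_noninteger j (r n j) (proj1 Hr n j)).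
      assert (HniC : forall k, r n j + INR k <> 0)
        by (intros k E; rewrite <- RtoC_plus in E; apply RtoC_inj in E; apply (Hni k E)).
      rewrite trunc_poly_psi, psi_trunc_R, (proj2 Hr) by auto; unfold Cdiv; ring.
    - intros i j Hij; apply Rgt_not_eq, (zero_array_decr N r n i j Hr); lia. }
  apply Ccv_mult.
  - apply Ccv_Cexp, Ccv_mult; [|apply Ccv_const]; apply Ccv_RtoC.
    apply is_lim_seq_plus'; [apply is_lim_seq_const|].
    apply (is_lim_seq_scal_l _ 2%R euler_const), euler_const_lim.
  (* From index 3 on the zeros are bounded below uniformly in n; for the first three factors
     convergence is enough. *)
  - apply infprod_dominated with (v := fun k => E1 (z / rho k)) (K := 3%nat)
      (m := fun k => (2 * (Cmod z / (1 / 4)) ^ 2 * exp (Cmod z / (1 / 4)) * / INR (S k) ^ 2)%R);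
      auto.
    + apply ex_series_scal_inv_sqr.
    + intros n k Hk; apply E1_div_sub1; [lra|]; apply zero_interval_abs; auto.
      assert (T := proj1 Hr n k); destruct k as [|[|k]]; try lia.
      change (- INR (S k) < r n (S (S k)) < - INR k)%R in T.
      replace (S (S k) - 1)%nat with (S k) by lia; replace (S (S k) - 2)%nat with k by lia; lra.
    + intros k; apply Ccv_E1, Ccv_scal, Ccv_inv; [|apply Ccv_RtoC, Hlim].
      intros E; apply (zero_location_noninteger k (rho k) (Hrho k)); exists 0%nat.
      rewrite E; simpl; ring.
    + intros n; lia.
Qed.

(** For each n the term equals [psi_trunc n z] divided by Euler's quotient exactly: the factors n!,
    n^z and the rising product match. *)
Lemma trunc_limit_quotient (z : C) : ~ nonpos_integer z ->
  Ccv (fun n => trunc_poly n z * Cexp (- (z * ln (INR n)))) (psi_G z / Gamma z).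
Proof.
  intros Hz; destruct (Gamma_seq_cv z Hz) as [HG HG0].
  apply Ccv_ext with (fun n => psi_trunc n z * / Gamma_seq z n).
  - intros n; assert (Hk := fun k => nonpos_integer_neq z k Hz).
    rewrite trunc_poly_psi, rising_Cprod, Cexp_opp by auto; unfold Gamma_seq.
    assert (H1 := Cexp_neq_0 (z * ln (INR n))); assert (H2 := INR_fact_C n).
    assert (H3 : Cprod (fun k => z + INR k) (S n) <> 0) by (apply Cprod_neq_0; auto).
    field; auto.
  - apply Ccv_mult; [apply psi_G_limit, Hz | apply Ccv_inv; auto].
Qed.

Theorem mainTheorem6 (beta : nat -> R)
    (beta_decr : forall k : nat, (beta (S k) < beta k)%R)
    (beta_zeros : forall z : C,
       zero_of_psi_G z <-> exists k : nat, z = RtoC (beta k)) :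
  exists F : C -> C,
    entire F /\
    (forall z : C, ~ nonpos_integer z -> F z = psi_G z / Gamma z) /\
    (forall z : C,
       exists P : C,
         is_infprod (fun k => (1 - z / beta k) * Cexp (z / beta k)) P /\
         F z = Cexp ((2 * euler_const + / 2 * ln (2 * PI) - / 2)%R * z) * P).
Proof.
  destruct zero_array_exists as [N [r Hr]].
  destruct (limit_zeros N r Hr) as [rho Hrho].
  assert (Hlim := fun j => proj1 (Hrho j)); assert (Hloc := fun j => proj2 (Hrho j)).
  destruct (zero_location_lower_bound rho Hloc) as [c [Hc Hlow]].
  set (W := fun z => Clim_seq (Cprod (fun k => E1 (z / rho k)))).
  assert (HW : forall z, is_infprod (fun k => E1 (z / rho k)) (W z))
    by (intros z; apply infprod_Clim_seq, E1_infprod with c; auto).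
  set (b := (kappa + 2 * euler_const)%R).
  assert (HF : forall z, ~ nonpos_integer z -> Cexp (b * z) * W z = psi_G z / Gamma z).
  { intros z Hz; apply Ccv_unique with (2 := trunc_limit_quotient z Hz).
    apply trunc_limit_product with N r rho; auto. }
  (* Off the poles neither the exponential nor 1 / Gamma vanishes, so psi_G and the product have the
     same zeros. The converse direction relies on the limits [rho] not being non-positive
     integers. *)
  assert (Hzeros : forall z, zero_of_psi_G z <-> exists k, z = RtoC (rho k)).
  { intros z; assert (Hz0 : forall k, E1 (z / rho k) = 0 <-> z = rho k)
      by (intros k; apply E1_eq_0, (Cneq_pos_INR_mult c _ k); auto).
    split.
    - intros [Hz Hpsi]; specialize (HF z Hz); rewrite Hpsi in HF.
      replace (0 / Gamma z) with (RtoC 0) in HF by (unfold Cdiv; ring).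
      destruct (Cmult_integral _ _ HF) as [H|H]; [destruct (Cexp_neq_0 _ H)|].
      apply (infprod_eq_0 _ _ (HW z)) in H; destruct H as [k H]; exists k; apply Hz0, H.
    - intros [k Hk]; assert (Hz : ~ nonpos_integer z)
        by (rewrite Hk; apply zero_location_noninteger with k; auto).
      split; auto; destruct (Gamma_seq_cv z Hz) as [_ HG].
      assert (HW0 : W z = 0) by (apply (infprod_eq_0 _ _ (HW z)); exists k; apply Hz0, Hk).
      specialize (HF z Hz); rewrite HW0, Cmult_0_r in HF.
      replace (psi_G z) with (psi_G z / Gamma z * Gamma z) by (field; auto).
      rewrite <- HF; ring. }
  assert (Hbeta : forall k, beta k = rho k).
  { apply decreasing_enumeration_unique; auto.
    - intros k; apply zero_location_decr with k; auto.
    - intros x; split; intros [k Hk].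
      + destruct (proj1 (Hzeros x)) as [i Hi]; [apply beta_zeros; exists k; subst; auto|].
        exists i; apply RtoC_inj, Hi.
      + destruct (proj1 (beta_zeros x)) as [i Hi]; [apply Hzeros; exists k; subst; auto|].
        exists i; apply RtoC_inj, Hi. }
  exists (fun z => Cexp (b * z) * W z); split; [|split; auto].
  (* Differentiability is taken from the product and not from the quotient, and so covers the
     non-positive integers. *)
  - intros z; destruct (E1_product_Cdiff (fun k => RtoC (rho k)) c W z Hc Hlow HW) as [l Hl].
    assert (Hb : Cdiff (fun x => b * x) z (b + 2 * 0 * z)).
    { apply Cdiff_ext with (2 := Cdiff_quadratic 0 b 0 z); intros x; ring. }
    eexists; apply Cdiff_is_derive, (Cdiff_mult (fun x => Cexp (b * x)) W);
      [apply (Cdiff_Cexp (fun x => b * x)), Hb | exact Hl].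
  - intros z; exists (W z); split.
    + destruct (HW z) as [M [q [Hq [Hq1 Hq2]]]]; exists M, q; split; auto; split.
      * apply Ccv_filterlim in Hq1; apply Ccv_filterlim.
        apply Ccv_ext with (2 := Hq1); intros n; apply Cprod_ext; intros k _.
        rewrite Hbeta; reflexivity.
      * rewrite Hq2; f_equal; apply Cprod_ext; intros k _; rewrite Hbeta; reflexivity.
    + replace (2 * euler_const + / 2 * ln (2 * PI) - / 2)%R with b
        by (unfold b, kappa; field); reflexivity.
Qed.
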